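(* Let $f,g$ be nonsquare elements of $\mathbb C(y)$. Then the following assertions are equivalent: (1) $\mathbb T_f$ and $\mathbb T_g$ are conjugate in $\mathrm{Bir}(\mathbb P^2)$; (2) $\mathbb T_f$ and $\mathbb T_g$ are conjugate in $\mathrm{Jonq}$; (3) $\mathbb T_f$ and $\mathbb T_g$ are conjugate by an element of $\mathbb C(y)^*\rtimes\mathrm{PGL}_2$; (4) $f$ and $g$ are in the same orbit for the action of $\mathbb C(y)^*\rtimes\mathrm{PGL}_2$ on $\mathbb C(y)$; (5) the involutions $\iota_f$ and $\iota_g$ are conjugate in $\mathrm{Bir}(\mathbb P^2)$; (6) the fields $\mathbb C(y)[\sqrt f]$ and $\mathbb C(y)[\sqrt g]$ are $\mathbb C$-isomorphic; (7) there exists $\mu\in\mathrm{Aut}(\mathbb P^1)$ such that $S_{\rm odd}(g)=\mu\big(S_{\rm odd}(f)\big)$; (8) the hyperelliptic curves associated with $x^2=f(y)$ and $x^2=g(y)$ are isomorphic.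
   Context: $\mathrm{Bir}(\mathbb P^2)$ is the group of birational transformations of the complex projective plane, identified with $\mathrm{Bir}(\mathbb A^2)$ via $(x,y)\mapsto[x:y:1]$. $\mathrm{PGL}_2=\mathrm{PGL}_2(\mathbb C)$, identified with $\mathrm{Aut}(\mathbb P^1)$. $\mathrm{Jonq}=\mathrm{PGL}_2(\mathbb C(y))\rtimes\mathrm{PGL}_2$ is the subgroup of maps $(x,y)\dashrightarrow\left(\frac{\alpha(y)x+\beta(y)}{\gamma(y)x+\delta(y)},\frac{ay+b}{cy+d}\right)$ with $\begin{pmatrix}\alpha&\beta\\ \gamma&\delta\end{pmatrix}\in\mathrm{PGL}_2(\mathbb C(y))$, $\begin{pmatrix}a&b\\ c&d\end{pmatrix}\in\mathrm{PGL}_2$; the factor $\mathrm{PGL}_2(\mathbb C(y))$ consists of those maps with second component $y$. For a nonsquare $f\in\mathbb C(y)$: $\mathbb T_f=\left\{\begin{pmatrix}a&bf\\ b&a\end{pmatrix}: a,b\in\mathbb C(y),\ (a,b)\neq(0,0)\right\}\subseteq\mathrm{PGL}_2(\mathbb C(y))$, and $\iota_f=\begin{pmatrix}0&f\\1&0\end{pmatrix}\in \mathbb T_f$, i.e. $\iota_f\colon(x,y)\dashrightarrow(f(y)/x,y)$. $\mathbb C(y)^*\rtimes\mathrm{PGL}_2\subseteq\mathrm{Jonq}$ is the subgroup of transformations $\varphi=(\lambda(y)x,\mu(y))$ with $\lambda\in\mathbb C(y)^*$, $\mu\in\mathrm{PGL}_2$. It acts on $\mathbb C(y)$ by $\varphi.f=(\lambda^2f)\circ\mu^{-1}$.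 For $f\in\mathbb C(y)^*$, $S_{\rm odd}(f)=\{a\in\mathbb P^1: v_a(f)\text{ is odd}\}$, where $v_a(f)$ is the order of vanishing of $f$ at $a$ (negative at poles). The hyperelliptic curve associated with $x^2=f(y)$ is the smooth projective complex curve with function field $\mathbb C(y)[\sqrt f]$ (genus $0$ and $1$ are allowed). *)

(* Defs.v *)
From HB Require Import structures.
From mathcomp Require Import all_boot all_order all_algebra all_field.
From mathcomp Require Import boolp classical_sets cardinality reals.
From mathcomp Require Import complex.
Set Implicit Arguments.
Unset Strict Implicit.
Unset Printing Implicit Defensive.
Import Order.TTheory GRing.Theory Num.Theory.
Local Open Scope classical_set_scope.
Local Open Scope ring_scope.

(* The value h(t) = n(t) / d(t) of a rational function h = n / d, with the
   coefficients of n and d mapped along c. This is meaningful when d(t) != 0,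
   and it is independent of the chosen fraction when t is transcendental over
   the image of c, which is the case in every use below.                    *)
Definition evalf (k L : fieldType) (c : k -> L) (t : L)
    (h : {fraction {poly k}}) : L :=
  (map_poly c \n_(repr h)).[t] / (map_poly c \d_(repr h)).[t].

Definition mx2 (K : fieldType) (a b c d : K) : 'M[K]_2 :=
  \matrix_(i, j) if i == 0 then (if j == 0 then a else b)
                 else (if j == 0 then c else d).

Definition homography (K : fieldType) (M : 'M[K]_2) (t : K) : K :=
  (M 0 0 * t + M 0 1) / (M 1 0 * t + M 1 1).

(* The action of PGL_2(k) on the projective line option k, None being the
   point at infinity [1 : 0]. An element of PGL_2 is given by an invertible
   matrix, of which only the class modulo scalars matters.                  *)
Definition mobius (k : fieldType) (M : 'M[k]_2) (z : option k) : option k :=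
  match z with
  | Some t => if M 1 0 * t + M 1 1 == 0 then None else Some (homography M t)
  | None => if M 1 0 == 0 then None else Some (M 0 0 / M 1 0)
  end.

Section RationalFunctions.
Variable k : fieldType.

(* k(y) *)
Definition fun1 : fieldType := {fraction {poly k}}.
(* k(x, y), as k(y)(x) *)
Definition fun2 : fieldType := {fraction {poly fun1}}.

Definition const1 : k -> fun1 := @FracField.tofrac {poly k} \o polyC.
Definition fun1_to_fun2 : fun1 -> fun2 :=
  @FracField.tofrac {poly fun1} \o polyC.
Definition const2 : k -> fun2 := fun1_to_fun2 \o const1.

Definition y1 : fun1 := FracField.tofrac 'X.
Definition x2 : fun2 := FracField.tofrac 'X.
Definition y2 : fun2 := fun1_to_fun2 y1.

(* The rational map (x, y) |--> (phi.1(x, y), phi.2(x, y)) of the affine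
   plane to itself.                                                         *)
Definition ratmap : Type := (fun2 * fun2)%type.

Definition idmap : ratmap := (x2, y2).

(* p(phi.1, phi.2) != 0 for every nonzero polynomial p in k[y][x] *)
Definition dominant (phi : ratmap) : Prop :=
  forall p : {poly {poly k}}, p != 0 ->
    (map_poly (fun q => (map_poly const2 q).[phi.2]) p).[phi.1] != 0.

(* F(psi.1, psi.2), for psi dominant *)
Definition subst (psi : ratmap) (F : fun2) : fun2 :=
  evalf (evalf const2 psi.2) psi.1 F.

(* phi after psi, for psi dominant *)
Definition ratcomp (phi psi : ratmap) : ratmap :=
  (subst psi phi.1, subst psi phi.2).

Definition inverse_maps (phi psi : ratmap) : Prop :=
  [/\ dominant phi, dominant psi, ratcomp phi psi = idmap
    & ratcomp psi phi = idmap].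

Definition Bir : set ratmap := [set phi | exists psi, inverse_maps phi psi].

Definition jonq_map (A : 'M[fun1]_2) (M : 'M[k]_2) : ratmap :=
  (homography (map_mx fun1_to_fun2 A) x2, homography (map_mx const2 M) y2).

Definition Jonq : set ratmap :=
  [set phi | exists A M,
     [/\ A \in unitmx, M \in unitmx & phi = jonq_map A M]].

Definition scaling_map (lambda : fun1) (M : 'M[k]_2) : ratmap :=
  (fun1_to_fun2 lambda * x2, homography (map_mx const2 M) y2).

(* k(y)^* ><| PGL_2 *)
Definition scaling_PGL2 : set ratmap :=
  [set phi | exists lambda M,
     [/\ lambda != 0, M \in unitmx & phi = scaling_map lambda M]].

(* The inclusion of PGL_2(k(y)) in Jonq *)
Definition fibre_map (A : 'M[fun1]_2) : ratmap :=
  (homography (map_mx fun1_to_fun2 A) x2, y2).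

Definition torus (f : fun1) : set ratmap :=
  [set tau | exists a b : fun1,
     (a, b) != (0, 0) /\ tau = fibre_map (mx2 a (b * f) b a)].

Definition iota_inv (f : fun1) : ratmap := fibre_map (mx2 0 f 1 0).

(* Subsets A and B of Bir are conjugate by an element of the subgroup G. *)
Definition conjugate_in (G A B : set ratmap) : Prop :=
  exists phi psi, [/\ G phi, inverse_maps phi psi
    & [set ratcomp phi (ratcomp tau psi) | tau in A] = B].

Definition conjugate_elts_in (G : set ratmap) (s t : ratmap) : Prop :=
  exists phi psi, [/\ G phi, inverse_maps phi psi
    & ratcomp phi (ratcomp s psi) = t].

(* phi.f = (lambda^2 f) o mu^-1 for phi = (lambda(y) x, mu(y)) *)
Definition scaling_act (lambda : fun1) (M : 'M[k]_2) (f : fun1) : fun1 :=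
  evalf const1 (homography (map_mx const1 (invmx M)) y1) (lambda ^+ 2 * f).

Definition same_orbit (f g : fun1) : Prop :=
  exists lambda M, [/\ lambda != 0, M \in unitmx & g = scaling_act lambda M f].

(* The order of vanishing of f != 0 *)
Definition ord_at (a : option k) (f : fun1) : int :=
  let n := \n_(repr f) in let d := \d_(repr f) in
  match a with
  | Some t => (mup t n)%:Z - (mup t d)%:Z
  | None => (size d)%:Z - (size n)%:Z
  end.

Definition Sodd (f : fun1) : set (option k) :=
  [set a | odd `|ord_at a f|%N].

Definition nonsquare (f : fun1) : Prop := forall h : fun1, f != h ^+ 2.

Lemma nonsquare_irreducible (f : fun1) :
  nonsquare f -> monic_irreducible_poly ('X^2 - f%:P).
Proof.
move=> hf.
have sz : size ('X^2 - f%:P : {poly fun1}) = 3%N by rewrite size_XnsubC.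
split; last by rewrite monicXnsubC.
apply: cubic_irreducible; first by rewrite sz.
move=> h; rewrite /root !hornerE subr_eq0 eq_sym; exact: hf.
Qed.

(* k(y)[sqrt f] *)
Definition sqrt_ext (f : fun1) (hf : nonsquare f) : fieldType :=
  {poly %/ ('X^2 - f%:P) with nonsquare_irreducible hf}.

Definition sqrt_const (f : fun1) (hf : nonsquare f) (a : k) : sqrt_ext hf :=
  qpolyC ('X^2 - f%:P) (const1 a).

End RationalFunctions.

Arguments Bir k : clear implicits.
Arguments Jonq k : clear implicits.
Arguments scaling_PGL2 k : clear implicits.

Definition field_iso_over (k K L : fieldType) (c : k -> K) (d : k -> L) :
    Prop :=
  exists u : {rmorphism K -> L}, bijective u /\ forall a, u (c a) = d a.

(* The smooth projective curve over an algebraically closed field k whose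
   function field is K, where K is a function field of one variable over k via
   c : k -> K: its points are the discrete valuation rings of K / k, its
   closed subsets are the finite ones and the whole curve, and the regular
   functions on an open set U are the elements s of K which belong to the
   valuation rings of all the points P of U, seen as functions U -> k through
   the residue fields (Hartshorne, Algebraic Geometry, I.6).                *)
Section Curve.
Variables (k K : fieldType) (c : k -> K).

Definition is_dvr (O : set K) : Prop :=
  exists v : K -> int,
    [/\ exists2 t, t != 0 & v t = 1,
        forall s t, s != 0 -> t != 0 -> v (s * t) = v s + v t,
        forall s t, s != 0 -> t != 0 -> s + t != 0 ->
          Order.min (v s) (v t) <= v (s + t),
        forall a, a != 0 -> v (c a) = 0
      & O = [set s | s = 0 \/ 0 <= v s]].

Definition curve : Type := {O : set K | is_dvr O}.

Definition max_ideal (P : curve) : set K :=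
  [set s | sval P s /\ (s = 0 \/ ~ sval P s^-1)].

Definition curve_open (U : set curve) : Prop :=
  U = set0 \/ finite_set (~` U).

Definition regular (U : set curve) (h : curve -> k) : Prop :=
  exists s : K, forall P, U P -> max_ideal P (s - c (h P)).

End Curve.

Section CurveMorphisms.
Variables (k K L : fieldType) (c : k -> K) (d : k -> L).

Definition curve_morphism (F : curve c -> curve d) : Prop :=
  (forall V, curve_open V -> curve_open (F @^-1` V)) /\
  (forall V h, curve_open V -> regular V h -> regular (F @^-1` V) (h \o F)).

End CurveMorphisms.

Definition curve_iso (k K L : fieldType) (c : k -> K) (d : k -> L) : Prop :=
  exists (F : curve c -> curve d) (G : curve d -> curve c),
    [/\ cancel F G, cancel G F, curve_morphism F & curve_morphism G].

(* Main.v *)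
(* The equivalences follow from the cycle (1) => (5) => (6) => (4) => (3) =>
   (2) => (1), together with (4) <=> (7) and (6) <=> (8).
   - (1) => (5): iota_g is the only involution of the torus of g.
   - (5) => (6): the curve x^2 = f(y), which is fixed by iota_f, defines a
     discrete place of C(x, y) with residue field K_f = C(y)[sqrt f], on which
     iota_f acts trivially. Transported by the conjugation, it becomes a place
     on which iota_g acts trivially. If y is residually transcendental, this
     place lies over the fixed curve of iota_g, so that K_f and K_g are
     isomorphic; otherwise a sequence of blow-ups shows that K_f is rational.
     By symmetry, either K_f and K_g are isomorphic, or both are rational.
   - (6) => (4): let z and eta be the two generators of the quadratic subfields
     in the common field. If C(z) = C(eta), they differ by a homography.
     Otherwise, by Gauss' lemma, they satisfy a relation of bidegree (2, 2),
     whose discriminants in eta and z are quartics equal to f and g up to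
     squares. The two quartics have the same invariants I and J, and these
     determine the orbit of a nonsquare quartic through its depressed cubic.
   - (4) <=> (7): over an algebraically closed field, a rational function all
     of whose orders are even is a square.
   - (8) => (6): a function is determined by its values at almost all points,
     so that an isomorphism of curves induces one of function fields. This
     needs infinitely many points, residue fields C and finitely many poles;
     the latter holds since three distinct points over y = 0 would give three
     linearly independent elements of a quadratic extension of C(y). *)

From HB Require Import structures.
Require Import Defs.
From mathcomp Require Import all_boot all_order all_algebra all_field.
From mathcomp Require Import boolp classical_sets cardinality reals complex.
From mathcomp Require Import ring zify.

Set Implicit Arguments.
Unset Strict Implicit.
Unset Printing Implicit Defensive.
Import Order.TTheory GRing.Theory Num.Theory.
Local Open Scope classical_set_scope.
Local Open Scope ring_scope.

(** * Fractions and birational maps as field morphisms *)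

(** Composition of rational maps is a substitution in chosen fractions, which is hard to compute
    with. A rational map is therefore replaced by the endomorphism of C(x, y) that it induces, and
    two such endomorphisms agree once they agree on constants, x and y. Dominance is what makes the
    endomorphism exist. No surface is constructed either. The fixed curve is followed as a discrete
    valuation with a residue map, which every automorphism of C(x, y) transports. The obstacle is
    that a birational map may contract this curve to a point or move it into a fibre of y; only
    rational curves can suffer this, whence the two alternatives of the residue field argument. For
    (6) => (4), the usual proof distinguishes genus 0, genus 1 (j-invariant) and higher genus
    (uniqueness of the hyperelliptic involution). Here the only distinction is whether the two
    quadratic subfields coincide. The equality of the invariants of the two discriminants of a (2,
    2) form is a polynomial identity. A quartic that is not a square has a simple root; once this
    root is at infinity, I and J are, up to constants and a weighted scaling, the coefficients p and
    q of y^3 + p y + q. *)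

Lemma frac_repr (A : idomainType) (h : {fraction A}) :
  \d_(repr h) != 0 /\
  h = FracField.tofrac \n_(repr h) / FracField.tofrac \d_(repr h).
Proof.
split; first exact: denom_ratioP.
have hd : FracField.tofrac \d_(repr h) != 0 by rewrite tofrac_eq0 denom_ratioP.
apply: (canRL (mulfK hd)).
move: (repr h) (reprK h) {hd} => x <-.
rewrite -[LHS]/(FracField.mul _ _) !piE.
apply/eqmodP; rewrite /= FracField.equivfE /FracField.mulf.
by rewrite !numden_Ratio ?mulf_neq0 ?oner_eq0 ?denom_ratioP // !mulr1 mulrC.
Qed.

Lemma fracP (A : idomainType) (h : {fraction A}) :
  exists n d, d != 0 /\ h = FracField.tofrac n / FracField.tofrac d.
Proof. by have [? ?] := frac_repr h; exists \n_(repr h), \d_(repr h). Qed.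

Lemma subf_div (F : fieldType) (a b c d : F) : b != 0 -> d != 0 ->
  a / b - c / d = (a * d - c * b) / (b * d).
Proof. by move=> bn0 dn0; rewrite -mulNr addf_div // mulNr. Qed.

Section MorphismInstances.
Variable k : fieldType.

HB.instance Definition _ := GRing.RMorphism.copy (@const1 k)
  (@FracField.tofrac {poly k} \o polyC).
HB.instance Definition _ := GRing.RMorphism.copy (@fun1_to_fun2 k)
  (@FracField.tofrac {poly fun1 k} \o polyC).
HB.instance Definition _ := GRing.RMorphism.copy (@const2 k)
  (@fun1_to_fun2 k \o @const1 k).

End MorphismInstances.

Section Evaluation.
Variables (k L : fieldType).

Definition transcendental (c : k -> L) (t : L) := ~ algebraicOver c t.

Lemma eq_evalf (c d : k -> L) t : c =1 d -> evalf c t =1 evalf d t.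
Proof. by move=> cd h; rewrite /evalf !(eq_map_poly cd). Qed.

Lemma transcendental_eval (c : {rmorphism k -> L}) t (p : {poly k}) :
  transcendental c t -> ((map_poly c p).[t] == 0) = (p == 0).
Proof.
move=> tr; apply/eqP/eqP => [p0|->]; last by rewrite rmorph0 horner0.
by apply/eqP/negPn/negP => pn0; apply: tr; exists p => //; apply/rootP.
Qed.

Lemma transcendentalP (c : {rmorphism k -> L}) t :
  (forall p : {poly k}, p != 0 -> (map_poly c p).[t] != 0) ->
  transcendental c t.
Proof. by move=> H [p /H pn0 /rootP p0]; rewrite p0 eqxx in pn0. Qed.

Lemma morph_fracE (u : {rmorphism {fraction {poly k}} -> L}) (p : {poly k}) :
  u (FracField.tofrac p) =
  (map_poly (fun a => u (FracField.tofrac a%:P)) p).[u (FracField.tofrac 'X)].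
Proof.
rewrite -[in LHS](coefK p) poly_def !raddf_sum /=.
rewrite /map_poly horner_poly; apply: eq_bigr => i _.
by rewrite -mul_polyC !rmorphM !rmorphXn.
Qed.

(** A morphism out of [k(y)] is known from the constants and the image of y. This is the bridge from
    [evalf], in which the definitions are written, to morphisms. *)
Lemma morph_evalf (u : {rmorphism fun1 k -> L}) h :
  u h = evalf (u \o @const1 k) (u (@y1 k)) h.
Proof.
have [_ {1}->] := frac_repr h.
by rewrite fmorph_div /evalf; congr (_ / _); apply: morph_fracE.
Qed.

Lemma eq_fun1_morph (u v : {rmorphism fun1 k -> L}) :
  u \o @const1 k =1 v \o @const1 k -> u (@y1 k) = v (@y1 k) -> u =1 v.
Proof.
move=> uv uvy h; rewrite [LHS]morph_evalf [RHS]morph_evalf uvy.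
exact: eq_evalf.
Qed.

Lemma evalf_frac (c : {rmorphism k -> L}) t (n d : {poly k}) :
  transcendental c t -> d != 0 ->
  evalf c t (FracField.tofrac n / FracField.tofrac d) =
  (map_poly c n).[t] / (map_poly c d).[t].
Proof.
move=> tr dn0; set h := _ / _; have [d'n0 hE] := frac_repr h.
rewrite /evalf; move: \n_(repr h) \d_(repr h) d'n0 hE => n' d' d'n0.
rewrite /h => /eqP; rewrite eqr_div ?tofrac_eq0 // -!rmorphM tofrac_eq.
move=> /eqP E; apply/eqP; rewrite eqr_div ?transcendental_eval //.
by rewrite -!hornerM -!rmorphM -E.
Qed.

Lemma evalf_const (c : {rmorphism k -> L}) t a :
  transcendental c t -> evalf c t (const1 a) = c a.
Proof.
move=> tr; rewrite -[const1 a]divr1 -[1](rmorph1 (@FracField.tofrac {poly k})).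
by rewrite evalf_frac ?oner_eq0 // rmorph1 hornerC divr1 map_polyC hornerC.
Qed.

Lemma evalf_y1 (c : {rmorphism k -> L}) t :
  transcendental c t -> evalf c t (y1 k) = t.
Proof.
move=> tr; rewrite -[y1 k]divr1 -[1](rmorph1 (@FracField.tofrac {poly k})).
by rewrite evalf_frac ?oner_eq0 // rmorph1 hornerC divr1 map_polyX hornerX.
Qed.

(** Transcendence keeps denominators from vanishing. This is where morphisms out of [k(y)] come from
    and, with [k(y)] in the role of [k], those out of [k(x, y)]. *)
Lemma evalf_rmorphism (c : {rmorphism k -> L}) t : transcendental c t ->
  {u : {rmorphism fun1 k -> L} | u =1 evalf c t}.
Proof.
move=> tr; have ev := evalf_frac _ tr.
have uB : zmod_morphism (evalf c t : fun1 k -> L).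
  move=> x y; have [n [d [dn0 ->]]] := fracP x; have [m [e [en0 ->]]] := fracP y.
  have -> : FracField.tofrac n / FracField.tofrac d
     - FracField.tofrac m / FracField.tofrac e =
     FracField.tofrac (n * e - m * d) / FracField.tofrac (d * e).
    by rewrite rmorphB !rmorphM subf_div ?tofrac_eq0.
  rewrite !ev ?mulf_neq0 // rmorphB !rmorphM hornerD hornerN !hornerM.
  by rewrite subf_div ?transcendental_eval.
have uM : monoid_morphism (evalf c t : fun1 k -> L).
  split; first by rewrite -(rmorph1 (@const1 k)) evalf_const ?rmorph1.
  move=> x y; have [n [d [dn0 ->]]] := fracP x; have [m [e [en0 ->]]] := fracP y.
  rewrite mulf_div -!rmorphM !ev ?mulf_neq0 // !rmorphM !hornerM.
  by rewrite mulf_div.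
pose u : {rmorphism fun1 k -> L} := HB.pack (evalf c t : fun1 k -> L)
  (GRing.isZmodMorphism.Build _ _ _ uB) (GRing.isMonoidMorphism.Build _ _ _ uM).
by exists u.
Qed.

End Evaluation.

Lemma frac_poly_ind (K : fieldType) (P : {fraction {poly K}} -> Prop) :
  (forall a, P (FracField.tofrac a%:P)) -> P (FracField.tofrac 'X) ->
  (forall s t, P s -> P t -> P (s + t)) ->
  (forall s t, P s -> P t -> P (s * t)) -> (forall s, P s -> P s^-1) ->
  forall z, P z.
Proof.
move=> Pc PX PD PM PV.
have Pp p : P (FracField.tofrac p).
  elim/poly_ind: p => [|p a IH]; first exact: (Pc 0).
  by rewrite rmorphD rmorphM; apply: PD (Pc _); apply: PM.
by move=> z; have [n [d [_ ->]]] := fracP z; apply: PM => //; apply: PV.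
Qed.

Lemma fun2_ind (k : fieldType) (P : fun2 k -> Prop) :
  (forall a, P (const2 a)) -> P (x2 k) -> P (y2 k) ->
  (forall s t, P s -> P t -> P (s + t)) ->
  (forall s t, P s -> P t -> P (s * t)) -> (forall s, P s -> P s^-1) ->
  forall z, P z.
Proof.
move=> Pc Px Py PD PM PV.
apply: (@frac_poly_ind (fun1 k) P _ Px PD PM PV).
apply: (@frac_poly_ind k (fun q => P (fun1_to_fun2 q))).
- exact: Pc.
- exact: Py.
- move=> s t Ps Pt.
  exact: (eq_ind_r P (PD _ _ Ps Pt) (rmorphD (@fun1_to_fun2 k) s t)).
- move=> s t Ps Pt.
  exact: (eq_ind_r P (PM _ _ Ps Pt) (rmorphM (@fun1_to_fun2 k) s t)).
- move=> s Ps.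
  exact: (eq_ind_r P (PV _ Ps) (fmorphV (@fun1_to_fun2 k) s)).
Qed.

Lemma clear_denominators (A : idomainType) (p : {poly {fraction A}}) :
  exists d q, d != 0 /\
    FracField.tofrac d *: p = map_poly (@FracField.tofrac A) q.
Proof.
elim/poly_ind: p => [|p c [d [q [dn0 E]]]].
  by exists 1, 0; rewrite oner_eq0 scaler0 rmorph0.
have [n [e [en0 ->]]] := fracP c.
exists (d * e), (e%:P * q * 'X + (d * n)%:P); split; first exact: mulf_neq0.
have aux (F : fieldType) (r s : {poly F}) (x y z : F) : z != 0 ->
    x *: r = s -> (x * z) *: (r * 'X + (y / z)%:P) = z%:P * s * 'X + (x * y)%:P.
  move=> zn0 <-; rewrite scalerDr -!mul_polyC -polyCM.
  have -> : x * z * (y / z) = x * y by field.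
  by rewrite polyCM; ring.
rewrite rmorphD !rmorphM /= map_polyX !map_polyC /=.
rewrite -!polyCM; apply: (aux _ p _ (FracField.tofrac d)) => //.
by rewrite tofrac_eq0.
Qed.

Lemma y1_transcendental (k : fieldType) : transcendental (@const1 k) (y1 k).
Proof.
move=> [p pn0 /rootP E].
have F : FracField.tofrac p = 0 :> fun1 k.
  by transitivity ((map_poly (@const1 k) p).[y1 k]); first exact: (morph_fracE idfun).
by move/eqP: F; rewrite tofrac_eq0 (negPf pn0).
Qed.

Lemma transcendental_morph (k L L' : fieldType) (c : {rmorphism k -> L})
    (u : {rmorphism L -> L'}) t :
  transcendental c t -> transcendental (u \o c) (u t).
Proof.
move=> tr [p pn0]; rewrite map_poly_comp fmorph_root => p0.
by apply: tr; exists p.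
Qed.

Section BivariateEvaluation.
Variables (k L : fieldType) (c : {rmorphism k -> L}) (s t : L).

Definition algebraically_independent :=
  forall p : {poly {poly k}}, p != 0 ->
    (map_poly (fun q => (map_poly c q).[t]) p).[s] != 0.

Lemma independent_transcendental :
  algebraically_independent -> transcendental c t.
Proof.
move=> dom; apply: transcendentalP => q qn0.
have := dom q%:P; rewrite polyC_eq0 => /(_ qn0).
have -> : map_poly (fun q => (map_poly c q).[t]) q%:P = ((map_poly c q).[t])%:P.
  exact: (map_polyC (horner_eval t \o map_poly c)).
by rewrite hornerC.
Qed.

Lemma morph_tofracE (m : {rmorphism fun1 k -> L}) q :
  m \o @const1 k =1 c -> m (y1 k) = t ->
  m (FracField.tofrac q) = (map_poly c q).[t].
Proof.
move=> mc my; rewrite (morph_fracE m) -/(@y1 k) my; congr (_ .[_]).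
by apply: eq_map_poly => a; rewrite -mc.
Qed.

(** With [m] embedding [k(y)] as [k(t)], independence of [s] and [t] becomes transcendence of [s]
    over [k(t)]: denominators in [k[t]] can be cleared. *)
Lemma independentP (m : {rmorphism fun1 k -> L}) :
  m \o @const1 k =1 c -> m (y1 k) = t ->
  algebraically_independent <-> transcendental m s.
Proof.
move=> mc my.
have E q : map_poly (fun q => (map_poly c q).[t]) q =
           map_poly m (map_poly (@FracField.tofrac _) q).
  rewrite -map_poly_comp; apply: eq_map_poly => r.
  by symmetry; apply: morph_tofracE.
split=> [dom|tr p pn0].
  apply: transcendentalP => p pn0.
  have [d [q [dn0 F]]] := clear_denominators p.
  have qn0 : q != 0.
    apply: contra_neq pn0 => q0; move: F; rewrite q0 rmorph0 => /eqP.
    by rewrite scaler_eq0 tofrac_eq0 (negPf dn0) => /eqP.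
  have := dom q qn0; rewrite E -F linearZ /= hornerZ.
  by apply: contraNneq => ->; rewrite mulr0.
rewrite E transcendental_eval //.
by rewrite map_poly_eq0_id0 // tofrac_eq0 lead_coef_eq0.
Qed.

End BivariateEvaluation.

Section Pullbacks.
Variable k : fieldType.

Lemma eq_fun2_morph (L : fieldType) (u v : {rmorphism fun2 k -> L}) :
  u \o @const2 k =1 v \o @const2 k -> u (x2 k) = v (x2 k) ->
  u (y2 k) = v (y2 k) -> u =1 v.
Proof.
move=> uvc uvx uvy; apply: fun2_ind => // [s t|s t|s] us.
- by move=> ut; rewrite !rmorphD us ut.
- by move=> ut; rewrite !rmorphM us ut.
- by rewrite !fmorphV us.
Qed.

(** The morphism [u] is F |-> F o psi, pinned down by its values on generators. *)
Definition is_pullback (u : {rmorphism fun2 k -> fun2 k}) (psi : ratmap k) :=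
  [/\ u \o @const2 k =1 @const2 k, u (x2 k) = psi.1 & u (y2 k) = psi.2].

Lemma is_pullback_subst u psi : is_pullback u psi -> subst psi =1 u.
Proof.
move=> [uc ux uy] F; rewrite /subst -ux.
transitivity (evalf (u \o @const1 (fun1 k)) (u (y1 (fun1 k))) F); last first.
  by symmetry; apply: morph_evalf.
apply: eq_evalf => q /=.
rewrite -uy.
transitivity (evalf ((u \o @fun1_to_fun2 k) \o @const1 k) (u (y2 k)) q).
  by apply: eq_evalf => a; symmetry; apply: uc.
symmetry; exact: (@morph_evalf k _ (u \o @fun1_to_fun2 k) q).
Qed.

Lemma x2_transcendental : transcendental (@fun1_to_fun2 k) (x2 k).
Proof. exact: (@y1_transcendental (fun1 k)). Qed.

(** Evaluation is extended in two stages, from [k] to [k(y)] by y |-> [psi.2], then to [k(y)(x)] by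
    x |-> [psi.1]; dominance supplies the transcendence needed at each stage. *)
Lemma pullback psi : dominant psi -> {u | is_pullback u psi}.
Proof.
move=> dom.
have tr2 : transcendental (@const2 k) psi.2.
  exact: (@independent_transcendental k (fun2 k) (@const2 k) psi.1 psi.2 dom).
have [m mE] := evalf_rmorphism tr2.
have mc : m \o @const1 k =1 @const2 k.
  by move=> a; rewrite [LHS]mE; apply: evalf_const.
have my : m (y1 k) = psi.2 by rewrite mE; apply: evalf_y1.
have tr1 : transcendental m psi.1.
  exact: (@independentP k (fun2 k) (@const2 k) psi.1 psi.2 m mc my).1 dom.
have [u uE] := evalf_rmorphism tr1.
have um q : u (fun1_to_fun2 q) = m q.
  by rewrite uE; apply: evalf_const.
exists u; split=> [a||].
- exact: etrans (um (const1 a)) (mc a).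
- by rewrite uE; apply: evalf_y1.
- exact: etrans (um (y1 k)) my.
Qed.

Lemma dominantP (u : {rmorphism fun2 k -> fun2 k}) psi :
  is_pullback u psi -> dominant psi.
Proof.
move=> [uc ux uy].
have tr : transcendental (u \o @fun1_to_fun2 k) psi.1.
  rewrite -ux.
  exact: (@transcendental_morph _ _ _ (@fun1_to_fun2 k) u (x2 k)
    x2_transcendental).
exact: (@independentP k (fun2 k) (@const2 k) psi.1 psi.2
  (u \o @fun1_to_fun2 k) uc uy).2 tr.
Qed.

(** Pulling back is contravariant, so the order of composition is reversed. *)
Lemma is_pullback_comp u v phi psi : is_pullback u phi -> is_pullback v psi ->
  is_pullback (v \o u) (ratcomp phi psi).
Proof.
move=> pu pv; have [uc ux uy] := pu; have [vc vx vy] := pv.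
have E := is_pullback_subst pv.
split=> [a||].
- exact: etrans (congr1 v (uc a)) (vc a).
- exact: etrans (congr1 v ux) (esym (E phi.1)).
- exact: etrans (congr1 v uy) (esym (E phi.2)).
Qed.

Lemma pullback_inj u phi psi : is_pullback u phi -> is_pullback u psi ->
  phi = psi.
Proof.
case: phi psi => [p1 p2] [q1 q2] [_ ux uy] [_ vx vy].
by congr (_, _); [exact: etrans (esym ux) vx | exact: etrans (esym uy) vy].
Qed.

Lemma eq_is_pullback (u v : {rmorphism fun2 k -> fun2 k}) psi :
  u =1 v -> is_pullback u psi -> is_pullback v psi.
Proof.
move=> uv [uc ux uy]; split=> [a||].
- exact: etrans (esym (uv _)) (uc a).
- exact: etrans (esym (uv _)) ux.
- exact: etrans (esym (uv _)) uy.
Qed.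

Lemma pullback_id : is_pullback idfun (idmap k).
Proof. by split. Qed.

Lemma inverse_mapsP u v phi psi : is_pullback u phi -> is_pullback v psi ->
  cancel u v -> cancel v u -> inverse_maps phi psi.
Proof.
move=> pu pv uv vu; split; [exact: dominantP pu | exact: dominantP pv | |].
  apply: pullback_inj (is_pullback_comp pu pv) _.
  by apply: eq_is_pullback pullback_id => z; rewrite [RHS]uv.
apply: pullback_inj (is_pullback_comp pv pu) _.
by apply: eq_is_pullback pullback_id => z; rewrite [RHS]vu.
Qed.

Lemma inverse_maps_pullbacks phi psi : inverse_maps phi psi ->
  exists u v, [/\ is_pullback u phi, is_pullback v psi,
                  cancel u v & cancel v u].
Proof.
move=> [/pullback [u pu] /pullback [v pv] E1 E2]; exists u, v.
have := is_pullback_comp pu pv; have := is_pullback_comp pv pu; rewrite E1 E2.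
move=> [c1 x1 y1] [c2 x2' y2']; split; [done | done | |].
  exact: (@eq_fun2_morph _ (v \o u) idfun c2 x2' y2').
exact: (@eq_fun2_morph _ (u \o v) idfun c1 x1 y1).
Qed.

End Pullbacks.

(** * Homographies and substitutions in [k(y)] *)

Section Homographies.
Variable K : fieldType.
Implicit Types (M N : 'M[K]_2) (t : K).

Lemma mulmx2E M N i j : (M *m N) i j = M i 0 * N 0 j + M i 1 * N 1 j.
Proof. by rewrite mxE !big_ord_recl big_ord0 addr0; congr (_ * _ + M i _ * N _ _); apply/val_inj. Qed.

Lemma unitmx2 M : (M \in unitmx) = (M 0 0 * M 1 1 - M 0 1 * M 1 0 != 0).
Proof.
rewrite unitmxE unitfE (expand_det_row _ 0) !big_ord_recl big_ord0 addr0.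
rewrite /cofactor !det_mx11 !mxE /= expr0 mul1r expr1 mulN1r mulrN.
congr (_ * M _ _ - M _ _ * M _ _ != 0); exact/val_inj.
Qed.

Lemma mx2E (a b c d : K) : [/\ mx2 a b c d 0 0 = a, mx2 a b c d 0 1 = b,
  mx2 a b c d 1 0 = c & mx2 a b c d 1 1 = d].
Proof. by split; rewrite mxE. Qed.

Lemma homographyE M t :
  homography M t = (M 0 0 * t + M 0 1) / (M 1 0 * t + M 1 1).
Proof. by []. Qed.

Lemma homography1 t : homography 1%:M t = t.
Proof. by rewrite homographyE !mxE /= mul1r mul0r add0r addr0 divr1. Qed.

Lemma homography_mul M N t : N 1 0 * t + N 1 1 != 0 ->
  homography M (homography N t) = homography (M *m N) t.
Proof.
move=> dn0; rewrite !homographyE !mulmx2E.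
rewrite -[LHS](mulr1) -(divff dn0) mulf_div.
by congr (_ / _); field.
Qed.

End Homographies.

Lemma map_homography (K L : fieldType) (u : {rmorphism K -> L}) M t :
  u (homography M t) = homography (map_mx u M) (u t).
Proof. by rewrite !homographyE fmorph_div !rmorphD !rmorphM !mxE. Qed.

Lemma rmorph_sqrM (K L : fieldType) (u : {rmorphism K -> L}) s t :
  u (s ^+ 2 * t) = u s ^+ 2 * u t.
Proof. by rewrite rmorphM rmorphXn. Qed.

Lemma rmorph_sqr_sqrM (K L : fieldType) (u : {rmorphism K -> L}) r s t :
  r ^+ 2 * u (s ^+ 2 * t) = (r * u s) ^+ 2 * u t.
Proof. by rewrite rmorph_sqrM mulrA -exprMn. Qed.

Lemma fmorph_neq0 (K L : fieldType) (u : {rmorphism K -> L}) s :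
  s != 0 -> u s != 0.
Proof. by rewrite fmorph_eq0. Qed.

Lemma rmorph_cancel_sqr (K L : fieldType) (u : {rmorphism K -> L}) s t :
  s != 0 -> (u s)^-1 ^+ 2 * u (s ^+ 2 * t) = u t.
Proof.
by move=> sn0; rewrite rmorph_sqr_sqrM mulVf ?fmorph_eq0 // expr1n mul1r.
Qed.

Section TranscendentalHomography.
Variables (k L : fieldType) (c : {rmorphism k -> L}) (t : L).
Hypothesis tr : transcendental c t.

Lemma transcendental_denominator (a b : k) :
  (a != 0) || (b != 0) -> c a * t + c b != 0.
Proof.
move=> ab; have -> : c a * t + c b = (map_poly c (a *: 'X + b%:P)).[t].
  by rewrite rmorphD /= map_polyZ /= map_polyX map_polyC hornerD hornerZ hornerX hornerC.
rewrite transcendental_eval //; apply: contraL ab => /eqP E.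
have := congr1 (fun p : {poly k} => p`_0) E.
have := congr1 (fun p : {poly k} => p`_1) E.
rewrite !coefD !coefZ !coefX !coefC /= mulr0 mulr1 addr0 add0r => -> ->.
by rewrite eqxx.
Qed.

Lemma unitmx_denominator (M : 'M[k]_2) : M \in unitmx ->
  map_mx c M 1 0 * t + map_mx c M 1 1 != 0.
Proof.
move=> uM; rewrite !mxE; apply: transcendental_denominator.
apply: contraTT uM; rewrite negb_or !negbK unitmx2 => /andP[/eqP -> /eqP ->].
by rewrite !mulr0 subrr negbK.
Qed.

(** The inverse homography recovers [t], so algebraicity of the image would pass back to [t]. *)
Lemma homography_transcendental (M : 'M[k]_2) : M \in unitmx ->
  transcendental c (homography (map_mx c M) t).
Proof.
move=> uM alg; apply: tr.
have -> : t = homography (map_mx c (invmx M)) (homography (map_mx c M) t).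
  by rewrite homography_mul ?unitmx_denominator // -map_mxM mulVmx // map_mx1 homography1.
rewrite homographyE !mxE.
by apply: algebraic_div; apply: algebraic_add; rewrite ?algebraic_id //;
  try (apply: algebraic_mul => //); apply: algebraic_id.
Qed.

Lemma transcendental_sub (m : {rmorphism k -> k}) : transcendental (c \o m) t.
Proof.
move=> [p pn0]; rewrite map_poly_comp => p0; apply: tr.
by exists (map_poly m p) => //; rewrite map_poly_eq0.
Qed.

End TranscendentalHomography.

Section Substitution.
Variable k : fieldType.

(** The morphism [u] is h |-> h o M, the one-variable analogue of [is_pullback]. *)
Definition is_substitution (M : 'M[k]_2) (u : {rmorphism fun1 k -> fun1 k}) :=
  u \o @const1 k =1 @const1 k /\
  u (y1 k) = homography (map_mx (@const1 k) M) (y1 k).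

Lemma substitution_ex M : M \in unitmx -> {u | is_substitution M u}.
Proof.
move=> uM; have tr := homography_transcendental (@y1_transcendental k) uM.
have [u uE] := evalf_rmorphism tr; exists u; split=> [a /=|].
  by rewrite uE; apply: evalf_const.
by rewrite uE; apply: evalf_y1.
Qed.

Lemma substitution_mul M N u v : N \in unitmx ->
  is_substitution M u -> is_substitution N v ->
  is_substitution (M *m N) (v \o u).
Proof.
move=> uN [uc uy] [vc vy]; split=> [a|].
  exact: etrans (congr1 v (uc a)) (vc a).
rewrite [LHS](congr1 v uy) map_homography vy -map_mx_comp (eq_map_mx _ vc).
rewrite homography_mul -?map_mxM //.
exact: unitmx_denominator (@y1_transcendental k) _ uN.
Qed.

Lemma substitution_id : is_substitution 1%:M idfun.
Proof. by split=> //; rewrite map_mx1 homography1. Qed.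

Lemma substitution_inj M u v :
  is_substitution M u -> is_substitution M v -> u =1 v.
Proof.
move=> [uc uy] [vc vy]; apply: eq_fun1_morph; last exact: etrans uy (esym vy).
by move=> a; apply: etrans (uc a) (esym (vc a)).
Qed.

Lemma substitution_evalf M u h : is_substitution M u ->
  evalf (@const1 k) (homography (map_mx (@const1 k) M) (y1 k)) h = u h.
Proof.
move=> [uc uy]; rewrite -uy [RHS]morph_evalf; apply: eq_evalf => a.
exact: esym (uc a).
Qed.

Lemma substitution_cancel M u v : M \in unitmx ->
  is_substitution M u -> is_substitution (invmx M) v ->
  cancel u v /\ cancel v u.
Proof.
move=> uM su sv; have uV : invmx M \in unitmx by rewrite unitmx_inv.
split=> h.
  have := substitution_mul uV su sv; rewrite mulmxV // => s1.
  exact: substitution_inj s1 substitution_id h.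
have := substitution_mul uM sv su; rewrite mulVmx // => s1.
exact: substitution_inj s1 substitution_id h.
Qed.

(** A form of the action that composes well: here [M] is the inverse of mu, [u] composes with it,
    and [b] is lambda o mu^-1. *)
Lemma same_orbitP (f g : fun1 k) : same_orbit f g <->
  exists M u b, [/\ M \in unitmx, is_substitution M u, b != 0
    & g = b ^+ 2 * u f].
Proof.
split=> [[l [M [ln0 uM ->]]]|[M [u [b [uM su bn0 ->]]]]].
  have uV : invmx M \in unitmx by rewrite unitmx_inv.
  have [u su] := substitution_ex uV.
  exists (invmx M), u, (u l).
  split; [exact: uV | exact: su | exact: fmorph_neq0 |].
  exact: etrans (substitution_evalf _ su) (rmorph_sqrM u l f).
have uV : invmx M \in unitmx by rewrite unitmx_inv.
have [v sv] := substitution_ex uV.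
have [_ vu] := substitution_cancel uM su sv.
exists (v b), (invmx M); split; [exact: fmorph_neq0 | exact: uV |].
rewrite /scaling_act invmxK.
apply: etrans (esym (substitution_evalf _ su)); rewrite [RHS]rmorph_sqrM.
by rewrite vu.
Qed.

Lemma same_orbit_trans (f g h : fun1 k) :
  same_orbit f g -> same_orbit g h -> same_orbit f h.
Proof.
move=> /same_orbitP[M [u [b [uM su bn0 ->]]]].
move=> /same_orbitP[N [v [d [uN sv dn0 ->]]]].
apply/same_orbitP; exists (M *m N), (v \o u), (d * v b); split.
- by rewrite unitmx_mul uM.
- exact: substitution_mul.
- exact: (mulf_neq0 dn0 (fmorph_neq0 v bn0)).
- exact: rmorph_sqr_sqrM.
Qed.

Lemma same_orbit_sym (f g : fun1 k) : same_orbit f g -> same_orbit g f.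
Proof.
move=> /same_orbitP[M [u [b [uM su bn0 ->]]]].
have uV : invmx M \in unitmx by rewrite unitmx_inv.
have [v sv] := substitution_ex uV.
have [uv _] := substitution_cancel uM su sv.
apply/same_orbitP; exists (invmx M), v, (v b)^-1.
split; [exact: uV | exact: sv | exact: (invr_neq0 (fmorph_neq0 v bn0)) |].
by rewrite (rmorph_cancel_sqr v (u f) bn0) uv.
Qed.

Lemma same_orbit_square (f b : fun1 k) : b != 0 -> same_orbit f (b ^+ 2 * f).
Proof.
move=> bn0; apply/same_orbitP; exists 1%:M, idfun, b.
by split; [exact: unitmx1 | exact: substitution_id | | ].
Qed.

(** Maps preserving the fibration by y: [m] acts on the base and [A] on the fibre. The identity for
    [m] gives the fibre maps, a substitution gives the scaling maps. *)
Lemma fibration_lift (m : {rmorphism fun1 k -> fun1 k}) (A : 'M[fun1 k]_2) :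
  A \in unitmx -> {u : {rmorphism fun2 k -> fun2 k} |
    u \o @fun1_to_fun2 k =1 @fun1_to_fun2 k \o m /\
    u (x2 k) = homography (map_mx (@fun1_to_fun2 k) A) (x2 k)}.
Proof.
move=> uA.
have tr := homography_transcendental (@x2_transcendental k) uA.
have trm := transcendental_sub (m := m) tr.
have [u uE] := evalf_rmorphism trm; exists u; split=> [a|].
  by rewrite [LHS]uE; apply: evalf_const.
by rewrite uE; apply: evalf_y1.
Qed.

End Substitution.

(** * Tori and involutions *)

(** Certificate for deducing one identity from another: the cofactor [c] is supplied by hand and
    [ring] checks the rest. *)
Lemma eq_of_diff (A : fieldType) (c s t s' t' : A) :
  s = t -> s' - t' = c * (s - t) -> s' = t'.
Proof. by move=> ->; rewrite subrr mulr0 => /eqP; rewrite subr_eq0 => /eqP. Qed.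

Arguments eq_of_diff {A} c {s t s' t'} _ _.

Section AbstractTorus.
Variables (K E : fieldType) (i : {rmorphism K -> E}) (x : E).
Hypothesis x_tr : transcendental i x.

Lemma transcendental_quadratic (a b c : K) :
  i a * x ^+ 2 + i b * x + i c = 0 -> [/\ a = 0, b = 0 & c = 0].
Proof.
move=> E0; have : (map_poly i (a *: 'X^2 + b *: 'X + c%:P)).[x] = 0.
  rewrite !rmorphD /= !map_polyZ /= map_polyXn map_polyX map_polyC.
  by rewrite !(hornerD, hornerZ, hornerC, hornerX, hornerXn).
move/eqP; rewrite transcendental_eval // => /eqP P0.
have := congr1 (fun p : {poly K} => p`_0) P0.
have := congr1 (fun p : {poly K} => p`_1) P0.
have := congr1 (fun p : {poly K} => p`_2) P0.
rewrite !coefD !coefZ !coefX !coefXn !coefC /= !mulr0 !mulr1 !addr0 !add0r.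
by [].
Qed.

(** Here K and E stand for C(y) and C(x, y). Conjugation by a scaling sends the element (a, b) of
    the torus of [f] to (u a, u b / l) in the torus of l^2 u(f). *)
Lemma conjugate_torus_elt (u : {rmorphism K -> K}) (V T : {rmorphism E -> E})
    (a b f m l : K) :
  V \o i =1 i \o u -> T \o i =1 i -> V x = i l^-1 * x ->
  T x = (i a * x + i (b * f)) / (i b * x + i a) -> u m = l -> l != 0 ->
  V (T (i m * x)) = (i (u a) * x + i (u b / l * (l ^+ 2 * u f))) /
                    (i (u b / l) * x + i (u a)).
Proof.
move=> Vi Ti Vx Tx um ln0.
rewrite rmorphM [T (i m)]Ti Tx !rmorphM fmorphV /= !rmorphD !rmorphM Vx.
have {}Vi s : V (i s) = i (u s) by exact: Vi.
rewrite !Vi um fmorphV mulrA.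
have iln0 : i l != 0 by rewrite fmorph_eq0.
by congr (_ / _); field.
Qed.

(** The square of the matrix has off-diagonal entries 2abg and 2ab, so an involution has a = 0 or b
    = 0. *)
Lemma torus_involution (a b g : K) (S : {rmorphism E -> E}) :
  2%:R != 0 :> K -> (a, b) != (0, 0) -> S \o i =1 i ->
  (forall h, g != h ^+ 2) ->
  S x = (i a * x + i (b * g)) / (i b * x + i a) -> S (S x) = x ->
  S x = x \/ [/\ a = 0, b != 0 & S x = i g / x].
Proof.
move=> two ab Si ng Sx SSx.
have {}Si s : S (i s) = i s by exact: Si.
have xn0 : x != 0.
  apply: contra_not_neq x_tr => ->; exact: algebraic0.
have den : i b * x + i a != 0.
  apply: transcendental_denominator => //.
  by move: ab; rewrite xpair_eqE negb_and orbC.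
have Sden : S (i b * x + i a) != 0 by rewrite fmorph_eq0.
have E1 : (i b * x + i a) * S x = i a * x + i (b * g).
  by rewrite Sx mulrC divfK.
have := congr1 S E1; rewrite rmorphM SSx !rmorphD !rmorphM !Si.
move=> E2.
(* Clearing denominators in S (S x) = x leaves 2ab (x^2 - g) = 0. *)
have E3 : i (2%:R * a * b) * x ^+ 2 + i 0 * x + i (- (2%:R * a * b * g)) = 0.
  have E3 : (i b * ((i b * x + i a) * S x) + i a * (i b * x + i a)) * x =
     i a * ((i b * x + i a) * S x) + i b * i g * (i b * x + i a).
    by apply: (eq_of_diff (i b * x + i a) E2); rewrite ?rmorphM; ring.
  rewrite E1 rmorphM in E3.
  rewrite rmorph0 rmorphN !rmorphM rmorph_nat.
  by apply: (eq_of_diff 1 E3); ring.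
have [/eqP + _ _] := transcendental_quadratic E3.
rewrite !mulf_eq0 (negPf two) /= => /orP[/eqP a0|/eqP b0]; [right | left].
  have bn0 : b != 0 by move: ab; rewrite a0 xpair_eqE eqxx.
  split=> //; rewrite Sx a0 rmorph0 mul0r add0r addr0 rmorphM.
  by rewrite -mulf_div divff ?mul1r // fmorph_eq0.
have an0 : a != 0 by move: ab; rewrite b0 xpair_eqE eqxx andbT.
by rewrite Sx b0 mul0r rmorph0 mul0r add0r addr0 mulrAC divff ?mul1r ?fmorph_eq0.
Qed.

(** The determinant a^2 - b^2 f is the norm of a + b sqrt f; if it vanished with b nonzero, f would
    be the square of a / b. *)
Lemma nonsquare_det (a b f : K) : (forall h, f != h ^+ 2) ->
  (a, b) != (0, 0) -> mx2 a (b * f) b a \in unitmx.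
Proof.
move=> nf ab; rewrite unitmx2; case: (mx2E a (b * f) b a) => -> -> -> ->.
have [b0|bn0] := eqVneq b 0.
  move: ab; rewrite b0 xpair_eqE eqxx andbT => an0.
  by rewrite mulr0 subr0 mulf_neq0.
have := nf (a / b); apply: contra => /eqP E0; apply/eqP.
have {}E0 : b ^+ 2 * f = a ^+ 2 by apply: (eq_of_diff (-1) E0); ring.
by rewrite expr_div_n -E0; field.
Qed.

End AbstractTorus.

Section AbstractHomographies.
Variables (K E : fieldType) (i : {rmorphism K -> E}).

Lemma homography_map_mx2 (a b c d : K) x :
  homography (map_mx i (mx2 a b c d)) x = (i a * x + i b) / (i c * x + i d).
Proof. by rewrite homographyE !mxE. Qed.

Lemma homography_scaling (l : K) x :
  homography (map_mx i (mx2 l 0 0 1)) x = i l * x.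
Proof.
by rewrite homography_map_mx2 !rmorph0 rmorph1 mul0r add0r addr0 divr1.
Qed.

Lemma homography_iota (f : K) x :
  homography (map_mx i (mx2 0 f 1 0)) x = i f / x.
Proof.
by rewrite homography_map_mx2 !rmorph0 rmorph1 mul0r add0r addr0 mul1r.
Qed.

Lemma unitmx_scaling (l : K) : l != 0 -> mx2 l 0 0 1 \in unitmx.
Proof.
rewrite unitmx2; case: (mx2E l 0 0 1) => -> -> -> ->.
by rewrite mulr1 mul0r subr0.
Qed.

Lemma unitmx_iota (f : K) : f != 0 -> mx2 0 f 1 0 \in unitmx.
Proof.
rewrite unitmx2; case: (mx2E 0 f 1 0) => -> -> -> ->.
by rewrite mul0r mulr1 sub0r oppr_eq0.
Qed.

Lemma scaling_cancel (u : {rmorphism K -> K}) (V : {rmorphism E -> E}) m l x :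
  V \o i =1 i \o u -> V x = i l^-1 * x -> u m = l -> l != 0 ->
  V (i m * x) = x.
Proof.
move=> Vi Vx um ln0; rewrite rmorphM Vx [V (i m)]Vi /= um mulrA -rmorphM.
by rewrite divff // rmorph1 mul1r.
Qed.

Lemma iota_involution (T : {rmorphism E -> E}) f x :
  T \o i =1 i -> T x = i f / x -> f != 0 -> T (i f / x) = x.
Proof.
move=> Ti Tx fn0; rewrite fmorph_div [T (i f)]Ti Tx invf_div mulrA.
by rewrite mulrAC divff ?mul1r ?fmorph_eq0.
Qed.

Lemma iota_not_fixed x f : transcendental i x -> i f / x <> x.
Proof.
move=> tr E0; have xn0 : x != 0.
  by apply: contra_not_neq tr => ->; apply: algebraic0.
have : i 1 * x ^+ 2 + i 0 * x + i (- f) = 0.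
  have E1 : i f = x ^+ 2 by rewrite expr2 -{1}E0 divfK.
  by rewrite rmorph0 rmorph1 rmorphN E1; ring.
by case/(transcendental_quadratic tr) => /eqP; rewrite oner_eq0.
Qed.

Lemma pair_fmorph_neq0 (u : {rmorphism K -> K}) a b l : l != 0 ->
  (a, b) != (0, 0) -> (u a, u b / l) != (0, 0).
Proof.
move=> ln0; apply: contra; rewrite !xpair_eqE mulf_eq0 invr_eq0 (negPf ln0).
by rewrite orbF !fmorph_eq0.
Qed.

Lemma pair_fmorph_neq0' (u : {rmorphism K -> K}) a b l : l != 0 ->
  (a, b) != (0, 0) -> (u a, u (l * b)) != (0, 0).
Proof.
move=> ln0; apply: contra; rewrite !xpair_eqE !fmorph_eq0 mulf_eq0.
by rewrite (negPf ln0).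
Qed.

Lemma mulKf' (l b : K) : l != 0 -> l * b / l = b.
Proof. by move=> ln0; rewrite mulrAC divff // mul1r. Qed.

End AbstractHomographies.

Section ConcreteTorus.
Variable k : fieldType.
Local Notation K := (fun1 k).
Local Notation E := (fun2 k).
Local Notation i := (@fun1_to_fun2 k).

Lemma fibre_pullback (A : 'M[K]_2) : A \in unitmx ->
  {T | is_pullback T (fibre_map A) /\ T \o i =1 i}.
Proof.
move=> uA; have [T [Ti Tx]] := fibration_lift idfun uA; exists T.
split; last exact: Ti.
by split=> [a||]; [exact: Ti (const1 a) | exact: Tx | exact: Ti (y1 k)].
Qed.

Lemma homography_y2 (M : 'M[k]_2) :
  i (homography (map_mx (@const1 k) M) (y1 k)) =
  homography (map_mx (@const2 k) M) (y2 k).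
Proof. by rewrite map_homography -map_mx_comp. Qed.

Lemma scaling_pullback (M : 'M[k]_2) v (l : K) :
  is_substitution M v -> l != 0 ->
  {U | [/\ is_pullback U (scaling_map l M), U \o i =1 i \o v
         & U (x2 k) = i l * x2 k]}.
Proof.
move=> [vc vy] ln0.
have uA := unitmx_scaling ln0.
have [U [Ui Ux]] := fibration_lift v uA.
have {}Ux : U (x2 k) = i l * x2 k by exact: etrans Ux (homography_scaling _ _ _).
exists U; split; [split | exact: Ui | exact: Ux].
- move=> a; transitivity (i (v (const1 a))); first exact: Ui.
  by rewrite [v _]vc.
- exact: Ux.
- apply: etrans (Ui (y1 k)) _.
  apply: etrans (congr1 i vy) _.
  exact: homography_y2.
Qed.

(** The element (m x, M y) that carries f to g also conjugates the tori. Its inverse is (x / u m,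
    M^-1 y), where [u m] is m o M^-1. *)
Lemma orbit_conjugate (f g : K) : nonsquare f -> same_orbit f g ->
  conjugate_in (scaling_PGL2 k) (torus f) (torus g).
Proof.
move=> nf [m [M [mn0 uM gE]]].
have uV : invmx M \in unitmx by rewrite unitmx_inv.
have [v sv] := substitution_ex uM.
have [u su] := substitution_ex uV.
have [vu uv] := substitution_cancel uM sv su.
have ln0 : u m != 0 := fmorph_neq0 u mn0.
have {}gE : g = u m ^+ 2 * u f.
  by rewrite gE /scaling_act (substitution_evalf _ su) [LHS]rmorph_sqrM.
have [U [pU Ui Ux]] := scaling_pullback sv mn0.
have [V [pV Vi Vx]] := scaling_pullback su (invr_neq0 ln0).
have UV : cancel U V.
  apply: (@eq_fun2_morph _ _ (V \o U) idfun) => [a||].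
  - have [cU _ _] := pU; have [cV _ _] := pV.
    exact: etrans (congr1 V (cU a)) (cV a).
  - exact: etrans (congr1 V Ux) (scaling_cancel Vi Vx (erefl _) ln0).
  - exact: etrans (congr1 V (Ui (y1 k))) (etrans (Vi _) (congr1 i (vu _))).
have VU : cancel V U.
  apply: (@eq_fun2_morph _ _ (U \o V) idfun) => [a||].
  - have [cU _ _] := pU; have [cV _ _] := pV.
    exact: etrans (congr1 U (cV a)) (cU a).
  - have Ux' : U (x2 k) = i (m^-1)^-1 * x2 k by rewrite invrK.
    apply: etrans (congr1 U Vx) (scaling_cancel Ui Ux' _ (invr_neq0 mn0)).
    exact: etrans (fmorphV v _) (congr1 GRing.inv (uv m)).
  - exact: etrans (congr1 U (Vi (y1 k))) (etrans (Ui _) (congr1 i (uv _))).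
exists (scaling_map m M), (scaling_map (u m)^-1 (invmx M)); split.
- by exists m, M.
- exact: inverse_mapsP pU pV UV VU.
have key a b : (a, b) != (0, 0) ->
    ratcomp (scaling_map m M) (ratcomp (fibre_map (mx2 a (b * f) b a))
      (scaling_map (u m)^-1 (invmx M))) =
    fibre_map (mx2 (u a) (u b / u m * g) (u b / u m) (u a)).
  move=> ab; have [T [pT Ti]] := fibre_pullback (nonsquare_det nf ab).
  have [_ Tx _] := pT; move: (etrans Tx (homography_map_mx2 _ _ _ _ _ _)) => {}Tx.
  have p := is_pullback_comp pU (is_pullback_comp pT pV).
  have [pc _ _] := p; apply: (pullback_inj p).
  split; [exact: pc | |].
    rewrite gE; apply: etrans (congr1 (V \o T) Ux) _.
    apply: etrans (conjugate_torus_elt Vi Ti Vx Tx (erefl _) ln0) _.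
    exact: esym (homography_map_mx2 _ _ _ _ _ _).
  apply: etrans (congr1 (V \o T) (Ui (y1 k))) _.
  apply: etrans (congr1 V (Ti _)) _.
  exact: etrans (Vi _) (congr1 i (vu _)).
apply/seteqP; split=> [_ [_ [a [b [ab ->]]] <-]|_ [a [b [ab ->]]]].
  exists (u a), (u b / u m); split; last exact: key ab.
  exact: pair_fmorph_neq0.
(* These entries solve u a' = a and u b' / u m = b, [v] being the inverse of [u]. *)
have ab' : (v a, v (u m * b)) != (0, 0) by exact: pair_fmorph_neq0'.
exists (fibre_map (mx2 (v a) (v (u m * b) * f) (v (u m * b)) (v a))).
  by exists (v a), (v (u m * b)).
by rewrite (key _ _ ab') !vu (mulKf' b ln0).
Qed.

Lemma iota_in_torus (f : K) : torus f (iota_inv f).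
Proof.
exists 0, 1; split; first by rewrite xpair_eqE oner_eq0 andbF.
by rewrite /iota_inv mul1r.
Qed.

Lemma iota_pullback (f : K) : f != 0 ->
  {T | [/\ is_pullback T (iota_inv f), T \o i =1 i & T (x2 k) = i f / x2 k]}.
Proof.
move=> fn0.
have uA := unitmx_iota fn0.
have [T [pT Ti]] := fibre_pullback uA; exists T.
split; [exact: pT | exact: Ti |].
by have [_ Tx _] := pT; apply: etrans Tx (homography_iota _ _ _).
Qed.

Lemma nonsquare_neq0 (f : K) : nonsquare f -> f != 0.
Proof. by move=> nf; have := nf 0; rewrite expr0n. Qed.

Lemma x2_neq0 : x2 k != 0.
Proof.
by apply: contra_not_neq (@x2_transcendental k) => ->; apply: algebraic0.
Qed.

Lemma torus_conjugate_iota (f g : K) : 2%:R != 0 :> K ->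
  nonsquare f -> nonsquare g ->
  conjugate_in (Bir k) (torus f) (torus g) ->
  conjugate_elts_in (Bir k) (iota_inv f) (iota_inv g).
Proof.
move=> two nf ng [phi [psi [B inv im]]]; exists phi, psi; split; [exact: B | exact: inv |].
have [U [V [pU pV UV VU]]] := inverse_maps_pullbacks inv.
have [T [pT Ti Tx]] := iota_pullback (nonsquare_neq0 nf).
have TT z : T (T z) = z.
  apply: (@eq_fun2_morph _ _ (T \o T) idfun) => [a||].
  - exact: etrans (congr1 T (Ti _)) (Ti _).
  - apply: etrans (congr1 T Tx) (iota_involution Ti Tx _).
    exact: nonsquare_neq0.
  - exact: etrans (congr1 T (Ti _)) (Ti _).
have p := is_pullback_comp pU (is_pullback_comp pT pV).
have : torus g (ratcomp phi (ratcomp (iota_inv f) psi)).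
  by rewrite -im; exists (iota_inv f) => //; apply: iota_in_torus.
move=> [a [b [ab eS]]]; move: (p); rewrite eS => p'.
set S : {rmorphism E -> E} := (_ \o _) in p p'.
have SE z : S z = V (T (U z)) by [].
have SS z : S (S z) = z by rewrite !SE VU TT UV.
have [Sc Sx Sy] := p'.
have Si : S \o i =1 i by apply: (@eq_fun1_morph _ _ (S \o i) i).
move: (etrans Sx (homography_map_mx2 _ _ _ _ _ _)) => {}Sx.
(* The conjugate [S] of the involution is not the identity: otherwise x = f / x, against the
   transcendence of x. *)
have [Sx1|[a0 bn0 Sx1]] := torus_involution (@x2_transcendental k) two ab Si ng Sx (SS _).
  have S1 : S =1 idfun := @eq_fun2_morph _ _ S idfun Sc Sx1 Sy.
  have Tx1 : T (x2 k) = x2 k.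
    by have := S1 (V (x2 k)); rewrite SE VU => /(can_inj VU).
  by case: (iota_not_fixed (@x2_transcendental k) (etrans (esym Tx) Tx1)).
have pS : is_pullback S (iota_inv g).
  have Sy' : S (y2 k) = y2 k := Sy.
  split; [exact: Sc | | exact: Sy'].
  exact: etrans Sx1 (esym (homography_iota _ _ _)).
exact: pullback_inj p' pS.
Qed.

End ConcreteTorus.

(** * Quadratic extensions *)

Section QuadraticExtension.
Variables (K L : fieldType) (j : {rmorphism K -> L}) (w : L) (f : K).
Hypothesis ww : w ^+ 2 = j f.
Hypothesis nf : forall h, f != h ^+ 2.

Definition spanned := forall z, exists a b, z = j a + j b * w.

Lemma quadratic_notin a : w <> j a.
Proof.
move=> E; have := ww; rewrite E -rmorphXn => /fmorph_inj F.
by have := nf a; rewrite F eqxx.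
Qed.

Lemma quadratic_free a b : j a + j b * w = 0 -> a = 0 /\ b = 0.
Proof.
move=> E; have [b0|bn0] := eqVneq b 0.
  by move: E; rewrite b0 rmorph0 mul0r addr0 => /eqP; rewrite fmorph_eq0 => /eqP.
case: (quadratic_notin (a := - a / b)).
have jb : j b != 0 by rewrite fmorph_eq0.
apply: (mulfI jb); rewrite fmorph_div rmorphN [RHS]mulrC divfK //.
by apply/eqP; rewrite -addr_eq0 addrC E.
Qed.

Lemma quadratic_uniq a b a' b' :
  j a + j b * w = j a' + j b' * w -> a = a' /\ b = b'.
Proof.
move=> E; have /quadratic_free [] : j (a - a') + j (b - b') * w = 0.
  by rewrite !rmorphB; apply: (eq_of_diff 1 E); ring.
by move=> /eqP + /eqP; rewrite !subr_eq0 => /eqP -> /eqP ->.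
Qed.

(** The universal property of K[X] / (X^2 - f), for any field spanned by 1 and a square root of f.
    Coordinates in this basis are unique, and chosen once for all. *)
Lemma quadratic_lift (M : fieldType) (m : {rmorphism K -> M}) xi :
  spanned -> xi ^+ 2 = m f ->
  exists u : {rmorphism L -> M}, u \o j =1 m /\ u w = xi.
Proof.
move=> sp xx.
have /boolp.choice [ab abE] : forall z, exists ab, z = j ab.1 + j ab.2 * w.
  by move=> z; have [a [b ->]] := sp z; exists (a, b).
pose u z : M := m (ab z).1 + m (ab z).2 * xi.
have uE a b : u (j a + j b * w) = m a + m b * xi.
  by have [/esym aE /esym bE] := quadratic_uniq (abE (j a + j b * w)); rewrite /u aE bE.
have uj a : u (j a) = m a.
  by have := uE a 0; rewrite !rmorph0 !mul0r !addr0.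
have uB : zmod_morphism u.
  move=> x y; rewrite [x]abE [y]abE.
  have -> : j (ab x).1 + j (ab x).2 * w - (j (ab y).1 + j (ab y).2 * w) =
    j ((ab x).1 - (ab y).1) + j ((ab x).2 - (ab y).2) * w.
    by rewrite !rmorphB; ring.
  by rewrite !uE !rmorphB; ring.
have uM : monoid_morphism u.
  split; first by rewrite -(rmorph1 j) uj rmorph1.
  move=> x y; rewrite [x]abE [y]abE; set a := (ab x).1; set b := (ab x).2.
  set c := (ab y).1; set d := (ab y).2.
  have -> : (j a + j b * w) * (j c + j d * w) =
    j (a * c + b * d * f) + j (a * d + b * c) * w.
    by rewrite !rmorphD !rmorphM -ww; ring.
  by rewrite !uE !rmorphD !rmorphM -xx; ring.
pose v : {rmorphism L -> M} := HB.pack u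
  (GRing.isZmodMorphism.Build _ _ _ uB) (GRing.isMonoidMorphism.Build _ _ _ uM).
exists v; split=> [a|]; first exact: uj.
by have := uE 0 1; rewrite !rmorph0 !rmorph1 !mul1r !add0r.
Qed.

End QuadraticExtension.

Lemma field_iso_of_surj (k K L : fieldType) (c : k -> K) (d : k -> L)
    (u : {rmorphism K -> L}) :
  (forall z, exists s, u s = z) -> (forall a, u (c a) = d a) ->
  field_iso_over c d.
Proof.
move=> surj uc; exists u; split=> //.
have [v vE] := boolp.choice surj.
by exists v => // z; apply: (fmorph_inj u); rewrite vE.
Qed.

Lemma field_iso_over_sym (k K L : fieldType) (c : k -> K) (d : k -> L) :
  field_iso_over c d -> field_iso_over d c.
Proof.
move=> [u [[v uv vu] uc]].
have vB : zmod_morphism v.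
  by move=> x y; apply: (fmorph_inj u); rewrite rmorphB !vu.
have vM : monoid_morphism v.
  by split=> [|x y]; apply: (fmorph_inj u); rewrite ?rmorph1 ?rmorphM !vu.
pose v' : {rmorphism L -> K} := HB.pack v
  (GRing.isZmodMorphism.Build _ _ _ vB) (GRing.isMonoidMorphism.Build _ _ _ vM).
exists v'; split; first by exists u.
by move=> a; apply: (fmorph_inj u); rewrite uc; apply: vu.
Qed.

Lemma field_iso_over_trans (k K L M : fieldType) (c : k -> K) (d : k -> L)
    (e : k -> M) :
  field_iso_over c d -> field_iso_over d e -> field_iso_over c e.
Proof.
move=> [u [[u' u1 u2] uc]] [v [[v' v1 v2] vd]]; exists (v \o u); split.
  by exists (u' \o v') => z /=; rewrite ?v1 ?u1 ?u2 ?v2.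
by move=> a /=; rewrite uc vd.
Qed.

Section QuotientQuadratic.
Variables (K : fieldType) (f : K).
Local Notation h := ('X^2 - f%:P).
Hypothesis hI : monic_irreducible_poly h.
Local Notation L := {poly %/ h with hI}.

Let size_h : size h = 3%N. Proof. by rewrite size_XnsubC. Qed.

Let mk_h : mk_monic h = h.
Proof. by rewrite /mk_monic size_h monicXnsubC. Qed.

Lemma in_qpolyC (a : K) : in_qpoly h a%:P = qpolyC h a.
Proof.
apply: val_inj; apply: in_qpoly_small; rewrite mk_h size_h.
exact: leq_ltn_trans (size_polyC_leq1 _) _.
Qed.

Lemma in_qpoly_sqr : in_qpoly h 'X ^+ 2 = qpolyC h f.
Proof.
rewrite -rmorphXn -in_qpolyC; apply/eqP; rewrite -subr_eq0 -rmorphB.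
apply/eqP/val_inj; rewrite /= /in_qpoly /= mk_h.
exact: (Pdiv.RingMonic.rmodpp (monicXnsubC f (isT : (0 < 2)%N))).
Qed.

Lemma qpoly_spanned (z : L) :
  exists a b, z = qpolyC h a + qpolyC h b * in_qpoly h 'X.
Proof.
exists (val z)`_0, (val z)`_1; rewrite -!in_qpolyC -rmorphM -rmorphD.
have sz : (size (val z) <= 2)%N.
  have s3 : (size (mk_monic h) <= 3)%N by rewrite mk_h size_h.
  by rewrite -ltnS; apply: leq_trans (size_mk_monic z) s3.
have -> : ((val z)`_0)%:P + ((val z)`_1)%:P * 'X = val z.
  apply/polyP => i; rewrite coefD coefC mul_polyC coefZ coefX.
  case: i => [|[|i]] /=; rewrite ?mulr0 ?mulr1 ?addr0 ?add0r //.
  by rewrite nth_default // (leq_trans sz).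
by apply: val_inj; symmetry; apply: in_qpoly_small; apply: size_mk_monic.
Qed.

End QuotientQuadratic.

Section SqrtExtension.
Variables (k : fieldType) (f : fun1 k) (hf : nonsquare f).

Definition sqrt_incl : {rmorphism fun1 k -> sqrt_ext hf} :=
  qpolyC ('X^2 - f%:P).

Definition sqrt_gen : sqrt_ext hf := in_qpoly ('X^2 - f%:P) 'X.

Lemma sqrt_genE : sqrt_gen ^+ 2 = sqrt_incl f.
Proof. exact: in_qpoly_sqr. Qed.

Lemma sqrt_ext_spanned : spanned sqrt_incl sqrt_gen.
Proof. exact: (@qpoly_spanned _ f (nonsquare_irreducible hf)). Qed.

End SqrtExtension.

(** * Places and the fixed curve of an involution *)

(* The residue map [place_res] is only meaningful on the valuation ring, i.e.
   on the elements satisfying [place_ring]; [place_val 0] is arbitrary. *)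
Record place (E F : fieldType) := Place {
  place_val : E -> int;
  place_res : E -> F;
  place_valM : forall s t, s != 0 -> t != 0 ->
    place_val (s * t) = place_val s + place_val t;
  place_ringD : forall s t, s = 0 \/ 0 <= place_val s ->
    t = 0 \/ 0 <= place_val t -> s + t = 0 \/ 0 <= place_val (s + t);
  place_resD : forall s t, s = 0 \/ 0 <= place_val s ->
    t = 0 \/ 0 <= place_val t -> place_res (s + t) = place_res s + place_res t;
  place_resM : forall s t, s = 0 \/ 0 <= place_val s ->
    t = 0 \/ 0 <= place_val t -> place_res (s * t) = place_res s * place_res t;
  place_res1 : place_res 1 = 1;
  place_res_eq0 : forall s, s = 0 \/ 0 <= place_val s ->
    place_res s = 0 <-> s = 0 \/ 0 < place_val s
}.

Section PlaceTheory.
Variables (E F : fieldType) (P : place E F).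
Local Notation v := (place_val P).
Local Notation r := (place_res P).

Definition place_ring s := s = 0 \/ 0 <= v s.

Lemma place_val1 : v 1 = 0.
Proof.
have := place_valM P (oner_neq0 E) (oner_neq0 E); rewrite mulr1 => /eqP.
by rewrite -subr_eq subrr eq_sym => /eqP.
Qed.

Lemma place_valV s : s != 0 -> v s^-1 = - v s.
Proof.
move=> sn0; have := place_valM P sn0 (invr_neq0 sn0).
by rewrite divff // place_val1 => /eqP; rewrite eq_sym addr_eq0 => /eqP ->; rewrite opprK.
Qed.

Lemma place_val_div s t : s != 0 -> t != 0 -> v (s / t) = v s - v t.
Proof. by move=> sn0 tn0; rewrite place_valM ?invr_eq0 // place_valV. Qed.

Lemma place_ring0 : place_ring 0. Proof. by left. Qed.

Lemma place_ring1 : place_ring 1. Proof. by right; rewrite place_val1. Qed.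

Lemma place_ring_val s : s != 0 -> place_ring s -> 0 <= v s.
Proof. by move=> sn0 [/eqP|//]; rewrite (negPf sn0). Qed.

Lemma place_ringM s t : place_ring s -> place_ring t -> place_ring (s * t).
Proof.
have [-> _ _|sn0] := eqVneq s 0; first by left; rewrite mul0r.
have [-> _ _|tn0] := eqVneq t 0; first by left; rewrite mulr0.
move=> /(place_ring_val sn0) vs /(place_ring_val tn0) vt.
by right; rewrite place_valM // addr_ge0.
Qed.

Lemma place_res0 : r 0 = 0.
Proof. by apply/(place_res_eq0 place_ring0); left. Qed.

Lemma place_res_unit s : place_ring s -> r s != 0 -> s != 0 /\ v s = 0.
Proof.
move=> os rs; have sn0 : s != 0 by apply: contra_neq rs => ->; apply: place_res0.
split=> //; case: os => [/eqP|vs]; first by rewrite (negPf sn0).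
apply/eqP; rewrite eq_le vs andbT leNgt; apply: contra rs => vs0.
by apply/eqP/place_res_eq0; right.
Qed.

Lemma place_ringV s : place_ring s -> r s != 0 -> place_ring s^-1.
Proof.
by move=> os rs; have [sn0 vs] := place_res_unit os rs; right; rewrite place_valV // vs oppr0.
Qed.

Lemma place_resV s : place_ring s -> r s != 0 -> r s^-1 = (r s)^-1.
Proof.
move=> os rs; have [sn0 _] := place_res_unit os rs.
apply: (mulfI rs); rewrite -place_resM //; last exact: place_ringV.
by rewrite !divff // place_res1.
Qed.

Lemma place_total s : place_ring s \/ place_ring s^-1 /\ r s^-1 = 0.
Proof.
have [->|sn0] := eqVneq s 0; first by left; left.
case: (lerP 0 (v s)) => vs; [by left; right | right].
have vV : 0 < v s^-1 by rewrite place_valV // oppr_gt0.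
have oV : place_ring s^-1 by right; apply: ltW.
by split=> //; apply/place_res_eq0 => //; right.
Qed.

End PlaceTheory.

(** Kept transparent, because later arguments use by conversion that its residue map is
    [place_res P \o u]. *)
Definition place_pullback (E E' F : fieldType) (u : {rmorphism E' -> E})
  (P : place E F) : place E' F.
Proof.
apply: (@Place E' F (place_val P \o u) (place_res P \o u)) => /=.
- by move=> s t sn0 tn0; rewrite rmorphM place_valM ?fmorph_eq0.
- move=> s t hs ht.
  have os : place_ring P (u s) by case: hs => [->|]; [left; rewrite rmorph0 | right].
  have ot : place_ring P (u t) by case: ht => [->|]; [left; rewrite rmorph0 | right].
  have [] := place_ringD os ot; rewrite -rmorphD; last by right.
  by move=> /eqP; rewrite fmorph_eq0 => /eqP; left.
- move=> s t hs ht; rewrite rmorphD; apply: place_resD.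
    by case: hs => [->|]; [left; rewrite rmorph0 | right].
  by case: ht => [->|]; [left; rewrite rmorph0 | right].
- move=> s t hs ht; rewrite rmorphM; apply: place_resM.
    by case: hs => [->|]; [left; rewrite rmorph0 | right].
  by case: ht => [->|]; [left; rewrite rmorph0 | right].
- by rewrite rmorph1 place_res1.
- move=> s hs.
  have os : place_ring P (u s) by case: hs => [->|]; [left; rewrite rmorph0 | right].
  split=> [/(place_res_eq0 os)[/eqP|]|[->|vs]]; last by apply/place_res_eq0 => //; right.
  + by rewrite fmorph_eq0 => /eqP; left.
  + by right.
  + by rewrite rmorph0 place_res0.
Defined.

Section PrincipalPlace.
Variables (A : comRingType) (K F : fieldType).
Variables (i : {rmorphism A -> K}) (e : {rmorphism A -> F}) (p : A).
Hypothesis ie : forall s, i s = 0 -> e s = 0.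
Hypothesis ep : e p = 0.
Hypothesis ip : i p != 0.
Hypothesis fac : forall s, i s != 0 ->
  exists n a b, [/\ e a != 0, e b != 0 & i b * i s = i p ^+ n * i a].
Hypothesis frac : forall z, exists s t, i t != 0 /\ z = i s / i t.

Let i_neq0 s : e s != 0 -> i s != 0.
Proof. by apply: contra_neq => /ie. Qed.

Let R z a b := e b != 0 /\ z = i a / i b.

Let R_uniq z a b c d : R z a b -> R z c d -> e a / e b = e c / e d.
Proof.
move=> [eb ->] [ed] /eqP; rewrite eqr_div ?i_neq0 // -!rmorphM -subr_eq0 -rmorphB.
move=> /eqP/ie/eqP; rewrite rmorphB subr_eq0 !rmorphM => h.
by apply/eqP; rewrite eqr_div.
Qed.

Let val_ex z : exists n : int, z = 0 \/
  exists a b, [/\ e a != 0, e b != 0 & z = i p ^ n * (i a / i b)].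
Proof.
have [->|zn0] := eqVneq z 0; first by exists 0; left.
have [s [t [tn0 zE]]] := frac z.
have sn0 : i s != 0 by apply: contra_neq zn0 => s0; rewrite zE s0 mul0r.
have [n [a [b [ea eb sE]]]] := fac sn0.
have [m [c [d [ec ed tE]]]] := fac tn0.
exists (n%:Z - m%:Z); right; exists (a * d), (b * c).
split; rewrite ?rmorphM ?mulf_neq0 // zE expfzDr // -exprnN /=.
have -> : i s = i p ^+ n * (i a / i b) by rewrite mulrA -sE mulrC mulKf ?i_neq0.
have -> : i t = i p ^+ m * (i c / i d) by rewrite mulrA -tE mulrC mulKf ?i_neq0.
have ia := i_neq0 ea; have ib := i_neq0 eb; have ic := i_neq0 ec; have id := i_neq0 ed.
have ipm : i p ^+ m != 0 by rewrite expf_neq0.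
rewrite -exprnP.
by move: (i p ^+ n) (i p ^+ m) ipm => x y yn0; field; rewrite ?ia ?ib ?ic ?id ?yn0.
Qed.

(** Uniqueness of the exponent: after division by the smaller power of p, one side keeps a factor p,
    which [e] kills, while the other side survives [e]. *)
Let val_lt n m a b c d : (n < m :> int) -> e a != 0 -> e b != 0 -> e d != 0 ->
  i p ^ n * (i a / i b) = i p ^ m * (i c / i d) -> False.
Proof.
move=> nm ea eb ed.
have [k [kE]] : exists k : nat, m = n + k.+1%:Z.
  exists (absz (m - n)).-1; move: nm; lia.
rewrite kE expfzDr // -mulrA.
move=> /(mulfI (expfz_neq0 _ ip)).
move=> /eqP; rewrite mulrA eqr_div ?i_neq0 // -exprnP -rmorphXn -!rmorphM.
rewrite -subr_eq0 -rmorphB => /eqP/ie/eqP.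
rewrite rmorphB subr_eq0 !rmorphM rmorphXn ep expr0n /= !mul0r.
by rewrite mulf_eq0 (negPf ea) (negPf ed).
Qed.

(** The local ring at the kernel of [e] is a discrete valuation ring with uniformizer p. The
    multiplier [b] in [fac] allows p to be a generator only locally, and [i] may have a kernel. This
    serves both for the polynomial X^2 - f in K[X] and for y - a at a point of a plane curve. *)
Lemma principal_place : exists P : place K F,
  [/\ place_val P (i p) = 1,
      forall a b, e b != 0 -> place_ring P (i a / i b) /\
        place_res P (i a / i b) = e a / e b
    & forall z, place_ring P z -> exists a b, e b != 0 /\ z = i a / i b].
Proof.
have [v vE] := boolp.choice val_ex.
have vP z n a b : z != 0 -> e a != 0 -> e b != 0 ->
    z = i p ^ n * (i a / i b) -> v z = n.
  move=> zn0 ea eb zE; have [/eqP|] := vE z; first by rewrite (negPf zn0).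
  move=> [c [d [ec ed]]]; rewrite {1}zE => E.
  case: (ltgtP (v z) n) => // lt; exfalso.
    exact: (val_lt lt ec ed eb (esym E)).
  exact: (val_lt lt ea eb ed E).
(* The valuation ring is exactly the localization, so that the residue can be read off any fraction
   with admissible denominator. *)
have OR z : (z = 0 \/ 0 <= v z) <-> exists a b, R z a b.
  split=> [oz|[a [b [eb zE]]]].
    have [->|zn0] := eqVneq z 0.
      by exists 0, 1; rewrite /R rmorph1 oner_eq0 rmorph0 mul0r.
    case: oz => [/eqP|vz]; first by rewrite (negPf zn0).
    have [/eqP|[a [b [ea eb E]]]] := vE z; first by rewrite (negPf zn0).
    exists (p ^+ (absz (v z)) * a), b; split=> //.
    rewrite {1}E rmorphM rmorphXn -mulrA; congr (_ * _).
    by rewrite -{1}(gez0_abs vz).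
  have [|zn0] := eqVneq z 0; [by left | right].
  have [/eqP|[c [d [ec ed E]]]] := vE z; first by rewrite (negPf zn0).
  rewrite leNgt; apply/negP => lt; apply: (val_lt (c := a) lt ec ed eb).
  by rewrite -E expr0z mul1r.
(* Off the valuation ring the residue gets the default value 0. *)
have rex z : exists x, forall a b, R z a b -> x = e a / e b.
  have [[a [b h]]|no] := pselect (exists a b, R z a b).
    by exists (e a / e b) => c d; apply: R_uniq.
  by exists 0 => a b h; case: no; exists a, b.
have [r rE] := boolp.choice rex.
have vM s t : s != 0 -> t != 0 -> v (s * t) = v s + v t.
  move=> sn0 tn0; have [/eqP|[a [b [ea eb E]]]] := vE s; first by rewrite (negPf sn0).
  have [/eqP|[c [d [ec ed E']]]] := vE t; first by rewrite (negPf tn0).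
  apply: (vP _ _ (a * c) (b * d)); rewrite ?rmorphM ?mulf_neq0 //.
  rewrite {1}E {1}E' expfzDr // -mulf_div.
  by move: (i p ^ _) (i p ^ _) (i a / _) (i c / _) => x y z w; ring.
have RD s t a b c d : R s a b -> R t c d -> R (s + t) (a * d + c * b) (b * d).
  move=> [eb ->] [ed ->]; split; first by rewrite rmorphM mulf_neq0.
  by rewrite rmorphD !rmorphM addf_div ?i_neq0.
have RM s t a b c d : R s a b -> R t c d -> R (s * t) (a * c) (b * d).
  move=> [eb ->] [ed ->]; split; first by rewrite rmorphM mulf_neq0.
  by rewrite !rmorphM mulf_div.
have OD s t : s = 0 \/ 0 <= v s -> t = 0 \/ 0 <= v t ->
    s + t = 0 \/ 0 <= v (s + t).
  by move=> /OR[a [b h]] /OR[c [d h']]; apply/OR; exists (a * d + c * b), (b * d); apply: RD.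
have rD s t : s = 0 \/ 0 <= v s -> t = 0 \/ 0 <= v t -> r (s + t) = r s + r t.
  move=> /OR[a [b h]] /OR[c [d h']]; rewrite (rE _ _ _ (RD _ _ _ _ _ _ h h')).
  have [eb _] := h; have [ed _] := h'.
  by rewrite (rE _ _ _ h) (rE _ _ _ h') rmorphD !rmorphM addf_div.
have rM s t : s = 0 \/ 0 <= v s -> t = 0 \/ 0 <= v t -> r (s * t) = r s * r t.
  move=> /OR[a [b h]] /OR[c [d h']]; rewrite (rE _ _ _ (RM _ _ _ _ _ _ h h')).
  by rewrite (rE _ _ _ h) (rE _ _ _ h') !rmorphM mulf_div.
have r1 : r 1 = 1.
  have h : R 1 1 1 by rewrite /R !rmorph1 oner_eq0 divr1.
  by rewrite (rE _ _ _ h) rmorph1 divr1.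
have r0 s : s = 0 \/ 0 <= v s -> r s = 0 <-> s = 0 \/ 0 < v s.
  move=> os; have /OR[a [b h]] := os; have [eb sE] := h; rewrite (rE _ _ _ h).
  have [s0|sn0] := eqVneq s 0.
    split=> _; [by left|]; move: sE; rewrite s0 => /esym/eqP.
    rewrite mulf_eq0 invr_eq0 (negPf (i_neq0 eb)) orbF => /eqP/ie ->.
    by rewrite mul0r.
  have vs : 0 <= v s by case: os => // /eqP; rewrite (negPf sn0).
  split=> [/eqP|[/eqP|lt]]; last 2 [by rewrite (negPf sn0)].
    rewrite mulf_eq0 invr_eq0 (negPf eb) orbF => /eqP ea; right.
    rewrite lt_neqAle vs andbT; apply/eqP => v0.
    have [/eqP|[c [d [ec ed E]]]] := vE s; first by rewrite (negPf sn0).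
    have := R_uniq h (conj ed (_ : s = i c / i d)).
    rewrite {1}E -v0 expr0z mul1r => /(_ erefl)/eqP.
    by rewrite ea mul0r eq_sym mulf_eq0 invr_eq0 (negPf ec) (negPf ed).
  apply/eqP; rewrite mulf_eq0; apply/orP; left; apply/negPn/negP => ea.
  have := vP s 0 a b sn0 ea eb; rewrite expr0z mul1r => /(_ sE) v0.
  by rewrite v0 ltxx in lt.
exists (Place vM OD rD rM r1 r0); split=> [|a b eb|z oz] /=.
- apply: (vP _ _ 1 1 ip); rewrite ?rmorph1 ?oner_eq0 //.
  by rewrite expr1z divr1 mulr1.
- have h : R (i a / i b) a b by [].
  by split; [apply/OR; exists a, b | apply: rE h].
- by have /OR[a [b h]] := oz; exists a, b.
Qed.

End PrincipalPlace.

(** * Blow-ups and rational residue fields *)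

Section RationalResidueField.
Variables (k E F : fieldType) (P : place E F).
Variables (c0 : {rmorphism k -> E}) (c : {rmorphism k -> F}).
Hypothesis c0c : forall a, place_ring P (c0 a) /\ place_res P (c0 a) = c a.
Local Notation v := (place_val P).
Local Notation r := (place_res P).
Local Notation ring := (place_ring P).

Lemma place_horner (p : {poly k}) y : ring y ->
  ring (map_poly c0 p).[y] /\ r (map_poly c0 p).[y] = (map_poly c p).[r y].
Proof.
move=> oy; elim/poly_ind: p => [|p a [IHo IHr]].
  by rewrite !rmorph0 !horner0 place_res0; split=> //; left.
rewrite !rmorphD !rmorphM /= !map_polyX !map_polyC !hornerE.
have [oa ra] := c0c a; have op := place_ringM IHo oy.
by split; [exact: place_ringD | rewrite place_resD // place_resM // IHr ra].
Qed.

Section Generation.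

(** The subring k[X, Y], given by closure rules rather than by bivariate polynomials so that a
    change of generators is a plain induction. *)
Inductive gen (X Y : E) : E -> Prop :=
| gen_const a : gen X Y (c0 a)
| gen_fst : gen X Y X
| gen_snd : gen X Y Y
| gen_add s t : gen X Y s -> gen X Y t -> gen X Y (s + t)
| gen_mul s t : gen X Y s -> gen X Y t -> gen X Y (s * t).

Definition generates X Y :=
  forall z, exists p q, [/\ gen X Y p, gen X Y q, q != 0 & z = p / q].

Lemma sub_gen X Y X' Y' : gen X' Y' X -> gen X' Y' Y ->
  forall s, gen X Y s -> gen X' Y' s.
Proof.
move=> gX gY s; elim=> [a|//|//|s1 t1 _ g1 _ g2|s1 t1 _ g1 _ g2].
- exact: gen_const.
- exact: gen_add.
- exact: gen_mul.
Qed.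

Lemma sub_generates X Y X' Y' : gen X' Y' X -> gen X' Y' Y ->
  generates X Y -> generates X' Y'.
Proof.
move=> gX gY G z; have [p [q [gp gq qn0 ->]]] := G z.
by exists p, q; split=> //; apply: (@sub_gen X Y).
Qed.

Lemma gen_ring X Y s : ring X -> ring Y -> gen X Y s -> ring s.
Proof.
move=> oX oY; elim=> [a|//|//|s1 t1 _ g1 _ g2|s1 t1 _ g1 _ g2].
- by case: (c0c a).
- exact: place_ringD.
- exact: place_ringM.
Qed.

(** The polynomial [p] is the restriction to the line Y = 0, the part that survives when Y has
    residue 0. *)
Lemma gen_split X Y s : gen X Y s ->
  exists p s', gen X Y s' /\ s = (map_poly c0 p).[X] + Y * s'.
Proof.
have g0 : gen X Y 0 by rewrite -(rmorph0 c0); apply: gen_const.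
have gp (p : {poly k}) : gen X Y (map_poly c0 p).[X].
  elim/poly_ind: p => [|p a IH]; first by rewrite rmorph0 horner0.
  rewrite rmorphD rmorphM /= map_polyX map_polyC !hornerE.
  by apply: gen_add (gen_const _ _ _); apply: gen_mul (gen_fst _ _).
elim=> [a|||s1 t1 g1 [p [s' [gs' ->]]] g2 [q [t' [gt' ->]]]
       |s1 t1 g1 [p [s' [gs' ->]]] g2 [q [t' [gt' ->]]]].
- by exists a%:P, 0; rewrite map_polyC hornerC mulr0 addr0.
- by exists 'X, 0; rewrite map_polyX hornerX mulr0 addr0.
- exists 0, 1; rewrite rmorph0 horner0 add0r mulr1; split=> //.
  by rewrite -(rmorph1 c0); apply: gen_const.
- exists (p + q), (s' + t'); split; first exact: gen_add.
  by rewrite rmorphD hornerD; ring.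
- exists (p * q), ((map_poly c0 p).[X] * t' + (map_poly c0 q).[X] * s' + Y * s' * t').
  split; last by rewrite rmorphM hornerM; ring.
  have gY := gen_snd X Y.
  by repeat (apply: gen_add || apply: gen_mul).
Qed.

(** The constant [a] is the value at the origin, where the place is centred when X and Y both have
    residue 0. *)
Lemma gen_split0 X Y s : gen X Y s ->
  exists a p1 p2, [/\ gen X Y p1, gen X Y p2 & s = c0 a + X * p1 + Y * p2].
Proof.
move=> /gen_split[p [s' [gs' ->]]].
have [q [a ->]] : exists q a, p = q * 'X + a%:P.
  exists (drop_poly 1 p), p`_0; rewrite -{1}(poly_take_drop 1 p) expr1 addrC.
  by congr (_ + _); apply/polyP => -[|i]; rewrite coef_take_poly coefC.
exists a, (map_poly c0 q).[X], s'; split=> //.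
  elim/poly_ind: q => [|q b IH].
    by rewrite rmorph0 horner0 -(rmorph0 c0); apply: gen_const.
  rewrite rmorphD rmorphM /= map_polyX map_polyC !hornerE.
  by apply: gen_add (gen_const _ _ _); apply: gen_mul (gen_fst _ _).
by rewrite rmorphD rmorphM /= map_polyX map_polyC !hornerE; ring.
Qed.

End Generation.

Lemma place_val_lt Y q q' : Y != 0 -> q' != 0 -> ring Y -> r Y = 0 ->
  q = Y * q' -> v q' < v q.
Proof.
move=> Yn0 q'n0 oY rY ->; rewrite place_valM // ltrDr.
by have [/eqP|//] := (place_res_eq0 oY).1 rY; rewrite (negPf Yn0).
Qed.

(** The place is then that of the line Y = 0, with residue field generated by the residue of X. If
    the denominator vanishes on this line, so does the numerator; cancelling Y from both lowers the
    valuation of the denominator. *)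
Lemma residue_of_transcendental X Y : ring X -> transcendental c (r X) ->
  ring Y -> r Y = 0 -> generates X Y ->
  forall z, ring z -> exists p q : {poly k}, q != 0 /\
    r z = (map_poly c p).[r X] / (map_poly c q).[r X].
Proof.
move=> oX tr oY rY G z oz.
have [p [q [gp gq qn0 zE]]] := G z.
have [n] : exists n : nat, v q < n%:Z by exists (absz (v q)).+1; lia.
elim: n p q gp gq qn0 zE => [|n IH] p q gp gq qn0 zE vq.
  have := place_ring_val qn0 (gen_ring oX oY gq); lia.
have [p0 [p1 [gp1 pE]]] := gen_split gp.
have [q0 [q1 [gq1 qE]]] := gen_split gq.
have resE s s0 s1 : gen X Y s1 -> s = (map_poly c0 s0).[X] + Y * s1 ->
    ring s /\ r s = (map_poly c s0).[r X].
  move=> g1 ->; have [o0 r0] := place_horner s0 oX.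
  have o1 := gen_ring oX oY g1; have oY1 := place_ringM oY o1.
  split; first exact: place_ringD.
  by rewrite place_resD // r0 place_resM // rY mul0r addr0.
have [op rp] := resE _ _ _ gp1 pE; have [oq rq] := resE _ _ _ gq1 qE.
have [q00|q0n0] := eqVneq q0 0; last first.
  have rqn0 : r q != 0 by rewrite rq transcendental_eval.
  exists p0, q0; split=> //; rewrite zE place_resM //; last exact: place_ringV.
  by rewrite place_resV // rp rq.
move: rq qE; rewrite q00 !rmorph0 !horner0 add0r => rq qE.
have Yn0 : Y != 0 by apply: contra_neq qn0 => Y0; rewrite qE Y0 mul0r.
have q1n0 : q1 != 0 by apply: contra_neq qn0 => h; rewrite qE h mulr0.
have p00 : p0 = 0.
  apply/eqP; rewrite -(transcendental_eval p0 tr) -rp.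
  have -> : p = z * q by rewrite zE divfK.
  by rewrite place_resM // rq mulr0.
move: pE; rewrite p00 rmorph0 horner0 add0r => pE.
apply: (IH p1 q1) => //.
  by rewrite zE pE qE -mulf_div divff // mul1r.
have := place_val_lt Yn0 q1n0 oY rY qE; lia.
Qed.

Hypothesis closed : forall x, algebraicOver c x -> exists a, x = c a.

(* Each step is a blow-up of the centre of the place; it decreases the
   valuation of the denominator of [s]. *)
Lemma transcendental_model X Y s : ring X -> ring Y -> r Y = 0 ->
  generates X Y -> ring s -> transcendental c (r s) ->
  exists X' Y', [/\ ring X', transcendental c (r X'), ring Y', r Y' = 0
    & generates X' Y'].
Proof.
move=> oX oY rY G os trs.
have [p [q [gp gq qn0 sE]]] := G s.
have [n] : exists n : nat, v q < n%:Z by exists (absz (v q)).+1; lia.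
elim: n X Y p q oX oY rY G gp gq qn0 sE => [|n IH] X Y p q oX oY rY G gp gq qn0 sE vq.
  have := place_ring_val qn0 (gen_ring oX oY gq); lia.
have [alg|tr] := pselect (algebraicOver c (r X)); last by exists X, Y.
have [a rX] := closed alg; have [oa ra] := c0c a; have [oNa rNa] := c0c (- a).
(* The residue of X is the constant a, so the centre is a rational point; it is translated to the
   origin. *)
pose X1 := X + c0 (- a).
have oX1 : ring X1 by apply: place_ringD.
have rX1 : r X1 = 0 by rewrite place_resD // rX rNa rmorphN subrr.
have gX : gen X1 Y X.
  have -> : X = X1 + c0 a by rewrite /X1 rmorphN subrK.
  exact: gen_add (gen_fst _ _) (gen_const _ _ _).
have gY := gen_snd X1 Y.
have [a1 [p1 [p2 [gp1 gp2 pE]]]] := gen_split0 (sub_gen gX gY gp).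
have [a2 [q1 [q2 [gq1 gq2 qE]]]] := gen_split0 (sub_gen gX gY gq).
have resE t a0 t1 t2 : gen X1 Y t1 -> gen X1 Y t2 -> t = c0 a0 + X1 * t1 + Y * t2 ->
    ring t /\ r t = c a0.
  move=> g1 g2 ->; have [o0 r0] := c0c a0.
  have o1 := gen_ring oX1 oY g1; have o2 := gen_ring oX1 oY g2.
  have h1 := place_ringM oX1 o1; have h2 := place_ringM oY o2.
  have h3 : ring (c0 a0 + X1 * t1) by apply: place_ringD.
  split; first exact: place_ringD.
  by rewrite !place_resD // !place_resM // r0 rX1 rY !mul0r !addr0.
have [op rp] := resE _ _ _ _ gp1 gp2 pE; have [oq rq] := resE _ _ _ _ gq1 gq2 qE.
(* With a nonzero constant term, q would be a unit at the centre and [s] would have a constant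
   residue. So q vanishes at the centre, and p = s q as well. *)
have [a20|a2n0] := eqVneq a2 0; last first.
  case: trs; have rqn0 : r q != 0 by rewrite rq fmorph_eq0.
  rewrite sE place_resM //; last exact: place_ringV.
  by rewrite place_resV // rp rq -fmorph_div; apply: algebraic_id.
move: rq qE; rewrite a20 !rmorph0 add0r => rq qE.
have a10 : a1 = 0.
  apply/eqP; rewrite -(fmorph_eq0 c) -rp.
  have -> : p = s * q by rewrite sE divfK.
  by rewrite place_resM // rq mulr0.
move: pE; rewrite a10 rmorph0 add0r => pE.
(* One chart of the blow-up: Y' is an equation of the exceptional curve, and it divides both p and
   q. *)
have step X' Y' p' q' : Y' != 0 -> ring X' -> ring Y' -> r Y' = 0 ->
    gen X' Y' X1 -> gen X' Y' Y -> gen X' Y' p' -> gen X' Y' q' ->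
    p = Y' * p' -> q = Y' * q' -> exists X' Y', [/\ ring X',
      transcendental c (r X'), ring Y', r Y' = 0 & generates X' Y'].
  move=> Y'n0 oX' oY' rY' gX1 gY1 gp' gq' p'E q'E.
  have q'n0 : q' != 0 by apply: contra_neq qn0 => h; rewrite q'E h mulr0.
  apply: (IH X' Y' p' q') => //.
  - apply: sub_generates G => //.
    exact: sub_gen gX.
  - by rewrite sE p'E q'E -mulf_div divff // mul1r.
  - have := place_val_lt Y'n0 q'n0 oY' rY' q'E; lia.
have case2 : X1 != 0 -> ring (Y / X1) -> exists X' Y', [/\ ring X',
      transcendental c (r X'), ring Y', r Y' = 0 & generates X' Y'].
  move=> X1n0 o'.
  have gX1' := gen_snd (Y / X1) X1.
  have gY' : gen (Y / X1) X1 Y.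
    by rewrite -{2}(divfK X1n0 Y); apply: gen_mul (gen_fst _ _) _.
  have S := sub_gen gX1' gY'.
  apply: (step (Y / X1) X1 (p1 + (Y / X1) * p2) (q1 + (Y / X1) * q2)) => //.
  - by apply: gen_add; [exact: S | apply: gen_mul (gen_fst _ _) (S _ _)].
  - by apply: gen_add; [exact: S | apply: gen_mul (gen_fst _ _) (S _ _)].
  - by rewrite pE; field.
  - by rewrite qE; field.
(* If Y = 0 then X1 is nonzero, as it divides q, and the chart with coordinate Y / X1 = 0
   applies. *)
have [Y0|Yn0] := eqVneq Y 0.
  apply: case2; last by left; rewrite Y0 mul0r.
  by apply: contra_neq qn0 => h; rewrite qE h Y0 !mul0r addr0.
have [o'|[X1n0 o']] : ring (X1 / Y) \/ X1 != 0 /\ ring (Y / X1); last exact: case2.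
  have [->|X1n0] := eqVneq X1 0; first by left; left; rewrite mul0r.
  by have [|[]] := place_total P (X1 / Y); [left | rewrite invf_div; right].
have gY' := gen_snd (X1 / Y) Y.
have gX1' : gen (X1 / Y) Y X1.
  by rewrite -{2}(divfK Yn0 X1); apply: gen_mul (gen_fst _ _) _.
have S := sub_gen gX1' gY'.
apply: (step (X1 / Y) Y ((X1 / Y) * p1 + p2) ((X1 / Y) * q1 + q2)) => //.
- by apply: gen_add; [apply: gen_mul (gen_fst _ _) (S _ _) | exact: S].
- by apply: gen_add; [apply: gen_mul (gen_fst _ _) (S _ _) | exact: S].
- by rewrite pE; field.
- by rewrite qE; field.
Qed.

Lemma rational_residue_field X Y s : ring X -> ring Y -> r Y = 0 ->
  generates X Y -> ring s -> transcendental c (r s) ->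
  (forall z, exists t, ring t /\ r t = z) ->
  field_iso_over (@const1 k) c.
Proof.
move=> oX oY rY G os trs surj.
have [X' [Y' [oX' tr oY' rY' G']]] := transcendental_model oX oY rY G os trs.
have [u uE] := evalf_rmorphism tr.
apply: (@field_iso_of_surj _ _ _ _ _ u) => [z|a]; last by rewrite uE evalf_const.
have [t [ot <-]] := surj z.
have [p [q [qn0 ->]]] := residue_of_transcendental oX' tr oY' rY' G' ot.
exists (FracField.tofrac p / FracField.tofrac q).
by rewrite uE evalf_frac.
Qed.

End RationalResidueField.

Section QuadraticValues.
Variables (K L : fieldType) (j : {rmorphism K -> L}) (w : L) (f : K).
Hypothesis ww : w ^+ 2 = j f.
Hypothesis nf : forall h, f != h ^+ 2.

Definition qspan z := exists a b, z = j a + j b * w.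

Lemma qspan_horner (p : {poly K}) : qspan (map_poly j p).[w].
Proof.
elim/poly_ind: p => [|p a [b [d IH]]].
  by exists 0, 0; rewrite !rmorph0 horner0 mul0r addr0.
exists (d * f + a), b; rewrite rmorphD rmorphM /= map_polyX map_polyC !hornerE IH.
by rewrite rmorphD rmorphM /= -ww; ring.
Qed.

(** The quotient is computed with the conjugate c - d w of the denominator; its norm c^2 - d^2 f is
    nonzero because f is not a square. *)
Lemma qspan_div s t : qspan s -> qspan t -> qspan (s / t).
Proof.
move=> [a [b ->]] [c [d ->]]; set t' := _ + j d * w.
have [->|tn0] := eqVneq t' 0.
  by exists 0, 0; rewrite invr0 !rmorph0 mul0r mulr0 addr0.
have N0 : c ^+ 2 - d ^+ 2 * f != 0.
  apply: contra_neq tn0 => N0; have [d0|dn0] := eqVneq d 0.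
    move: N0; rewrite d0 expr0n mul0r subr0 => /eqP; rewrite sqrf_eq0 => /eqP c0.
    by rewrite /t' c0 d0 !rmorph0 mul0r addr0.
  have := nf (c / d); rewrite expr_div_n.
  have -> : c ^+ 2 = d ^+ 2 * f by apply: (eq_of_diff 1 N0); ring.
  by rewrite mulrAC divff ?mul1r ?eqxx // expf_neq0.
exists ((a * c - b * d * f) / (c ^+ 2 - d ^+ 2 * f)),
       ((b * c - a * d) / (c ^+ 2 - d ^+ 2 * f)).
have E : t' * (j c - j d * w) = j (c ^+ 2 - d ^+ 2 * f).
  by rewrite rmorphB !rmorphM /= -ww /t'; ring.
have jN : j (c ^+ 2 - d ^+ 2 * f) != 0 by rewrite fmorph_eq0.
rewrite !fmorph_div [X in _ = _ + X]mulrAC -mulrDl.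
by apply/eqP; rewrite eqr_div // -E /t' !rmorphB !rmorphM -ww; apply/eqP; ring.
Qed.

Lemma horner_quadratic_root (p : {poly K}) :
  (map_poly j p).[w] = 0 -> exists q, p = q * ('X^2 - f%:P).
Proof.
move=> p0; set h := 'X^2 - _.
have sh : size h = 3%N by rewrite size_XnsubC.
have hn0 : h != 0 by rewrite -size_poly_gt0 sh.
have pE := divp_eq p h; exists (p %/ h); rewrite {1}pE.
have r0 : (map_poly j (p %% h)).[w] = 0.
  move: p0; rewrite {1}pE rmorphD rmorphM hornerD hornerM /=.
  rewrite [map_poly j h]rmorphB /= map_polyXn map_polyC.
  by rewrite hornerD hornerN hornerXn hornerC ww subrr mulr0 add0r.
have sr : (size (modp p h) <= 2)%N by rewrite -ltnS -sh ltn_modp.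
suff -> : p %% h = 0 by rewrite addr0.
move: (p %% h) r0 sr => s s0 sr.
have sE : s = (s`_0)%:P + (s`_1)%:P * 'X.
  apply/polyP => i; rewrite coefD coefC mul_polyC coefZ coefX.
  case: i => [|[|i]] /=; rewrite ?mulr0 ?mulr1 ?addr0 ?add0r //.
  by rewrite nth_default // (leq_trans sr).
move: s0; rewrite sE rmorphD rmorphM /= map_polyX !map_polyC /= !hornerE.
by move=> /(quadratic_free ww nf) [-> ->]; rewrite polyC0 mul0r addr0.
Qed.

Lemma quadratic_factor (p : {poly K}) : p != 0 ->
  exists n q, (map_poly j q).[w] != 0 /\ p = ('X^2 - f%:P) ^+ n * q.
Proof.
have [n] := ubnP (size p); elim: n p => // n IH p sp pn0.
have [p0|] := eqVneq ((map_poly j p).[w]) 0; last first.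
  by exists 0%N, p; rewrite expr0 mul1r.
have [q pE] := horner_quadratic_root p0.
have qn0 : q != 0 by apply: contra_neq pn0 => q0; rewrite pE q0 mul0r.
have sq : (size q < n)%N.
  move: sp; rewrite pE mulrC size_monicM ?monicXnsubC // size_XnsubC //= ltnS; apply: ltnW.
have [m [q' [q'0 qE]]] := IH q sq qn0.
exists m.+1, q'; split; first exact: q'0.
by rewrite pE qE [_ ^+ m.+1]exprSr mulrAC.
Qed.

End QuadraticValues.

(** Since x t(x) = g and t is trivial on residues, the residue xi of x is a square root of g, and
    the residue field is generated by it over K. *)
Lemma invariant_place_spanned (K E F : fieldType) (i : {rmorphism K -> E}) (x : E)
    (g : K) (P : place E F) (m : {rmorphism K -> F}) (t : {rmorphism E -> E}) :
  (forall h, g != h ^+ 2) ->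
  (forall z, exists p q, (map_poly i q).[x] != 0 /\
     z = (map_poly i p).[x] / (map_poly i q).[x]) ->
  (forall q, place_ring P (i q) /\ place_res P (i q) = m q) ->
  (forall z, place_ring P z ->
     place_ring P (t z) /\ place_res P (t z) = place_res P z) ->
  t \o i =1 i -> t x = i g / x -> x != 0 ->
  (forall z, exists s, place_ring P s /\ place_res P s = z) ->
  exists2 xi, xi ^+ 2 = m g & spanned m xi.
Proof.
move=> ng G im tP ti tx xn0 surj.
have gn0 : g != 0 by have := ng 0; rewrite expr0n.
have ign0 : i g != 0 by rewrite fmorph_eq0.
have mgn0 : m g != 0 by rewrite fmorph_eq0.
(* At a pole of x, both x^-1 and its image x / g under t would have residue 0, although their
   product g^-1 is a unit. *)
have ox : place_ring P x.
  have [//|[o r0]] := place_total P x; exfalso.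
  have [o' r'] := tP _ o; move: r'; rewrite r0 fmorphV tx invf_div in o' * => r'.
  have [oV rV] := im g^-1.
  have : x^-1 * (x / i g) = i g^-1 by rewrite mulrA mulVf // mul1r fmorphV.
  move=> /(congr1 (place_res P)); rewrite place_resM // r0 mul0r rV => /esym/eqP.
  by rewrite fmorph_eq0 invr_eq0 (negPf gn0).
have [ot rt] := tP _ ox; set xi := place_res P x.
have xixi : xi ^+ 2 = m g.
  have [_ <-] := im g; have <- : t x * x = i g by rewrite tx divfK.
  by rewrite place_resM // rt expr2.
exists xi => // z; have [s [os <-]] := surj z.
change (qspan m xi (place_res P s)).
have ph p := @place_horner K E F P i m im p x ox.
have [p [q [qn0 sE]]] := G s.
have [n] := ubnP (size q); elim: n p q qn0 sE => // n IH p q qn0 sE sq.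
have [op rp] := ph p; have [oq rq] := ph q.
(* If the denominator vanishes at xi, numerator and denominator are both divisible by X^2 - g, which
   is cancelled. *)
have [q0|q0] := eqVneq (map_poly m q).[xi] 0; last first.
  have rqn0 : place_res P (map_poly i q).[x] != 0 by rewrite rq.
  rewrite sE place_resM //; last exact: place_ringV.
  by rewrite place_resV // rp rq; apply: (qspan_div xixi ng); apply: (qspan_horner xixi).
have p0 : (map_poly m p).[xi] = 0.
  rewrite -rp; have -> : (map_poly i p).[x] = s * (map_poly i q).[x].
    by rewrite sE divfK.
  by rewrite place_resM // rq q0 mulr0.
have [p' pE] := horner_quadratic_root xixi ng p0.
have [q' qE] := horner_quadratic_root xixi ng q0.
have hn0 : (map_poly i ('X^2 - g%:P)).[x] != 0.
  by apply: contra_neq qn0 => h; rewrite qE rmorphM hornerM h mulr0.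
have q'n0 : (map_poly i q').[x] != 0.
  by apply: contra_neq qn0 => h; rewrite qE rmorphM hornerM h mul0r.
apply: (IH p' q') => //.
  by rewrite sE pE qE !rmorphM !hornerM -mulf_div divff // mulr1.
have q'0 : q' != 0 by apply: contra_neq q'n0 => ->; rewrite rmorph0 horner0.
move: sq; rewrite qE mulrC size_monicM ?monicXnsubC // size_XnsubC //= ltnS; apply: ltnW.
Qed.

Lemma algebraic_closed (k : closedFieldType) (F : fieldType)
    (c : {rmorphism k -> F}) x : algebraicOver c x -> exists a, x = c a.
Proof.
move=> [p pn0]; have [rs ->] := closed_field_poly_normal p.
rewrite map_polyZ /= rootZ ?fmorph_eq0 ?lead_coef_eq0 // rmorph_prod /=.
have -> : \prod_(z <- rs) map_poly c ('X - z%:P) =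
          \prod_(z <- [seq c z | z <- rs]) ('X - z%:P).
  by rewrite big_map; apply: eq_bigr => z _; rewrite rmorphB /= map_polyX map_polyC.
by rewrite root_prod_XsubC => /mapP[a _ ->]; exists a.
Qed.

(** * The place of the curve x^2 = f and its transport *)

Section AdicPlace.
Variables (K L : fieldType) (j : {rmorphism K -> L}) (w : L) (f : K).
Hypothesis ww : w ^+ 2 = j f.
Hypothesis nf : forall h, f != h ^+ 2.
Local Notation E := (fun1 K).
Local Notation i := (@const1 K).
Local Notation x := (y1 K).

Lemma tofrac_horner (p : {poly K}) : FracField.tofrac p = (map_poly i p).[x].
Proof. exact: (@morph_tofracE K E i x idfun). Qed.

Lemma fun1_horner_frac (z : E) : exists p q, (map_poly i q).[x] != 0 /\
  z = (map_poly i p).[x] / (map_poly i q).[x].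
Proof.
have [n [d [dn0 ->]]] := fracP z; exists n, d; rewrite -!tofrac_horner.
by rewrite tofrac_eq0.
Qed.

(** The valuation of K(x) attached to the irreducible polynomial X^2 - f, with residue field
    K[sqrt f]. *)
Lemma adic_place : exists P : place E L,
  [/\ forall q, place_ring P (i q) /\ place_res P (i q) = j q,
      place_ring P x /\ place_res P x = w
    & forall z, place_ring P z -> exists a b, (map_poly j b).[w] != 0 /\
        z = (map_poly i a).[x] / (map_poly i b).[x]].
Proof.
pose e : {rmorphism {poly K} -> L} := horner_eval w \o map_poly j.
have [| | |s|z|P [_ P1 P2]] := @principal_place {poly K} E L
    (@FracField.tofrac {poly K}) e ('X^2 - f%:P).
- by move=> s /eqP; rewrite tofrac_eq0 => /eqP ->; rewrite rmorph0.
- by rewrite /e /= /horner_eval rmorphB /= map_polyXn map_polyC hornerD hornerN hornerXn hornerC ww subrr.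
- by rewrite tofrac_eq0 -size_poly_gt0 size_XnsubC.
- rewrite tofrac_eq0 => sn0; have [n [q [q0 sE]]] := quadratic_factor ww nf sn0.
  exists n, q, 1; split; [exact: q0 | by rewrite rmorph1 oner_eq0 |].
  by rewrite rmorph1 mul1r {1}sE rmorphM rmorphXn.
- by have [n [d [dn0 ->]]] := fracP z; exists n, d; rewrite tofrac_eq0.
have e1 : e 1 != 0 by rewrite rmorph1 oner_eq0.
exists P; split=> [q||z oz].
- have := P1 q%:P 1 e1; rewrite !rmorph1 !divr1.
  by rewrite {1}/e /= /horner_eval map_polyC hornerC.
- have := P1 'X 1 e1; rewrite !rmorph1 !divr1.
  by rewrite {1}/e /= /horner_eval map_polyX hornerX.
- have [a [b [eb ->]]] := P2 z oz; exists a, b; split; first exact: eb.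
  by rewrite -!tofrac_horner.
Qed.

(** The residues of x and of f / x are equal, because w = f / w. *)
Lemma adic_place_invariant (P : place E L) (t : {rmorphism E -> E}) :
  (forall q, place_ring P (i q) /\ place_res P (i q) = j q) ->
  place_ring P x /\ place_res P x = w ->
  (forall z, place_ring P z -> exists a b, (map_poly j b).[w] != 0 /\
        z = (map_poly i a).[x] / (map_poly i b).[x]) ->
  t \o i =1 i -> t x = i f / x ->
  forall z, place_ring P z ->
    place_ring P (t z) /\ place_res P (t z) = place_res P z.
Proof.
move=> ij [ox rx] Pz ti tx z oz.
have wn0 : w != 0.
  apply: contra_neq (nf 0) => w0; rewrite expr0n; apply/eqP.
  by rewrite -(fmorph_eq0 j) -ww w0 expr0n.
have rxn0 : place_res P x != 0 by rewrite rx.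
have [oi ri] := ij f.
have ot : place_ring P (t x).
  by rewrite tx; apply: place_ringM => //; apply: place_ringV.
have rt : place_res P (t x) = w.
  rewrite tx place_resM //; last exact: place_ringV.
  by rewrite place_resV // ri rx -ww expr2 mulfK.
have [a [b [bn0 zE]]] := Pz z oz.
have th p : t (map_poly i p).[x] = (map_poly i p).[t x].
  by rewrite -horner_map -map_poly_comp (eq_map_poly ti).
have [oa ra] := place_horner ij a ox; have [ob rb] := place_horner ij b ox.
have [ota rta] := place_horner ij a ot; have [otb rtb] := place_horner ij b ot.
rewrite rx in ra rb; rewrite rt in rta rtb.
have rbn0 : place_res P (map_poly i b).[x] != 0 by rewrite rb.
have rtbn0 : place_res P (map_poly i b).[t x] != 0 by rewrite rtb.
have obV := place_ringV ob rbn0; have otbV := place_ringV otb rtbn0.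
rewrite zE fmorph_div !th; split; first exact: place_ringM.
by rewrite !place_resM // !place_resV // ra rb rta rtb.
Qed.

End AdicPlace.

Section FractionsOfGenerated.
Variables (k E : fieldType) (c0 : {rmorphism k -> E}) (X Y : E).

Definition gen_frac z :=
  exists p q, [/\ gen c0 X Y p, gen c0 X Y q, q != 0 & z = p / q].

Lemma gen_frac_gen p : gen c0 X Y p -> gen_frac p.
Proof.
move=> gp; exists p, 1; split; rewrite ?oner_eq0 ?divr1 //.
by rewrite -(rmorph1 c0); apply: gen_const.
Qed.

Lemma gen_frac_add s t : gen_frac s -> gen_frac t -> gen_frac (s + t).
Proof.
move=> [p [q [gp gq qn0 ->]]] [p' [q' [gp' gq' q'n0 ->]]].
exists (p * q' + p' * q), (q * q'); split; rewrite ?mulf_neq0 ?addf_div //.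
  by apply: gen_add; apply: gen_mul.
exact: gen_mul.
Qed.

Lemma gen_frac_mul s t : gen_frac s -> gen_frac t -> gen_frac (s * t).
Proof.
move=> [p [q [gp gq qn0 ->]]] [p' [q' [gp' gq' q'n0 ->]]].
exists (p * p'), (q * q'); split; rewrite ?mulf_neq0 ?mulf_div //.
  exact: gen_mul.
exact: gen_mul.
Qed.

Lemma gen_frac_inv s : gen_frac s -> gen_frac s^-1.
Proof.
move=> [p [q [gp gq qn0 ->]]]; have [->|pn0] := eqVneq p 0.
  by rewrite mul0r invr0; apply: gen_frac_gen; rewrite -(rmorph0 c0); apply: gen_const.
by exists q, p; split=> //; rewrite invf_div.
Qed.

End FractionsOfGenerated.

Lemma generates_fun2 (k : fieldType) (X Y : fun2 k) :
  gen_frac (@const2 k) X Y (x2 k) -> gen_frac (@const2 k) X Y (y2 k) ->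
  generates (@const2 k) X Y.
Proof.
move=> gx gy; apply: (@fun2_ind k (gen_frac (@const2 k) X Y)).
- by move=> a; apply: gen_frac_gen; apply: gen_const.
- exact: gx.
- exact: gy.
- exact: gen_frac_add.
- exact: gen_frac_mul.
- exact: gen_frac_inv.
Qed.

Lemma gen_frac_shift (k E : fieldType) (c0 : {rmorphism k -> E}) X z a :
  gen_frac c0 X (z + c0 (- a)) z.
Proof.
have := gen_add (gen_snd c0 X (z + c0 (- a))) (gen_const _ _ _ a).
by rewrite rmorphN subrK; apply: gen_frac_gen.
Qed.

Section ConjugateInvolutions.
Variable k : closedFieldType.
Local Notation i := (@fun1_to_fun2 k).
Local Notation x := (x2 k).
Local Notation y := (y2 k).

(** The case where y is constant on the divisor: Y is y - a or y^-1 and vanishes there. Either x or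
    x^-1 is regular, which gives affine coordinates to start the blow-ups from. *)
Lemma nonconstant_place (F : fieldType) (P : place (fun2 k) F)
    (c : {rmorphism k -> F}) (Y : fun2 k) :
  (forall a, place_ring P (const2 a) /\ place_res P (const2 a) = c a) ->
  place_ring P Y -> place_res P Y = 0 ->
  gen_frac (@const2 k) x Y y -> gen_frac (@const2 k) x^-1 Y y ->
  (exists s, place_ring P s /\ transcendental c (place_res P s)) ->
  (forall z, exists s, place_ring P s /\ place_res P s = z) ->
  field_iso_over (@const1 k) c.
Proof.
move=> cP oY rY gy gy' [s [os trs]] surj.
have cl := @algebraic_closed k F c.
have [ox|[ox _]] := place_total P x.
  apply: (rational_residue_field cP cl ox oY rY _ os trs surj).
  apply: generates_fun2 gy.
  exact: gen_frac_gen (gen_fst _ _ _).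
apply: (rational_residue_field cP cl ox oY rY _ os trs surj).
apply: generates_fun2 gy'.
have := gen_frac_inv (gen_frac_gen (gen_fst (@const2 k) x^-1 Y)).
by rewrite invrK.
Qed.

(** When y has transcendental residue, nonzero polynomials in y are units, so the residue map embeds
    the whole of [k(y)]. *)
Lemma place_fun1_transcendental (F : fieldType) (P : place (fun2 k) F)
    (c : {rmorphism k -> F}) :
  (forall a, place_ring P (const2 a) /\ place_res P (const2 a) = c a) ->
  place_ring P y -> transcendental c (place_res P y) ->
  exists m : {rmorphism fun1 k -> F}, m \o @const1 k =1 c /\
    forall q, place_ring P (i q) /\ place_res P (i q) = m q.
Proof.
move=> cP oy tr; have [m mE] := evalf_rmorphism tr; exists m.
have mc : m \o @const1 k =1 c.
  by move=> a; rewrite [LHS]mE; apply: evalf_const.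
have my : m (y1 k) = place_res P y by rewrite mE; apply: evalf_y1.
split; first exact: mc.
have hp (p : {poly k}) : place_ring P (i (FracField.tofrac p)) /\
    place_res P (i (FracField.tofrac p)) = m (FracField.tofrac p).
  have -> : i (FracField.tofrac p) = (map_poly (@const2 k) p).[y].
    by apply: (@morph_tofracE k (fun2 k) (@const2 k) y i p) => // a.
  rewrite (morph_tofracE p mc my).
  exact: place_horner.
move=> q; have [n [d [dn0 ->]]] := fracP q.
have [on rn] := hp n; have [od rd] := hp d.
have rdn0 : place_res P (i (FracField.tofrac d)) != 0.
  rewrite rd; apply: fmorph_neq0; by rewrite tofrac_eq0.
have oV := place_ringV od rdn0.
have iE : i (FracField.tofrac n / FracField.tofrac d) =
    i (FracField.tofrac n) / i (FracField.tofrac d) by exact: fmorph_div.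
split; first exact: (eq_ind_r (place_ring P) (place_ringM on oV) iE).
apply: etrans (congr1 (place_res P) iE) _.
apply: etrans (place_resM on oV) _.
have rV := etrans (place_resV od rdn0) (congr1 GRing.inv rd).
apply: etrans (congr2 *%R rn rV) _.
exact: esym (fmorph_div m (FracField.tofrac n) (FracField.tofrac d)).
Qed.

(** The first alternative occurs when y is transcendental on the divisor, the second when y is
    infinite or constant on it. *)
Lemma place_residue_field (F : fieldType) (P : place (fun2 k) F)
    (c : {rmorphism k -> F}) (g : fun1 k) (ng : nonsquare g)
    (t : {rmorphism fun2 k -> fun2 k}) :
  (forall a, place_ring P (const2 a) /\ place_res P (const2 a) = c a) ->
  (forall z, place_ring P z ->
     place_ring P (t z) /\ place_res P (t z) = place_res P z) ->
  t \o i =1 i -> t x = i g / x ->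
  (exists s, place_ring P s /\ transcendental c (place_res P s)) ->
  (forall z, exists s, place_ring P s /\ place_res P s = z) ->
  field_iso_over (sqrt_const ng) c \/ field_iso_over (@const1 k) c.
Proof.
move=> cP tP ti tx ex surj.
have [oy|[oy ry]] := place_total P y; last first.
  right; apply: (nonconstant_place cP oy ry _ _ ex surj).
    by have := gen_frac_inv (gen_frac_gen (gen_snd (@const2 k) x y^-1)); rewrite invrK.
  by have := gen_frac_inv (gen_frac_gen (gen_snd (@const2 k) x^-1 y^-1)); rewrite invrK.
have [alg|tr] := pselect (algebraicOver c (place_res P y)).
  right; have [a ra] := algebraic_closed alg.
  have [oN rN] := cP (- a).
  have gy X : gen_frac (@const2 k) X (y + const2 (- a)) y.
    exact: gen_frac_shift.
  apply: (nonconstant_place cP _ _ (gy _) (gy _) ex surj).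
    exact: (place_ringD oy oN).
  apply: etrans (place_resD oy oN) _; apply: etrans (congr2 +%R ra rN) _.
  by rewrite rmorphN subrr.
left; have [m [mc mP]] := place_fun1_transcendental cP oy tr.
have [xi xixi sp] := invariant_place_spanned ng (@fun1_horner_frac (fun1 k)) mP tP
  ti tx (x2_neq0 k) surj.
have [u [uj uw]] := quadratic_lift (sqrt_genE ng) ng (@sqrt_ext_spanned k g ng) xixi.
apply: (@field_iso_of_surj _ _ _ _ _ u) => [z|a].
  have [a [b ->]] := sp z.
  exists (sqrt_incl ng a + sqrt_incl ng b * sqrt_gen ng).
  by rewrite rmorphD rmorphM uw [u (_ a)]uj [u (_ b)]uj.
exact: etrans (uj (const1 a)) (mc a).
Qed.

(** The place of the curve x^2 = f, pulled back along [U], keeps its residue field, and it is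
    invariant under [tg] because U tg = tf U. *)
Lemma conjugate_iota_residue (f g : fun1 k) (nf : nonsquare f) (ng : nonsquare g)
    (U V tf tg : {rmorphism fun2 k -> fun2 k}) :
  cancel V U -> U \o @const2 k =1 @const2 k ->
  tf \o i =1 i -> tf x = i f / x -> tg \o i =1 i -> tg x = i g / x ->
  (forall z, U (tg z) = tf (U z)) ->
  field_iso_over (sqrt_const ng) (sqrt_const nf) \/
  field_iso_over (@const1 k) (sqrt_const nf).
Proof.
move=> VU Uc tfi tfx tgi tgx Ut.
have [P [P1 P2 P3]] := adic_place (sqrt_genE nf) nf.
have inv := adic_place_invariant (sqrt_genE nf) nf P1 P2 P3 tfi tfx.
pose Q := place_pullback U P.
have ringQ z : place_ring P (U z) -> place_ring Q z.
  move=> [Uz|]; last by right.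
  by left; apply/eqP; rewrite -(fmorph_eq0 U) Uz.
have Qring z : place_ring Q z -> place_ring P (U z).
  by move=> [->|]; [left; exact: rmorph0 | right].
have cQ a : place_ring Q (const2 a) /\
    place_res Q (const2 a) = (sqrt_incl nf \o @const1 k) a.
  have [o r] := P1 (const1 a).
  have E1 : U (const2 a) = i (const1 a) := Uc a.
  split; first by apply: ringQ; rewrite E1.
  exact: etrans (congr1 (place_res P) E1) r.
apply: (@place_residue_field _ Q (sqrt_incl nf \o @const1 k) g ng tg cQ _ tgi tgx).
- move=> z /Qring /inv [o r]; split; first by apply: ringQ; rewrite Ut.
  exact: etrans (congr1 (place_res P) (Ut z)) r.
(* The function carried to y by [U]; its residue is y in K_f. *)
- exists (V (i (y1 k))); have [o r] := P1 (y1 k); split.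
    by apply: ringQ; rewrite VU.
  have -> : place_res Q (V (i (y1 k))) = sqrt_incl nf (y1 k).
    exact: etrans (congr1 (place_res P) (VU (i (y1 k)))) r.
  exact: (@transcendental_morph _ _ _ (@const1 k) (sqrt_incl nf) (y1 k)
    (@y1_transcendental k)).
- move=> z; have [a [b ->]] := @sqrt_ext_spanned k f nf z.
  have [oa ra] := P1 a; have [ob rb] := P1 b; have [ox rx] := P2.
  have obx := place_ringM ob ox.
  have o : place_ring P (i a + i b * x) := place_ringD oa obx.
  exists (V (i a + i b * x)).
  split; first exact: (ringQ _ (eq_ind_r (place_ring P) o (VU (i a + i b * x)))).
  apply: etrans (congr1 (place_res P) (VU (i a + i b * x))) _.
  apply: etrans (place_resD oa obx) _; rewrite ra.
  by apply: etrans (congr1 _ (place_resM ob ox)) _; rewrite rb rx.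
Qed.

Lemma conjugate_iota_field_iso (f g : fun1 k) (nf : nonsquare f) (ng : nonsquare g) :
  conjugate_elts_in (Bir k) (iota_inv f) (iota_inv g) ->
  field_iso_over (sqrt_const nf) (sqrt_const ng).
Proof.
move=> [phi [psi [_ inv E]]].
have [U [V [pU pV UV VU]]] := inverse_maps_pullbacks inv.
have [tf [ptf tfi tfx]] := iota_pullback (nonsquare_neq0 nf).
have [tg [ptg tgi tgx]] := iota_pullback (nonsquare_neq0 ng).
have p := is_pullback_comp pU (is_pullback_comp ptf pV); rewrite E in p.
have tgE z : tg z = V (tf (U z)).
  transitivity (subst (iota_inv g) z); first exact: esym (is_pullback_subst ptg z).
  exact: is_pullback_subst p z.
have [cU _ _] := pU; have [cV _ _] := pV.
have Ut z : U (tg z) = tf (U z) by rewrite tgE VU.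
have Vt z : V (tf z) = tg (V z) by rewrite tgE VU.
have [s1|s1] := conjugate_iota_residue nf ng VU cU tfi tfx tgi tgx Ut.
  exact: field_iso_over_sym.
(* In the remaining case both fields are isomorphic to [k(y)]. *)
have [//|s2] := conjugate_iota_residue ng nf UV cV tgi tgx tfi tfx Vt.
exact: field_iso_over_trans (field_iso_over_sym s1) s2.
Qed.

End ConjugateInvolutions.

(** * Orders of vanishing *)

Section PolynomialOrder.
Variable k : fieldType.
Implicit Types (p q : {poly k}) (a : option k).

(* The order at infinity of p is 1 - size p = - deg p for p != 0. *)
Definition poly_ord a p : int :=
  if a is Some t then (mup t p)%:Z else 1 - (size p)%:Z.

Lemma poly_ordM a p q : p != 0 -> q != 0 ->
  poly_ord a (p * q) = poly_ord a p + poly_ord a q.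
Proof.
move=> pn0 qn0; case: a => [t|] /=; first by rewrite mupM // PoszD.
rewrite size_mul //; move: pn0 qn0; rewrite -!size_poly_gt0.
by case: (size p) => // m _; case: (size q) => // n _; lia.
Qed.

Lemma poly_ord_linear a (c d : k) : (c != 0) || (d != 0) ->
  poly_ord a (c *: 'X + d%:P) =
  if a is Some t then (c * t + d == 0)%:Z else - (c != 0)%:Z.
Proof.
move=> cd; have pn0 : c *: 'X + d%:P != 0.
  apply: contraL cd => /eqP E.
  have := congr1 (fun p : {poly k} => p`_0) E.
  have := congr1 (fun p : {poly k} => p`_1) E.
  rewrite !coefD !coefZ !coefX !coefC /= mulr0 mulr1 addr0 add0r => -> ->.
  by rewrite eqxx.
have [c0|cn0] := eqVneq c 0.
  move: cd; rewrite c0 eqxx /= => dn0; rewrite scale0r add0r.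
  case: a => [t|] /=; last by rewrite size_polyC dn0.
  by rewrite mul0r add0r (negPf dn0) mupNroot // rootC.
have E : c *: 'X + d%:P = c%:P * ('X - (- d / c)%:P).
  rewrite mulrBr -polyCM mul_polyC; congr (_ + _); rewrite -polyCN; congr (_%:P).
  by field.
case: a => [t|] /=; last first.
  by rewrite E size_Cmul // size_XsubC.
rewrite E mupMr ?rootC // -['X - _]expr1 mup_XsubCX.
congr (Posz _); have -> : (- d / c == t) = (c * t + d == 0).
  apply/eqP/eqP => [<-|h]; first by field.
  by apply: (mulfI cn0); apply: (eq_of_diff (-1) h); field.
by case: eqP.
Qed.

Lemma ord_at_frac a (n d : {poly k}) : n != 0 -> d != 0 ->
  ord_at a (FracField.tofrac n / FracField.tofrac d) =
  poly_ord a n - poly_ord a d.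
Proof.
move=> nn0 dn0; set h := _ / _; have [d'n0 hE] := frac_repr h.
have -> : ord_at a h = poly_ord a \n_(repr h) - poly_ord a \d_(repr h).
  by rewrite /ord_at /=; case: a => [t|] //=; ring.
move: \n_(repr h) \d_(repr h) d'n0 hE => n' d' d'n0.
rewrite /h => /eqP; rewrite eqr_div ?tofrac_eq0 // -!rmorphM tofrac_eq => /eqP E.
have n'n0 : n' != 0.
  by apply: contra_neq (mulf_neq0 nn0 d'n0) => h0; rewrite E h0 mul0r.
have := congr1 (poly_ord a) E; rewrite !poly_ordM //; lia.
Qed.

Lemma ord_at_tofrac a p : p != 0 -> ord_at a (FracField.tofrac p) = poly_ord a p.
Proof.
move=> pn0; have := ord_at_frac a pn0 (oner_neq0 {poly k}).
rewrite rmorph1 divr1 => ->; rewrite -[1]polyC1.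
have := @poly_ord_linear a 0 1; rewrite oner_eq0 orbT scale0r add0r => -> //.
by case: a => [t|]; rewrite ?mul0r ?add0r ?oner_eq0 ?eqxx /= ?oppr0 subr0.
Qed.

Lemma frac_neq0 (h : fun1 k) : h != 0 -> exists n d : {poly k},
  [/\ n != 0, d != 0 & h = FracField.tofrac n / FracField.tofrac d].
Proof.
move=> hn0; have [n [d [dn0 hE]]] := fracP h; exists n, d; split=> //.
by apply: contra_neq hn0 => n0; rewrite hE n0 rmorph0 mul0r.
Qed.

Lemma ord_atM a (g h : fun1 k) : g != 0 -> h != 0 ->
  ord_at a (g * h) = ord_at a g + ord_at a h.
Proof.
move=> /frac_neq0[n [d [nn0 dn0 ->]]] /frac_neq0[m [e [mn0 en0 ->]]].
rewrite mulf_div -!rmorphM !ord_at_frac ?mulf_neq0 // !poly_ordM //.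
by rewrite opprD addrACA.
Qed.

Lemma ord_at_sqrM a (g h : fun1 k) : g != 0 -> h != 0 ->
  ord_at a (g ^+ 2 * h) = ord_at a g *+ 2 + ord_at a h.
Proof.
move=> gn0 hn0; have g2 : g * g != 0 := mulf_neq0 gn0 gn0.
have := ord_atM a g2 hn0; rewrite (ord_atM a gn0 gn0) => <-.
by [].
Qed.

Lemma ord_at1 a : ord_at a (1 : fun1 k) = 0.
Proof.
have := ord_atM a (oner_neq0 (fun1 k)) (oner_neq0 (fun1 k)).
by rewrite mulr1 => /eqP; rewrite -subr_eq subrr eq_sym => /eqP.
Qed.

Lemma ord_atV a (h : fun1 k) : h != 0 -> ord_at a h^-1 = - ord_at a h.
Proof.
move=> hn0; have := ord_atM a hn0 (invr_neq0 hn0).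
by rewrite mulfV // ord_at1 => /eqP; rewrite eq_sym addrC addr_eq0 => /eqP.
Qed.

(** The functions y - s already tell all points apart. *)
Lemma ord_at_inj a b : (forall h : fun1 k, h != 0 -> ord_at a h = ord_at b h) ->
  a = b.
Proof.
have lin (t : k) (c : option k) :
    ord_at c (FracField.tofrac ('X - t%:P)) = if c is Some s then (s == t)%:Z else -1.
  rewrite ord_at_tofrac ?polyXsubC_eq0 //.
  have := @poly_ord_linear c 1 (- t); rewrite oner_eq0 scale1r polyCN => -> //.
  by case: c => [s|] //; rewrite mul1r subr_eq0.
have nz (t : k) : FracField.tofrac ('X - t%:P) != 0 :> fun1 k.
  by rewrite tofrac_eq0 polyXsubC_eq0.
move=> E; case: a b E => [s|] [t|] E //.
- have := E _ (nz s); rewrite !lin eqxx.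
  by case: eqP => // ->.
- by have := E _ (nz s); rewrite !lin eqxx.
- by have := E _ (nz t); rewrite !lin eqxx.
Qed.

End PolynomialOrder.

Section OrderSubstitution.
Variable k : closedFieldType.

(** Over an algebraically closed field, constants and the functions y - a generate the
    multiplicative group of [k(y)]. *)
Lemma fun1_mul_ind (Q : fun1 k -> Prop) :
  (forall a, a != 0 -> Q (const1 a)) ->
  (forall a, Q (FracField.tofrac ('X - a%:P))) ->
  (forall s t, s != 0 -> t != 0 -> Q s -> Q t -> Q (s * t)) ->
  (forall s, s != 0 -> Q s -> Q s^-1) ->
  forall h, h != 0 -> Q h.
Proof.
move=> Qc QX QM QV.
have Qp (p : {poly k}) : p != 0 -> Q (FracField.tofrac p).
  move=> pn0; have [rs pE] := closed_field_poly_normal p.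
  rewrite pE -mul_polyC rmorphM; apply: (QM).
  - by rewrite tofrac_eq0 polyC_eq0 lead_coef_eq0.
  - by rewrite tofrac_eq0 monic_neq0 // monic_prod_XsubC.
  - by apply: Qc; rewrite lead_coef_eq0.
  elim: rs {pE} => [|r rs IH].
    by rewrite big_nil; apply: (Qc 1); rewrite oner_eq0.
  rewrite big_cons rmorphM; apply: (QM).
  - by rewrite tofrac_eq0 polyXsubC_eq0.
  - by rewrite tofrac_eq0 monic_neq0 // monic_prod_XsubC.
  - exact: QX.
  - exact: IH.
move=> h /frac_neq0[n [d [nn0 dn0 ->]]].
apply: (QM); rewrite ?invr_eq0 ?tofrac_eq0 //; first exact: Qp.
by apply: (QV); [rewrite tofrac_eq0 | apply: Qp].
Qed.

Lemma ord_at_const a (c : k) : c != 0 -> ord_at a (const1 c) = 0.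
Proof.
move=> cn0; have pn0 : c%:P != 0 by rewrite polyC_eq0.
apply: etrans (ord_at_tofrac a pn0) _.
have := @poly_ord_linear k a 0 c; rewrite cn0 orbT scale0r add0r => -> //.
by case: a => [t|]; rewrite ?mul0r ?add0r ?(negPf cn0) ?eqxx.
Qed.

Lemma homography_sub (L : fieldType) (c : {rmorphism k -> L}) (M : 'M[k]_2)
    (r : k) y : map_mx c M 1 0 * y + map_mx c M 1 1 != 0 ->
  homography (map_mx c M) y - c r =
  (c (M 0 0 - r * M 1 0) * y + c (M 0 1 - r * M 1 1)) /
  (c (M 1 0) * y + c (M 1 1)).
Proof.
by rewrite homographyE !mxE !rmorphB !rmorphM => h; field.
Qed.

Lemma tofrac_linear (c d : k) :
  FracField.tofrac (c *: 'X + d%:P) = const1 c * y1 k + const1 d :> fun1 k.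
Proof.
apply: etrans (rmorphD (@FracField.tofrac {poly k}) _ _) _; rewrite -mul_polyC.
exact: congr2 (rmorphM (@FracField.tofrac {poly k}) _ _) (erefl _).
Qed.

Lemma substitution_linear (M : 'M[k]_2) u (r : k) : M \in unitmx ->
  is_substitution M u ->
  u (FracField.tofrac ('X - r%:P)) =
  FracField.tofrac ((M 0 0 - r * M 1 0) *: 'X + (M 0 1 - r * M 1 1)%:P) /
  FracField.tofrac (M 1 0 *: 'X + (M 1 1)%:P).
Proof.
move=> uM [uc uy]; rewrite !tofrac_linear.
have den := unitmx_denominator (@y1_transcendental k) uM.
apply: etrans (homography_sub r den).
have -> : FracField.tofrac ('X - r%:P) = y1 k - const1 r :> fun1 k.
  exact: (rmorphB (@FracField.tofrac {poly k})).
apply: etrans (rmorphB u _ _) _.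
have ur : u (const1 r) = const1 r := uc r.
by rewrite uy ur.
Qed.

(** Both sides are additive in h, which leaves constants and y - r; the latter becomes a quotient of
    two linear polynomials. *)
Lemma ord_at_substitution (M : 'M[k]_2) u a (h : fun1 k) : M \in unitmx ->
  is_substitution M u -> h != 0 -> ord_at a (u h) = ord_at (mobius M a) h.
Proof.
move=> uM su; apply: (fun1_mul_ind (Q := fun h =>
  ord_at a (u h) = ord_at (mobius M a) h)) => {h}.
- move=> c cn0; have [uc _] := su.
  by rewrite [u (const1 c)]uc !ord_at_const.
- move=> r; rewrite (substitution_linear r uM su).
  move: uM; rewrite unitmx2.
  set al := M 0 0; set be := M 0 1; set ga := M 1 0; set de := M 1 1 => dt.
  have n1 : (al - r * ga != 0) || (be - r * de != 0).
    apply: contraR dt; rewrite negb_or !negbK !subr_eq0 => /andP[/eqP -> /eqP ->].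
    by apply/eqP; ring.
  have n2 : (ga != 0) || (de != 0).
    apply: contraR dt; rewrite negb_or !negbK => /andP[/eqP -> /eqP ->].
    by apply/eqP; ring.
  have nz (c d : k) : (c != 0) || (d != 0) -> c *: 'X + d%:P != 0.
    by move=> cd; rewrite -(tofrac_eq0 (_ + _)) tofrac_linear;
       apply: (transcendental_denominator (@y1_transcendental k)).
  rewrite ord_at_frac ?nz // !poly_ord_linear //.
  rewrite ord_at_tofrac ?polyXsubC_eq0 //.
  have -> : 'X - r%:P = 1 *: 'X + (- r)%:P by rewrite scale1r polyCN.
  rewrite poly_ord_linear ?oner_eq0 //.
  case: a => [t|] /=; rewrite -/ga -/de.
    (* If t goes to infinity, the denominator has a simple zero at t and, the determinant being
       nonzero, the numerator has none. The order is -1, that of y - r at infinity. *)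
    have [d0|dn0] := eqVneq (ga * t + de) 0.
      have -> : ((al - r * ga) * t + (be - r * de) == 0) = false.
        apply/negbTE; apply: contra dt => /eqP E; apply/eqP.
        have E1 : al * t + be = 0.
          by rewrite -[LHS](subrK (r * (ga * t + de))) {2}d0 mulr0 addr0 -E; ring.
        have [ga0|gan0] := eqVneq ga 0.
          by move: d0; rewrite ga0 mul0r add0r => ->; ring.
        apply: (mulfI gan0); rewrite mulr0.
        have -> : ga * (al * de - be * ga) =
          al * ga * (ga * t + de) - ga ^+ 2 * (al * t + be) by ring.
        by rewrite d0 E1 !mulr0 subrr.
      by [].
    rewrite mul1r subr_eq0 /homography -/al -/be -/ga -/de subr0.
    congr (Posz (nat_of_bool _)); rewrite -[X in _ = (X == _)]subr0.
    have -> : (al - r * ga) * t + (be - r * de) =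
      (ga * t + de) * ((al * t + be) / (ga * t + de) - r) by field.
    by rewrite mulf_eq0 (negPf dn0) subr0 subr_eq0.
  have [ga0|gan0] := eqVneq ga 0.
    have -> : al - r * ga != 0.
      by apply: contra dt => /eqP E; move: E; rewrite ga0 mulr0 subr0 => ->; rewrite mul0r mulr0 subrr.
    by [].
  rewrite mul1r !subr_eq0 -/al.
  have -> : (al == r * ga) = (al / ga == r).
    by apply/eqP/eqP => [->|<-]; field.
  by case: eqP.
- move=> s t sn0 tn0 hs ht; rewrite rmorphM.
  have us := fmorph_neq0 u sn0; have ut := fmorph_neq0 u tn0.
  by rewrite (ord_atM a us ut) (ord_atM _ sn0 tn0) hs ht.
- move=> s sn0 hs; rewrite fmorphV.
  by rewrite (ord_atV a (fmorph_neq0 u sn0)) (ord_atV _ sn0) hs.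
Qed.

(** Deduced from the inverse substitutions on functions, since a point is determined by its orders;
    this avoids a case analysis at infinity. *)
Lemma mobiusK (M : 'M[k]_2) : M \in unitmx ->
  cancel (mobius M) (mobius (invmx M)) /\ cancel (mobius (invmx M)) (mobius M).
Proof.
move=> uM; have uV : invmx M \in unitmx by rewrite unitmx_inv.
have [u su] := substitution_ex uM; have [v sv] := substitution_ex uV.
have [uv vu] := substitution_cancel uM su sv.
split=> a; apply: ord_at_inj => h hn0.
  rewrite -(ord_at_substitution _ uV sv hn0).
  by rewrite -(ord_at_substitution _ uM su (fmorph_neq0 v hn0)) vu.
rewrite -(ord_at_substitution _ uM su hn0).
by rewrite -(ord_at_substitution _ uV sv (fmorph_neq0 u hn0)) uv.
Qed.

End OrderSubstitution.

(** * Odd orders and squares *)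

Section OddOrders.
Variable k : closedFieldType.

Lemma closed_sqrt (c : k) : exists d, c = d ^+ 2.
Proof.
have /closed_rootP[d] : size ('X^2 - c%:P) != 1%N by rewrite size_XnsubC.
rewrite /root hornerD hornerN hornerXn hornerC subr_eq0 => /eqP <-.
by exists d.
Qed.

(** A root has multiplicity at least 2; the square of its linear factor is removed, and the degree
    drops. *)
Lemma poly_square (p : {poly k}) : p != 0 ->
  (forall t, ~~ odd (mup t p)) -> exists q, p = q ^+ 2.
Proof.
have [n] := ubnP (size p); elim: n p => // n IH p sp pn0 ev.
have [s1|/closed_rootP[t rt]] := eqVneq (size p) 1%N.
  have /size_poly1P[c _ ->] : size p == 1%N by rewrite s1.
  by have [d ->] := closed_sqrt c; exists d%:P; rewrite polyC_exp.
have m1 : (1 < mup t p)%N.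
  have : (0 < mup t p)%N by rewrite -XsubC_dvd // dvdp_XsubCl.
  by have := ev t; case: (mup t p) => [|[]].
have : ('X - t%:P) ^+ 2 %| p by rewrite -mup_geq.
rewrite Pdiv.Field.dvdp_eq; set q := p %/ _ => /eqP pE.
have X2 : ('X - t%:P) ^+ 2 != 0 by rewrite expf_neq0 // polyXsubC_eq0.
have qn0 : q != 0 by apply: contra_neq pn0 => q0; rewrite pE q0 mul0r.
have [||s|r rE] := IH q.
- move: sp; rewrite pE size_mul // size_exp_XsubC /=; move: (size q) => m.
  by rewrite addnC /= ltnS; apply: ltnW.
- exact: qn0.
- have := ev s; rewrite pE mupM // oddD mup_XsubCX.
  by case: eqP => _ /=; rewrite addbF.
by exists (r * ('X - t%:P)); rewrite exprMn -rE.
Qed.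

Lemma odd_absz_double (a b : int) : odd (absz (a *+ 2 + b)) = odd (absz b).
Proof. lia. Qed.

Lemma Sodd_sqrM (b f : fun1 k) : b != 0 -> f != 0 -> Sodd (b ^+ 2 * f) = Sodd f.
Proof.
move=> bn0 fn0; apply/seteqP; split=> a; rewrite /Sodd /=.
  by rewrite ord_at_sqrM // odd_absz_double.
by rewrite ord_at_sqrM // odd_absz_double.
Qed.

Lemma Sodd_substitution (M : 'M[k]_2) u (f : fun1 k) : M \in unitmx ->
  is_substitution M u -> f != 0 -> Sodd (u f) = mobius (invmx M) @` Sodd f.
Proof.
move=> uM su fn0; have [K1 K2] := mobiusK uM.
apply/seteqP; split=> a; rewrite /Sodd /=.
  rewrite (ord_at_substitution a uM su fn0) => h.
  by exists (mobius M a); rewrite ?K1.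
move=> [b h <-]; rewrite (ord_at_substitution _ uM su fn0) K2.
exact: h.
Qed.

Lemma same_orbit_Sodd (f g : fun1 k) : f != 0 -> same_orbit f g ->
  exists2 M : 'M[k]_2, M \in unitmx & Sodd g = mobius M @` Sodd f.
Proof.
move=> fn0 /same_orbitP[M [u [b [uM su bn0 ->]]]].
exists (invmx M); first by rewrite unitmx_inv.
exact: etrans (Sodd_sqrM bn0 (fmorph_neq0 u fn0)) (Sodd_substitution uM su fn0).
Qed.

(** Since n / d = n d / d^2, it suffices that the polynomial n d be a square; at finite points its
    multiplicities have the parity of the orders of h. *)
Lemma fun1_square (h : fun1 k) : h != 0 -> Sodd h = set0 ->
  exists s, h = s ^+ 2.
Proof.
move=> hn0 S0; have [n [d [nn0 dn0 hE]]] := frac_neq0 hn0.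
have [|t|q qE] := @poly_square (n * d); first exact: mulf_neq0.
  have : ~ odd (absz (ord_at (Some t) h)).
    by change (~ Sodd h (Some t)); rewrite S0.
  rewrite hE ord_at_frac //= mupM //; lia.
exists (FracField.tofrac q / FracField.tofrac d).
have E (F : fieldType) (x y z : F) : z != 0 -> x * z = y ^+ 2 -> x / z = (y / z) ^+ 2.
  by move=> zn0 e; rewrite expr_div_n -e; field.
rewrite hE; apply: E; first by rewrite tofrac_eq0.
by rewrite -rmorphM qE rmorphXn.
Qed.

Lemma Sodd_same_orbit (f g : fun1 k) : f != 0 -> g != 0 ->
  (exists2 M : 'M[k]_2, M \in unitmx & Sodd g = mobius M @` Sodd f) ->
  same_orbit f g.
Proof.
move=> fn0 gn0 [M uM Sg]; have uV : invmx M \in unitmx by rewrite unitmx_inv.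
have [u su] := substitution_ex uV.
have ufn0 := fmorph_neq0 u fn0.
have Suf : Sodd (u f) = Sodd g.
  by rewrite (Sodd_substitution uV su fn0) invmxK Sg.
have ugn0 : u f * g != 0 := mulf_neq0 ufn0 gn0.
(* The functions [u f] and g have odd order at the same points, so their product has only even
   orders. *)
have [s sE] : exists s, u f * g = s ^+ 2.
  apply: fun1_square => //; apply/seteqP; split=> // a; rewrite /Sodd.
  change (odd (absz (ord_at a (u f * g))) -> False); rewrite (ord_atM a ufn0 gn0).
  have : odd (absz (ord_at a (u f))) = odd (absz (ord_at a g)).
    apply/idP/idP; first by change (Sodd (u f) a -> Sodd g a); rewrite Suf.
    by change (Sodd g a -> Sodd (u f) a); rewrite Suf.
  move: (ord_at a (u f)) (ord_at a g) => x y; lia.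
have sn0 : s != 0.
  by apply: contra_neq ugn0 => s0; rewrite sE s0 expr0n.
apply/same_orbitP; exists (invmx M), u, (s / u f).
split; [exact: uV | exact: su | exact: (mulf_neq0 sn0 (invr_neq0 ufn0)) |].
have E (F : fieldType) (x y z : F) : x != 0 -> x * y = z ^+ 2 -> y = (z / x) ^+ 2 * x.
  by move=> xn0 e; rewrite expr_div_n -e; field.
exact: E ufn0 sE.
Qed.

End OddOrders.

(** * Quartics *)

Section Quartics.
Variable k : numClosedFieldType.

Definition quartic (L : fieldType) (c : k -> L) (a4 a3 a2 a1 a0 : k) (y : L) : L :=
  c a4 * y ^+ 4 + c a3 * y ^+ 3 + c a2 * y ^+ 2 + c a1 * y + c a0.

(* The classical invariants of a binary quartic form, of degrees 2 and 3. *)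
Definition quartic_I (a4 a3 a2 a1 a0 : k) : k :=
  12%:R * a4 * a0 - 3%:R * a3 * a1 + a2 ^+ 2.

Definition quartic_J (a4 a3 a2 a1 a0 : k) : k :=
  72%:R * a4 * a2 * a0 + 9%:R * a3 * a2 * a1 - 27%:R * a4 * a1 ^+ 2
  - 27%:R * a0 * a3 ^+ 2 - 2%:R * a2 ^+ 3.

Section AbstractQuartics.
Variables (L : fieldType) (c : {rmorphism k -> L}) (u : {rmorphism L -> L}) (y : L).
Hypothesis uc : u \o c =1 c.

Lemma rmorph_quartic a4 a3 a2 a1 a0 :
  u (quartic c a4 a3 a2 a1 a0 y) = quartic c a4 a3 a2 a1 a0 (u y).
Proof.
have uc' a : u (c a) = c a by exact: uc.
by rewrite /quartic !rmorphD !rmorphM !uc'.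
Qed.

(** The substitution y |-> r + 1/y exchanges r and infinity: the new coefficients are the Taylor
    coefficients at r in reversed order. A simple root r thus leaves a true cubic. *)
Lemma quartic_invert a4 a3 a2 a1 a0 r : y != 0 ->
  u y = homography (map_mx c (mx2 r 1 1 0)) y ->
  quartic c (a4 * r ^+ 4 + a3 * r ^+ 3 + a2 * r ^+ 2 + a1 * r + a0)
    (4%:R * a4 * r ^+ 3 + 3%:R * a3 * r ^+ 2 + 2%:R * a2 * r + a1)
    (6%:R * a4 * r ^+ 2 + 3%:R * a3 * r + a2) (4%:R * a4 * r + a3) a4 y =
  (y ^+ 2) ^+ 2 * u (quartic c a4 a3 a2 a1 a0 y).
Proof.
move=> yn0 uy; rewrite rmorph_quartic uy homography_map_mx2 rmorph1 rmorph0.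
rewrite /quartic !rmorphD !rmorphM !rmorph_nat.
by field.
Qed.

(** The shift that removes the quadratic term. *)
Lemma cubic_shift a3 a2 a1 a0 h : 3%:R * a3 * h + a2 = 0 ->
  u y = homography (map_mx c (mx2 1 h 0 1)) y ->
  quartic c 0 a3 0 (3%:R * a3 * h ^+ 2 + 2%:R * a2 * h + a1)
    (a3 * h ^+ 3 + a2 * h ^+ 2 + a1 * h + a0) y =
  1 ^+ 2 * u (quartic c 0 a3 a2 a1 a0 y).
Proof.
move=> E uy; rewrite rmorph_quartic uy homography_map_mx2 rmorph1 rmorph0.
rewrite mul0r add0r divr1 mul1r.
have -> : a2 = - (3%:R * a3 * h) by apply: (eq_of_diff 1 E); ring.
rewrite /quartic !rmorphD !rmorphM !rmorphN !rmorphM !rmorph_nat.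
by rewrite !rmorph0; ring.
Qed.

Lemma cubic_normalize a3 p q d : d ^+ 2 = a3^-1 -> a3 != 0 ->
  quartic c 0 1 0 p q y =
  c d ^+ 2 * quartic c 0 a3 0 (a3 * p) (a3 * q) y.
Proof.
move=> dd an0; have -> : c d ^+ 2 = (c a3)^-1 by rewrite -rmorphXn dd fmorphV.
have can0 : c a3 != 0 by rewrite fmorph_eq0.
by rewrite /quartic !rmorphM rmorph1 !rmorph0; field.
Qed.

(** Scaling y by al gives p and q the weights 2 and 3, with a common factor al^3 that is a square
    over an algebraically closed field. *)
Lemma cubic_rescale p q al d : d ^+ 2 = (al ^+ 3)^-1 -> al != 0 ->
  u y = homography (map_mx c (mx2 al 0 0 1)) y ->
  quartic c 0 1 0 p q y =
  c d ^+ 2 * u (quartic c 0 1 0 (al ^+ 2 * p) (al ^+ 3 * q) y).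
Proof.
move=> dd an0 uy; rewrite rmorph_quartic uy homography_scaling.
have -> : c d ^+ 2 = (c al ^+ 3)^-1 by rewrite -rmorphXn dd fmorphV rmorphXn.
have can0 : c al != 0 by rewrite fmorph_eq0.
by rewrite /quartic !rmorphM rmorph1 !rmorph0; field.
Qed.

End AbstractQuartics.

Local Notation c := (@const1 k).
Local Notation y := (y1 k).
Local Notation quart a4 a3 a2 a1 a0 := (quartic c a4 a3 a2 a1 a0 y).

Lemma y1_neq0 : y != 0.
Proof.
by apply: contra_not_neq (@y1_transcendental k) => ->; apply: algebraic0.
Qed.

Lemma same_orbit_ex (f g : fun1 k) (M : 'M[k]_2) (b : fun1 k) :
  M \in unitmx -> b != 0 ->
  (forall u, is_substitution M u -> g = b ^+ 2 * u f) -> same_orbit f g.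
Proof.
move=> uM bn0 E; have [u su] := substitution_ex uM; apply/same_orbitP.
by exists M, u, b; split; [exact: uM | exact: su | exact: bn0 | exact: E].
Qed.

(** The scalar [s] is the leading coefficient of the cubic. It is recorded so that I and J give back
    p and q without a choice of roots. *)
Lemma cubic_depress a3 a2 a1 a0 : a3 != 0 -> exists s p q : k,
  [/\ s != 0, same_orbit (quart 0 a3 a2 a1 a0) (quart 0 1 0 p q),
      quartic_I 0 a3 a2 a1 a0 = - 3%:R * s ^+ 2 * p
    & quartic_J 0 a3 a2 a1 a0 = - 27%:R * s ^+ 3 * q].
Proof.
move=> an0; have three : 3%:R != 0 :> k by rewrite pnatr_eq0.
pose h := - a2 / (3%:R * a3).
have hE : 3%:R * a3 * h + a2 = 0 by rewrite /h; field; rewrite ?an0 ?three.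
pose p' := 3%:R * a3 * h ^+ 2 + 2%:R * a2 * h + a1.
pose q' := a3 * h ^+ 3 + a2 * h ^+ 2 + a1 * h + a0.
exists a3, (p' / a3), (q' / a3); split; first exact: an0.
- have o1 : same_orbit (quart 0 a3 a2 a1 a0) (quart 0 a3 0 p' q').
    have uM : mx2 1 h 0 1 \in unitmx.
      by rewrite unitmx2 !mxE /= mulr1 mulr0 subr0 oner_neq0.
    apply: (same_orbit_ex uM (oner_neq0 _)) => u [uc uy].
    exact: (cubic_shift uc a1 a0 hE uy).
  have [d dd] := closed_sqrt a3^-1.
  have cd : c d != 0.
    apply: fmorph_neq0; apply: contra_neq an0 => d0.
    by move: dd; rewrite d0 expr0n => /eqP; rewrite invr_eq0 => /eqP.
  apply: (same_orbit_trans o1).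
  have := cubic_normalize c y (p' / a3) (q' / a3) (esym dd) an0.
  have e t : a3 * (t / a3) = t by rewrite mulrC divfK.
  by rewrite (e p') (e q') => ->; apply: same_orbit_square.
- by rewrite /quartic_I /p' /h; field; rewrite ?an0 ?three.
- by rewrite /quartic_J /q' /h; field; rewrite ?an0 ?three.
Qed.

Lemma quartic_depress a4 a3 a2 a1 a0 :
  (a4 = 0 /\ a3 != 0) \/
  (exists r, a4 * r ^+ 4 + a3 * r ^+ 3 + a2 * r ^+ 2 + a1 * r + a0 = 0 /\
     4%:R * a4 * r ^+ 3 + 3%:R * a3 * r ^+ 2 + 2%:R * a2 * r + a1 != 0) ->
  exists s p q : k,
  [/\ s != 0, same_orbit (quart a4 a3 a2 a1 a0) (quart 0 1 0 p q),
      quartic_I a4 a3 a2 a1 a0 = - 3%:R * s ^+ 2 * p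
    & quartic_J a4 a3 a2 a1 a0 = - 27%:R * s ^+ 3 * q].
Proof.
move=> [[-> an0]|[r [r0 r1]]]; first exact: cubic_depress.
set b2 := 6%:R * a4 * r ^+ 2 + 3%:R * a3 * r + a2.
set b1 := 4%:R * a4 * r + a3.
have [s [p [q [sn0 o IE JE]]]] := cubic_depress b2 b1 a4 r1.
exists s, p, q; split; first exact: sn0.
- apply: same_orbit_trans o.
  have uM : mx2 r 1 1 0 \in unitmx.
    by rewrite unitmx2 !mxE /= mulr0 mulr1 sub0r oppr_eq0 oner_neq0.
  apply: (same_orbit_ex uM (expf_neq0 2 y1_neq0)) => u [uc uy].
  by rewrite -(quartic_invert uc a4 a3 a2 a1 a0 y1_neq0 uy) r0.
(* I and J have weights 4 and 6, and r + 1/y has determinant -1, so both are unchanged. *)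
- by rewrite -IE -r0 /quartic_I /b2 /b1; ring.
- by rewrite -JE -r0 /quartic_J /b2 /b1; ring.
Qed.

(** The scalars give the scaling factor al = s' / s at once, with no case distinction on the
    vanishing of p or q. *)
Lemma depressed_same_orbit (s p q s' p' q' : k) : s != 0 -> s' != 0 ->
  s ^+ 2 * p = s' ^+ 2 * p' -> s ^+ 3 * q = s' ^+ 3 * q' ->
  same_orbit (quart 0 1 0 p q) (quart 0 1 0 p' q').
Proof.
move=> sn0 s'n0 E1 E2; pose al := s' / s.
have an0 : al != 0 by rewrite mulf_neq0 ?invr_eq0.
have [d dd] := closed_sqrt (al ^+ 3)^-1.
have cd : c d != 0.
  apply: fmorph_neq0; apply: contra_neq an0 => d0.
  by move: dd; rewrite d0 expr0n => /eqP; rewrite invr_eq0 expf_eq0 => /eqP.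
have -> : p = al ^+ 2 * p'.
  apply: (mulfI (expf_neq0 2 sn0)); rewrite E1 /al; field.
  by rewrite sn0.
have -> : q = al ^+ 3 * q'.
  apply: (mulfI (expf_neq0 3 sn0)); rewrite E2 /al; field.
  by rewrite sn0.
apply: (same_orbit_ex (unitmx_scaling an0) cd) => u [uc uy].
exact: (cubic_rescale uc p' q' (esym dd) an0 uy).
Qed.

End Quartics.

Section QuarticOrbits.
Variable k : numClosedFieldType.
Local Notation c := (@const1 k).
Local Notation y := (y1 k).
Local Notation quart a4 a3 a2 a1 a0 := (quartic c a4 a3 a2 a1 a0 y).

Lemma mup1_simple (D : {poly k}) r : D != 0 -> mup r D = 1%N ->
  D.[r] = 0 /\ D^`().[r] != 0.
Proof.
move=> Dn0 m1; have : 'X - r%:P %| D by rewrite XsubC_dvd // m1.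
rewrite Pdiv.Field.dvdp_eq; set E := D %/ _ => /eqP DE.
have Er : E.[r] != 0.
  apply: contra_eq_neq m1 => /eqP Er.
  have : ('X - r%:P) ^+ 2 %| D.
    by rewrite DE expr2 dvdp_mul // dvdp_XsubCl.
  by rewrite -mup_geq //; case: mup => [|[]].
split; first by rewrite DE !hornerE subrr mulr0.
by rewrite DE derivM derivXsubC !hornerE subrr mulr0 add0r.
Qed.

(** Some root has odd multiplicity, and the degree leaves only 1 or 3. Degree 3 is set aside because
    its simple root may be the one at infinity. *)
Lemma nonsquare_simple_root (D : {poly k}) : (size D <= 5)%N -> size D != 4%N ->
  (forall q, D != q ^+ 2) -> exists r, D.[r] = 0 /\ D^`().[r] != 0.
Proof.
move=> s5 s4 ns.
have Dn0 : D != 0 by have := ns 0; rewrite expr0n.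
have [t ot] : exists t, odd (mup t D).
  apply: contrapT => no; have [|q DE] := poly_square Dn0.
    by move=> t; apply/negP => ot; apply: no; exists t.
  by have := ns q; rewrite DE eqxx.
have : ('X - t%:P) ^+ mup t D %| D by rewrite -mup_geq.
rewrite Pdiv.Field.dvdp_eq; set E := D %/ _ => /eqP DE.
have En0 : E != 0 by apply: contra_neq Dn0 => E0; rewrite DE E0 mul0r.
have sE : size D = (size E + mup t D)%N.
  by rewrite {1}DE size_mul ?expf_neq0 ?polyXsubC_eq0 // size_exp_XsubC addnS.
have E0 : (0 < size E)%N by rewrite size_poly_gt0.
have [m1|m1] := eqVneq (mup t D) 1%N; first by exists t; apply: mup1_simple.
(* With a triple root, D has degree 4; the cofactor E is linear, and its root differs from t, hence
   is simple. *)
have m3 : mup t D = 3%N.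
  move: ot m1 sE s5 E0; case: (mup t D) => [|[|[|[|[|m]]]]] //.
  by move=> _ _ -> ; lia.
have sE2 : size E = 2%N by move: s5 s4 sE E0; rewrite m3; case: (size D) => [|[|[|[|[|[|n]]]]]] //; lia.
have /closed_rootP[s /rootP Es] : size E != 1%N by rewrite sE2.
exists s; apply: mup1_simple => //.
have Et : E.[t] != 0.
  apply/negP => Et; have : ('X - t%:P) ^+ 4 %| D.
    by rewrite DE m3 exprS dvdp_mul // dvdp_XsubCl.
  by rewrite -mup_geq // m3.
have st : t != s by apply: contra_neq Et => ->.
rewrite DE m3 mulrC mupMr; last first.
  by rewrite rootE !hornerE expf_eq0 /= subr_eq0 eq_sym.
have : 'X - s%:P %| E by rewrite dvdp_XsubCl; apply/rootP.
rewrite Pdiv.Field.dvdp_eq; set G := E %/ _ => /eqP EE.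
have Gn0 : G != 0 by apply: contra_neq En0 => G0; rewrite EE G0 mul0r.
have : size G = 1%N.
  by move: sE2; rewrite EE size_mul ?polyXsubC_eq0 // size_XsubC addn2 => -[].
move=> /eqP/size_poly1P[e en0 GE].
by rewrite EE GE mupMr ?rootC // -['X - _]expr1 mup_XsubCX eqxx.
Qed.

Definition quartic_poly (a4 a3 a2 a1 a0 : k) : {poly k} :=
  a4 *: 'X^4 + a3 *: 'X^3 + a2 *: 'X^2 + a1 *: 'X + a0%:P.

Lemma tofrac_quartic a4 a3 a2 a1 a0 :
  FracField.tofrac (quartic_poly a4 a3 a2 a1 a0) = quart a4 a3 a2 a1 a0.
Proof.
rewrite (@tofrac_horner k); move: (y1 k) => z.
rewrite /quartic /quartic_poly !rmorphD /= !map_polyZ /= !map_polyXn map_polyX map_polyC.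
by rewrite !(hornerD, hornerZ, hornerXn, hornerX, hornerC).
Qed.

Lemma quartic_same_orbit a4 a3 a2 a1 a0 b4 b3 b2 b1 b0 :
  nonsquare (quart a4 a3 a2 a1 a0) -> nonsquare (quart b4 b3 b2 b1 b0) ->
  quartic_I a4 a3 a2 a1 a0 = quartic_I b4 b3 b2 b1 b0 ->
  quartic_J a4 a3 a2 a1 a0 = quartic_J b4 b3 b2 b1 b0 ->
  same_orbit (quart a4 a3 a2 a1 a0) (quart b4 b3 b2 b1 b0).
Proof.
have dep d4 d3 d2 d1 d0 : nonsquare (quart d4 d3 d2 d1 d0) ->
    exists s p q : k, [/\ s != 0,
      same_orbit (quart d4 d3 d2 d1 d0) (quart 0 1 0 p q),
      quartic_I d4 d3 d2 d1 d0 = - 3%:R * s ^+ 2 * p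
    & quartic_J d4 d3 d2 d1 d0 = - 27%:R * s ^+ 3 * q].
  move=> ns; apply: quartic_depress.
  set D := quartic_poly d4 d3 d2 d1 d0.
  have coefE i : D`_i = nth 0 [:: d0; d1; d2; d3; d4] i.
    rewrite /D /quartic_poly !coefD !coefZ !coefXn coefX coefC.
    by case: i => [|[|[|[|[|i]]]]] /=; rewrite ?mulr0 ?mulr1 ?addr0 ?add0r ?nth_nil.
  have s5 : (size D <= 5)%N.
    by apply/leq_sizeP => i hi; rewrite coefE nth_default.
  (* In degree 3 the quartic form has a simple root at infinity. *)
  have [s4|s4] := eqVneq (size D) 4%N.
    left; split; first by have := coefE 4%N; rewrite nth_default // s4.
    have : lead_coef D != 0 by rewrite lead_coef_eq0 -size_poly_gt0 s4.
    by rewrite lead_coefE s4 coefE.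
  right; have [|r [r0 r1]] := nonsquare_simple_root s5 s4.
    move=> q; apply/negP => /eqP DE.
    have := ns (FracField.tofrac q).
    rewrite -tofrac_quartic -/D DE; move/eqP; apply.
    exact: (rmorphXn (@FracField.tofrac {poly k})).
  exists r; split.
    rewrite -r0 /D /quartic_poly.
    by rewrite !(hornerD, hornerZ, hornerXn, hornerX, hornerC).
  move: r1; rewrite /D /quartic_poly !derivD !derivZ !derivXn derivX derivC.
  rewrite !(hornerD, hornerZ, hornerXn, hornerX, hornerC, hornerMn) /=.
  by apply: contra_neq => E; rewrite -[RHS]E; ring.
move=> /dep[s [p [q [sn0 o1 I1 J1]]]] /dep[s' [p' [q' [s'n0 o2 I2 J2]]]] II JJ.
apply: same_orbit_trans o1 (same_orbit_trans _ (same_orbit_sym o2)).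
apply: (depressed_same_orbit sn0 s'n0).
  have n3 : - 3%:R != 0 :> k by rewrite oppr_eq0 pnatr_eq0.
  apply: (mulfI n3); rewrite [LHS]mulrA [RHS]mulrA.
  exact: etrans (esym I1) (etrans II I2).
have n27 : - 27%:R != 0 :> k by rewrite oppr_eq0 pnatr_eq0.
apply: (mulfI n27); rewrite [LHS]mulrA [RHS]mulrA.
exact: etrans (esym J1) (etrans JJ J2).
Qed.

End QuarticOrbits.

(** * Biquadratic relations *)

Section Gauss.
Variable k : closedFieldType.
Implicit Types (P Q S : {poly {poly k}}) (d : {poly k}).

(** Over an algebraically closed field a nonconstant content has a root, so it is detected by
    specializing the inner variable. *)
Definition poly2_primitive P := forall t : k, map_poly (horner_eval t) P != 0.

Lemma map_horner_eval_eq0 P t : map_poly (horner_eval t) P = 0 ->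
  exists S, P = ('X - t%:P)%:P * S.
Proof.
move=> P0; exists (map_poly (fun p : {poly k} => p %/ ('X - t%:P)) P).
apply/polyP => i; rewrite coefCM coef_map_id0 ?div0p // mulrC divpK //.
rewrite dvdp_XsubCl; apply/rootP.
by have := congr1 (fun q : {poly k} => q`_i) P0; rewrite coef_map coef0.
Qed.

Lemma primitive_part P : P != 0 ->
  exists d S, [/\ d != 0, poly2_primitive S & P = d%:P * S].
Proof.
have [n] := ubnP (size (lead_coef P)); elim: n P => // n IH P sP Pn0.
have [prim|/existsNP[t /negP]] := pselect (poly2_primitive P).
  by exists 1, P; rewrite oner_eq0 mul1r.
rewrite negbK => /eqP /map_horner_eval_eq0[S PE].
have Sn0 : S != 0 by apply: contra_neq Pn0 => S0; rewrite PE S0 mulr0.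
have [|d [S' [dn0 prim SE]]] := IH S _ Sn0.
  move: sP; rewrite PE lead_coefM lead_coefC size_mul ?polyXsubC_eq0 ?lead_coef_eq0 //.
  by rewrite size_XsubC.
exists (('X - t%:P) * d), S'; split=> //; first by rewrite mulf_neq0 ?polyXsubC_eq0.
by rewrite PE SE polyCM mulrA.
Qed.

(** Linear factors of d are removed one by one: at a root t of d the product P S vanishes and P does
    not, so S is divisible by the factor. *)
Lemma gauss_divide P Q S d : poly2_primitive P -> d != 0 ->
  d%:P * Q = P * S -> exists S', Q = P * S'.
Proof.
move=> prim; have [n] := ubnP (size d); elim: n d S => // n IH d S sd dn0 E.
have [s1|/closed_rootP[t]] := eqVneq (size d) 1%N.
  have /size_poly1P[a an0 dE] : size d == 1%N by rewrite s1.
  exists ((a^-1)%:P%:P * S).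
  have an0' : a%:P%:P != 0 :> {poly {poly k}} by rewrite !polyC_eq0.
  apply: (mulfI an0'); rewrite -{1}dE E [RHS]mulrCA; congr (_ * _).
  by rewrite mulrA -!polyCM divff // mul1r.
rewrite -dvdp_XsubCl Pdiv.Field.dvdp_eq; set d' := d %/ _ => /eqP dE.
have d'n0 : d' != 0 by apply: contra_neq dn0 => d0; rewrite dE d0 mul0r.
have : map_poly (horner_eval t) (d%:P * Q) = 0.
  by rewrite rmorphM /= map_polyC /= /horner_eval dE !hornerE subrr mulr0 mul0r.
rewrite E rmorphM => /eqP; rewrite mulf_eq0 (negPf (prim t)) /=.
move=> /eqP/map_horner_eval_eq0[S' SE].
apply: (IH d' S') => //.
  by move: sd; rewrite dE size_mul ?polyXsubC_eq0 // size_XsubC addn2.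
have X0 : ('X - t%:P)%:P != 0 :> {poly {poly k}} by rewrite polyC_eq0 polyXsubC_eq0.
apply: (mulfI X0); rewrite [RHS]mulrCA -SE -E dE polyCM.
by rewrite mulrA [_ * d'%:P]mulrC.
Qed.

Variables (L : fieldType) (c : {rmorphism k -> L}).

(** The outer variable goes to [eta], the inner one to [z]. *)
Definition eval2 (z eta : L) P : L := (map_poly (map_poly c) P).[eta%:P].[z].

Lemma eval2_swap z eta P : eval2 z eta (swapXY P) = eval2 eta z P.
Proof. by rewrite /eval2 -swapXY_map horner2_swapXY. Qed.

Lemma eval2M z eta P Q : eval2 z eta (P * Q) = eval2 z eta P * eval2 z eta Q.
Proof. by rewrite /eval2 rmorphM !hornerM. Qed.

Lemma eval2C z eta d : eval2 z eta d%:P = (map_poly c d).[z].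
Proof. by rewrite /eval2 map_polyC hornerC. Qed.

Variable m : {rmorphism fun1 k -> L}.
Hypothesis mc : m \o @const1 k =1 c.
Local Notation z := (m (y1 k)).
Local Notation tf := (map_poly (@FracField.tofrac {poly k})).

Lemma eval2_fun1 eta P : eval2 z eta P = (map_poly m (tf P)).[eta].
Proof.
rewrite /eval2.
have -> : (map_poly (map_poly c) P).[eta%:P].[z] =
    (map_poly (horner_eval z) (map_poly (map_poly c) P)).[eta].
  by rewrite -[in RHS](hornerC eta z) horner_map.
rewrite -!map_poly_comp; congr (_ .[_]); apply: eq_map_poly => p.
by symmetry; apply: morph_tofracE.
Qed.

Lemma map_tofrac_eq0 P : (tf P == 0) = (P == 0).
Proof.
have [->|Pn0] := eqVneq P 0; first by rewrite rmorph0 eqxx.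
by rewrite map_poly_eq0_id0 ?(negPf Pn0) // tofrac_eq0 lead_coef_eq0.
Qed.

Lemma size_map_tofrac P : size (tf P) = size P.
Proof.
have [->|Pn0] := eqVneq P 0; first by rewrite rmorph0 !size_poly0.
by rewrite size_map_poly_id0 // tofrac_eq0 lead_coef_eq0.
Qed.

Lemma tofrac_map_inj P Q : tf P = tf Q -> P = Q.
Proof.
by move=> E; apply/eqP; rewrite -subr_eq0 -map_tofrac_eq0 rmorphB /= E subrr.
Qed.

(* P being primitive and minimal over k(z), it divides Q by Gauss' lemma. *)
Lemma minimal_divides eta P Q : P != 0 -> poly2_primitive P ->
  eval2 z eta P = 0 ->
  (forall r : {poly fun1 k}, (size r < size P)%N -> (map_poly m r).[eta] = 0 -> r = 0) ->
  eval2 z eta Q = 0 -> exists S, Q = P * S.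
Proof.
move=> Pn0 prim P0 irr Q0.
have tPn0 : tf P != 0 by rewrite map_tofrac_eq0.
have E := divp_eq (tf Q) (tf P); have r0 : tf Q %% tf P = 0.
  apply: irr; first by rewrite -size_map_tofrac ltn_modp.
  move: Q0; rewrite eval2_fun1 {1}E rmorphD rmorphM hornerD hornerM /=.
  by rewrite -eval2_fun1 P0 mulr0 add0r.
have [d [S [dn0 SE]]] := clear_denominators (tf Q %/ tf P).
apply: (gauss_divide (S := S) prim dn0); apply: tofrac_map_inj.
rewrite !rmorphM /= -SE map_polyC /= {1}E r0 addr0 mul_polyC.
by rewrite scalerAl mulrC.
Qed.

(** P divides Q in k[y][X], which also bounds its degree in the inner variable. *)
Lemma minimal_sizeY eta P Q : P != 0 -> poly2_primitive P ->
  eval2 z eta P = 0 ->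
  (forall r : {poly fun1 k}, (size r < size P)%N -> (map_poly m r).[eta] = 0 -> r = 0) ->
  eval2 z eta Q = 0 -> Q != 0 -> (sizeY P <= sizeY Q)%N.
Proof.
move=> Pn0 prim P0 irr Q0 Qn0.
have [S QE] := minimal_divides Pn0 prim P0 irr Q0.
have Sn0 : S != 0 by apply: contra_neq Qn0 => S0; rewrite QE S0 mulr0.
rewrite QE !sizeYE rmorphM size_mul ?swapXY_eq0 //.
have : (0 < size (swapXY S))%N by rewrite size_poly_gt0 swapXY_eq0.
by case: (size (swapXY S)) => // n _; rewrite addnS leq_addr.
Qed.

End Gauss.

(** * Discriminants of relations between two generators *)

Section QuadraticDiscriminant.
Variables (K L : fieldType) (m : {rmorphism K -> L}) (w : L) (f : K).
Hypothesis ww : w ^+ 2 = m f.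
Hypothesis nf : forall h, f != h ^+ 2.
Hypothesis sp : spanned m w.

(** Write xi = a + b w: as xi^2 lies in K, 2ab = 0, and b is nonzero. *)
Lemma square_outside xi (D : K) : 2%:R != 0 :> K -> (forall a, xi <> m a) ->
  xi ^+ 2 = m D -> exists b, b != 0 /\ D = b ^+ 2 * f.
Proof.
move=> two out xx; have [a [b xiE]] := sp xi.
have bn0 : b != 0.
  by apply/eqP => b0; apply: (out a); rewrite xiE b0 rmorph0 mul0r addr0.
have E : m (a ^+ 2 + b ^+ 2 * f) + m (2%:R * a * b) * w = m D + m 0 * w.
  rewrite rmorph0 mul0r addr0 -xx xiE !rmorphD !rmorphM rmorph_nat -ww.
  by ring.
have [DE /eqP ab] := quadratic_uniq ww nf E.
move: ab; rewrite !mulf_eq0 (negPf two) (negPf bn0) /= orbF => /eqP a0.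
by exists b; split=> //; rewrite -DE a0 expr0n add0r.
Qed.

(** The characteristic polynomial of xi = a + b w, of degree exactly 2 even for xi in K. *)
Lemma quadratic_relation xi :
  exists p : {poly K}, size p = 3%N /\ (map_poly m p).[xi] = 0.
Proof.
have [a [b ->]] := sp xi; exists (('X - a%:P) ^+ 2 - (b ^+ 2 * f)%:P); split.
  rewrite size_polyDl size_exp_XsubC // size_polyN.
  exact: leq_ltn_trans (size_polyC_leq1 _) _.
rewrite rmorphB rmorphXn rmorphB /= map_polyX !map_polyC /=.
rewrite !(hornerD, hornerN, hornerX, hornerC, horner_exp).
by rewrite rmorphM rmorphXn -ww; ring.
Qed.

End QuadraticDiscriminant.

Lemma morph_quartic (k : numClosedFieldType) (E L : fieldType) (d : k -> E)
    (c : k -> L) (m : {rmorphism E -> L}) a4 a3 a2 a1 a0 y :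
  (forall a, m (d a) = c a) ->
  m (quartic d a4 a3 a2 a1 a0 y) = quartic c a4 a3 a2 a1 a0 (m y).
Proof. by move=> md; rewrite /quartic !rmorphD !rmorphM !md. Qed.

Section BiquadraticRelation.
Variables (k : numClosedFieldType) (L : fieldType) (c : {rmorphism k -> L}).

Definition poly2eval (a : nat -> nat -> k) (z : L) i : L :=
  c (a i 2%N) * z ^+ 2 + c (a i 1%N) * z + c (a i 0%N).

(* The coefficients of the discriminant a_1^2 - 4 a_2 a_0, a quartic in z, of
   the quadratic polynomial a_2(z) X^2 + a_1(z) X + a_0(z). *)
Definition disc4 (a : nat -> nat -> k) : k := a 1%N 2%N ^+ 2 - 4%:R * a 2%N 2%N * a 0%N 2%N.
Definition disc3 (a : nat -> nat -> k) : k := 2%:R * a 1%N 2%N * a 1%N 1%N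
  - 4%:R * (a 2%N 2%N * a 0%N 1%N + a 2%N 1%N * a 0%N 2%N).
Definition disc2 (a : nat -> nat -> k) : k := a 1%N 1%N ^+ 2 + 2%:R * a 1%N 2%N * a 1%N 0%N
  - 4%:R * (a 2%N 2%N * a 0%N 0%N + a 2%N 1%N * a 0%N 1%N + a 2%N 0%N * a 0%N 2%N).
Definition disc1 (a : nat -> nat -> k) : k := 2%:R * a 1%N 1%N * a 1%N 0%N
  - 4%:R * (a 2%N 1%N * a 0%N 0%N + a 2%N 0%N * a 0%N 1%N).
Definition disc0 (a : nat -> nat -> k) : k := a 1%N 0%N ^+ 2 - 4%:R * a 2%N 0%N * a 0%N 0%N.

Definition disc (L : fieldType) (d : k -> L) (a : nat -> nat -> k) (z : L) : L :=
  quartic d (disc4 a) (disc3 a) (disc2 a) (disc1 a) (disc0 a) z.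

Lemma discE a z : disc c a z =
  poly2eval a z 1%N ^+ 2 - 4%:R * poly2eval a z 2%N * poly2eval a z 0%N.
Proof.
rewrite /disc /quartic /poly2eval /disc4 /disc3 /disc2 /disc1 /disc0.
rewrite !(rmorphB, rmorphD, rmorphM, rmorphXn, rmorph_nat) /=.
by ring.
Qed.

(** The classical fact that the two discriminants of a (2, 2) form have the same invariants, checked
    by expansion. *)
Lemma disc_swap_IJ a : let b i j := a j i in
  quartic_I (disc4 a) (disc3 a) (disc2 a) (disc1 a) (disc0 a) =
  quartic_I (disc4 b) (disc3 b) (disc2 b) (disc1 b) (disc0 b) /\
  quartic_J (disc4 a) (disc3 a) (disc2 a) (disc1 a) (disc0 a) =
  quartic_J (disc4 b) (disc3 b) (disc2 b) (disc1 b) (disc0 b).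
Proof.
rewrite /quartic_I /quartic_J /disc4 /disc3 /disc2 /disc1 /disc0 /=.
by split; ring.
Qed.

(** The discriminant over k(z) of an equation for eta becomes a square in L, of an element outside
    k(z); up to a square in k(z) it must be f. *)
Lemma biquadratic_orbit (m : {rmorphism fun1 k -> L}) f w a eta :
  m \o @const1 k =1 c -> transcendental c (m (y1 k)) ->
  w ^+ 2 = m f -> nonsquare f -> spanned m w -> (forall h, eta <> m h) ->
  poly2eval a (m (y1 k)) 2%N * eta ^+ 2 + poly2eval a (m (y1 k)) 1%N * eta
    + poly2eval a (m (y1 k)) 0%N = 0 ->
  (exists i j, [/\ (i < 3)%N, (j < 3)%N & a i j != 0]) ->
  exists b, b != 0 /\ disc (@const1 k) a (y1 k) = b ^+ 2 * f.
Proof.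
set z := m (y1 k) => mc tr ww nf sp out E nz.
pose pi i : fun1 k := const1 (a i 2%N) * y1 k ^+ 2 + const1 (a i 1%N) * y1 k + const1 (a i 0%N).
have mc' b : m (const1 b) = c b by exact: mc.
have mpi i : m (pi i) = poly2eval a z i.
  by rewrite /pi /poly2eval !rmorphD !rmorphM !mc'.
(* Otherwise the relation puts eta in k(z), or all the coefficients vanish. *)
have p2n0 : poly2eval a z 2%N != 0.
  apply/eqP => p20; move: E; rewrite p20 mul0r add0r => E.
  have p10 : poly2eval a z 1%N = 0.
    apply/eqP/negPn/negP => p1n0; apply: (out (- pi 0%N / pi 1%N)).
    rewrite fmorph_div rmorphN !mpi; apply: (mulfI p1n0).
    by rewrite [RHS]mulrC divfK //; apply: (eq_of_diff 1 E); ring.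
  move: E; rewrite p10 mul0r add0r => p00.
  have zero i : poly2eval a z i = 0 -> [/\ a i 2%N = 0, a i 1%N = 0 & a i 0%N = 0].
    exact: (transcendental_quadratic tr).
  have [i [j [i3 j3 /eqP]]] := nz; apply.
  have {}zero : [/\ a i 2%N = 0, a i 1%N = 0 & a i 0%N = 0].
    by apply: zero; case: i i3 => [|[|[|i]]].
  by case: zero => ? ? ?; case: j j3 => [|[|[|j]]].
(* Completing the square: xi^2 is the discriminant. *)
pose xi := 2%:R * poly2eval a z 2%N * eta + poly2eval a z 1%N.
have twoL : 2%:R != 0 :> L by rewrite -(rmorph_nat c) fmorph_eq0 pnatr_eq0.
apply: (square_outside (xi := xi) ww nf sp).
- by rewrite -(rmorph_nat (@const1 k)) fmorph_neq0 // pnatr_eq0.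
- move=> h xiE; apply: (out ((h - pi 1%N) / (2%:R * pi 2%N))).
  have e2 : 2%:R * poly2eval a z 2%N != 0 by rewrite mulf_neq0.
  rewrite fmorph_div rmorphB rmorphM rmorph_nat !mpi -xiE; apply: (mulfI e2).
  by rewrite [RHS]mulrC divfK // /xi addrK.
- have -> : m (disc (@const1 k) a (y1 k)) = disc c a z.
    exact: (morph_quartic _ _ _ _ _ _ mc').
  rewrite discE; apply: (eq_of_diff (4%:R * poly2eval a z 2%N) E); rewrite /xi; ring.
Qed.

End BiquadraticRelation.

Lemma eq_transcendental (k L : fieldType) (c d : k -> L) x : c =1 d ->
  transcendental c x -> transcendental d x.
Proof.
move=> cd tr [p pn0 p0]; apply: tr; exists p => //.
by rewrite (eq_map_poly cd).
Qed.

Lemma linear_independent (K L : fieldType) (m1 : {rmorphism K -> L}) eta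
    (r : {poly K}) : (forall h, eta <> m1 h) ->
  (size r < 3)%N -> (map_poly m1 r).[eta] = 0 -> r = 0.
Proof.
move=> out sr r0.
have rE : r = (r`_0)%:P + (r`_1)%:P * 'X.
  apply/polyP => i; rewrite coefD coefC mul_polyC coefZ coefX.
  case: i => [|[|i]] /=; rewrite ?mulr0 ?mulr1 ?addr0 ?add0r //.
  by rewrite nth_default //; apply: leq_trans (sr : (size r <= 2)%N) _.
move: r0; rewrite rE rmorphD rmorphM /= map_polyX !map_polyC /= hornerD hornerM.
rewrite !hornerC hornerX => E.
have r1 : r`_1 = 0.
  apply/eqP/negPn/negP => r1; apply: (out (- r`_0 / r`_1)).
  have mr1 : m1 r`_1 != 0 by rewrite fmorph_eq0.
  rewrite fmorph_div rmorphN; apply: (mulfI mr1); rewrite [RHS]mulrC divfK //.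
  by apply: (eq_of_diff 1 E); ring.
move: E; rewrite r1 rmorph0 mul0r addr0 => /eqP; rewrite fmorph_eq0 => /eqP ->.
by rewrite polyC0 mul0r addr0.
Qed.

Section TwoQuadraticGenerators.
Variables (k : numClosedFieldType) (L : fieldType) (c : {rmorphism k -> L}).

Lemma generator_transcendental (m : {rmorphism fun1 k -> L}) :
  m \o @const1 k =1 c -> transcendental c (m (y1 k)).
Proof.
move=> mc; apply: (eq_transcendental mc).
exact: (@transcendental_morph _ _ _ (@const1 k) m (y1 k) (@y1_transcendental k)).
Qed.

Lemma relation_primitive (m : {rmorphism fun1 k -> L}) eta (p : {poly fun1 k}) :
  m \o @const1 k =1 c -> p != 0 -> (map_poly m p).[eta] = 0 ->
  exists P : {poly {poly k}}, [/\ P != 0, poly2_primitive P, size P = size p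
    & eval2 c (m (y1 k)) eta P = 0].
Proof.
move=> mc pn0 p0; have tr := generator_transcendental mc.
have [d [q [dn0 E]]] := clear_denominators p.
have td : FracField.tofrac d != 0 :> fun1 k by rewrite tofrac_eq0.
have q0 : eval2 c (m (y1 k)) eta q = 0.
  rewrite (eval2_fun1 mc) -E.
  have -> : map_poly m (FracField.tofrac d *: p) =
            m (FracField.tofrac d) *: map_poly m p by exact: map_polyZ.
  by rewrite hornerZ p0 mulr0.
have sq : size q = size p.
  rewrite -(size_map_tofrac q) -E; exact: size_scale.
have qn0 : q != 0 by rewrite -size_poly_gt0 sq size_poly_gt0.
have [e [S [en0 prim qE]]] := primitive_part qn0.
have Sn0 : S != 0 by apply: contra_neq qn0 => S0; rewrite qE S0 mulr0.
exists S; split=> //; first by rewrite -sq qE size_Cmul.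
move: q0; rewrite qE eval2M eval2C => /eqP.
by rewrite mulf_eq0 transcendental_eval // (negPf en0) => /eqP.
Qed.

Section OneSided.
Variables (m1 m2 : {rmorphism fun1 k -> L}) (w1 w2 : L) (f g : fun1 k).
Hypothesis mc1 : m1 \o @const1 k =1 c.
Hypothesis mc2 : m2 \o @const1 k =1 c.
Hypothesis ww1 : w1 ^+ 2 = m1 f.
Hypothesis ww2 : w2 ^+ 2 = m2 g.
Hypothesis nf : nonsquare f.
Hypothesis ng : nonsquare g.
Hypothesis sp1 : spanned m1 w1.
Hypothesis sp2 : spanned m2 w2.
Local Notation z := (m1 (y1 k)).
Local Notation eta := (m2 (y1 k)).

(** The primitive form P of the minimal relation of eta over k(z) divides the cleared relation of z
    over k(eta), read with the variables exchanged. So one P is bounded in both degrees. *)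
Lemma degree_bound (p : {poly fun1 k}) :
  p != 0 -> (map_poly m1 p).[eta] = 0 ->
  (forall r : {poly fun1 k}, (size r < size p)%N -> (map_poly m1 r).[eta] = 0 -> r = 0) ->
  forall q : {poly fun1 k}, q != 0 -> (map_poly m2 q).[z] = 0 ->
  exists P : {poly {poly k}}, [/\ P != 0, size P = size p,
    (sizeY P <= size q)%N & eval2 c z eta P = 0].
Proof.
move=> pn0 p0 irr q qn0 q0.
have [P [Pn0 prim sP P0]] := relation_primitive mc1 pn0 p0.
have [Q [Qn0 _ sQ Q0]] := relation_primitive mc2 qn0 q0.
exists P; split=> //.
have <- : sizeY (swapXY Q) = size q by rewrite sizeYE swapXYK.
rewrite -sP in irr.
apply: (minimal_sizeY mc1 Pn0 prim P0 irr); last by rewrite swapXY_eq0.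
by rewrite eval2_swap.
Qed.

End OneSided.
End TwoQuadraticGenerators.

Lemma nonsquare_sqrM (K : fieldType) (b f : K) : b != 0 ->
  (forall h, f != h ^+ 2) -> forall h, b ^+ 2 * f != h ^+ 2.
Proof.
move=> bn0 nf h; apply: contra (nf (h / b)) => /eqP E.
by rewrite expr_div_n -E; apply/eqP; field.
Qed.

Section BidegreeEvaluation.
Variables (k : numClosedFieldType) (L : fieldType) (c : {rmorphism k -> L}).
Variables (z eta : L).

Lemma horner_map_coef n (p : {poly k}) : (size p <= n)%N ->
  (map_poly c p).[z] = \sum_(i < n) c p`_i * z ^+ i.
Proof.
move=> sp; rewrite (@horner_coef_wide _ n); last first.
  exact: leq_trans (size_poly _ _) sp.
by apply: eq_bigr => i _; rewrite coef_map.
Qed.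

Lemma eval2_coef n (P : {poly {poly k}}) : (size P <= n)%N ->
  eval2 c z eta P = \sum_(i < n) (map_poly c P`_i).[z] * eta ^+ i.
Proof.
move=> sP; rewrite /eval2 (@horner_coef_wide _ n (map_poly (map_poly c) P)); last first.
  exact: leq_trans (size_poly _ _) sP.
rewrite horner_sum; apply: eq_bigr => i _.
by rewrite coef_map hornerM -polyC_exp hornerC.
Qed.

Lemma eval2_biquadratic (P : {poly {poly k}}) :
  (size P <= 3)%N -> (sizeY P <= 3)%N ->
  let a i j := P`_i`_j in
  eval2 c z eta P = poly2eval c a z 2%N * eta ^+ 2
    + poly2eval c a z 1%N * eta + poly2eval c a z 0%N.
Proof.
move=> sP sY a; rewrite (eval2_coef sP).
have s3 i : (size (P`_i)%R <= 3)%N by apply: leq_trans (max_size_coefXY _ _) sY.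
rewrite !big_ord_recl big_ord0 /= !(horner_map_coef (s3 _)).
by rewrite !big_ord_recl !big_ord0 /poly2eval /a /=; ring.
Qed.

Lemma eval2_bilinear (P : {poly {poly k}}) :
  (size P <= 2)%N -> (sizeY P <= 2)%N ->
  eval2 c z eta P = (c P`_1`_1 * z + c P`_1`_0) * eta
    + (c P`_0`_1 * z + c P`_0`_0).
Proof.
move=> sP sY; rewrite (eval2_coef sP).
have s3 i : (size (P`_i)%R <= 2)%N by apply: leq_trans (max_size_coefXY _ _) sY.
rewrite !big_ord_recl big_ord0 /= !(horner_map_coef (s3 _)).
by rewrite !big_ord_recl !big_ord0 /=; ring.
Qed.

Lemma bilinear_homography (d1 d0 e1 e0 : k) :
  transcendental c z -> transcendental c eta -> (d1 != 0) || (d0 != 0) ->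
  (c d1 * z + c d0) * eta + (c e1 * z + c e0) = 0 ->
  exists2 M : 'M[k]_2, M \in unitmx & eta = homography (map_mx c M) z.
Proof.
move=> trz tre dn0 E; have den := transcendental_denominator trz dn0.
exists (mx2 (- e1) (- e0) d1 d0); last first.
  rewrite homography_map_mx2; apply: (mulfI den).
  by rewrite [RHS]mulrC divfK // !rmorphN; apply: (eq_of_diff 1 E); ring.
rewrite unitmx2; case: (mx2E (- e1) (- e0) d1 d0) => -> -> -> ->.
(* With zero determinant the rows are proportional, and eta would be the constant -s. *)
apply/eqP => dt; have [s [e1E e0E]] : exists s, e1 = s * d1 /\ e0 = s * d0.
  have [d10|d1n0] := eqVneq d1 0; last first.
    exists (e1 / d1); split; first by field.
    by apply: (mulIf d1n0); rewrite mulrAC divfK //; apply: (eq_of_diff 1 dt); ring.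
  move: dn0; rewrite d10 eqxx /= => d0n0; exists (e0 / d0).
  rewrite mulr0 divfK //; split=> //.
  by apply: (mulIf d0n0); apply: (eq_of_diff (-1) dt); rewrite d10; ring.
apply: tre; have -> : eta = c (- s).
  apply: (mulfI den); rewrite rmorphN; apply: (eq_of_diff 1 E).
  by rewrite e1E e0E !rmorphM; ring.
exact: algebraic_id.
Qed.

End BidegreeEvaluation.

(** * Two quadratic subfields of one field *)

Section TwoQuadraticOrbits.
Variables (k : numClosedFieldType) (L : fieldType) (c : {rmorphism k -> L}).
Variables (m1 m2 : {rmorphism fun1 k -> L}) (w1 w2 : L) (f g : fun1 k).
Hypothesis mc1 : m1 \o @const1 k =1 c.
Hypothesis mc2 : m2 \o @const1 k =1 c.
Hypothesis ww1 : w1 ^+ 2 = m1 f.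
Hypothesis ww2 : w2 ^+ 2 = m2 g.
Hypothesis nf : nonsquare f.
Hypothesis ng : nonsquare g.
Hypothesis sp1 : spanned m1 w1.
Hypothesis sp2 : spanned m2 w2.
Local Notation z := (m1 (y1 k)).
Local Notation eta := (m2 (y1 k)).

Let trz := generator_transcendental mc1.
Let tre := generator_transcendental mc2.

Lemma fun1_two : 2%:R != 0 :> fun1 k.
Proof.
have two : 2%:R != 0 :> k by rewrite pnatr_eq0.
by have := fmorph_neq0 (@const1 k) two; rewrite rmorph_nat.
Qed.

(** The inclusion of k(eta) in k(z) is an equality, as L has degree 2 over both. The relation is
    then of bidegree (1, 1), so eta is a homography of z, and w2 compares g with f up to squares. *)
Lemma rational_case h : eta = m1 h -> same_orbit g f.
Proof.
move=> etaE.
have trh : transcendental (@const1 k) h.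
  move=> [p pn0 /rootP p0]; apply: tre; exists p => //; apply/rootP.
  rewrite etaE -(eq_map_poly mc1) map_poly_comp.
  by have := congr1 m1 p0; rewrite -horner_map rmorph0.
have [e eE] := evalf_rmorphism trh.
have m2E : m2 =1 m1 \o e.
  apply: eq_fun1_morph => [a|].
    apply: etrans (mc2 a) _; apply: etrans (esym (mc1 a)) _.
    apply: (congr1 m1); apply: esym; apply: etrans (eE _) _.
    exact: evalf_const trh.
  apply: etrans etaE _; apply: (congr1 m1).
  by apply: esym; apply: etrans (eE _) _; apply: evalf_y1 trh.
(* Otherwise L, generated by eta and w2, would be contained in k(z), against w1. *)
have w2out t : w2 <> m1 t.
  move=> w2E; have [u [v w1E]] := sp2 w1.
  apply: (quadratic_notin ww1 nf (a := e u + e v * t)).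
  by rewrite w1E w2E !m2E rmorphD rmorphM.
have [a [b zE]] := sp2 z.
(* A nonzero b would express w2 through z and eta, hence in k(z). *)
have b0 : b = 0.
  apply/eqP/negPn/negP => bn0; apply: (w2out ((y1 k - e a) / e b)).
  have mbn0 : m2 b != 0 by exact: fmorph_neq0.
  rewrite fmorph_div rmorphB -[m1 (e a)]m2E -[m1 (e b)]m2E zE.
  by apply: (mulfI mbn0); field.
move: zE; rewrite b0 rmorph0 mul0r addr0 => zE.
have lin (K F : fieldType) (m : {rmorphism K -> F}) s x : x = m s ->
    [/\ 'X - s%:P != 0, size ('X - s%:P) = 2%N & (map_poly m ('X - s%:P)).[x] = 0].
  move=> ->; rewrite polyXsubC_eq0 size_XsubC; split=> //.
  by rewrite rmorphB /= map_polyX map_polyC !hornerE subrr.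
have irr (K F : fieldType) (m : {rmorphism K -> F}) x (r : {poly K}) :
    (size r < 2)%N -> (map_poly m r).[x] = 0 -> r = 0.
  move=> sr; rewrite (size1_polyC (sr : (size r <= 1)%N)) map_polyC hornerC.
  by move/eqP; rewrite fmorph_eq0 => /eqP ->.
have [pn0 sp p0] := lin _ _ m1 h eta etaE.
have [qn0 sq q0] := lin _ _ m2 a z zE.
have [|P [Pn0 sP sY P0]] := degree_bound mc1 mc2 pn0 p0 _ qn0 q0.
  by move=> r; rewrite sp; apply: irr.
rewrite sp in sP; rewrite sq in sY.
have s2 : (size P <= 2)%N by rewrite sP.
rewrite (eval2_bilinear c z eta s2 sY) in P0.
have dn0 : (P`_1`_1 != 0) || (P`_1`_0 != 0).
  have : lead_coef P != 0 by rewrite lead_coef_eq0.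
  rewrite lead_coefE sP /=; apply: contraR.
  rewrite negb_or !negbK => /andP[/eqP c1 /eqP c0]; apply/eqP/polyP => i.
  rewrite coef0; case: i => [|[|i]] //.
  rewrite nth_default //; apply: leq_trans (max_size_coefXY _ _) _.
  exact: leq_trans sY _.
have [M uM etaM] := bilinear_homography trz tre dn0 P0.
have [u su] := substitution_ex uM; have [uc uy] := su.
have m2u : m2 =1 m1 \o u.
  apply: eq_fun1_morph => [s|].
    by apply: etrans (mc2 s) _; apply: etrans (esym (mc1 s)) (congr1 m1 (esym (uc s))).
  apply: etrans etaM _; apply: esym; apply: etrans (congr1 m1 uy) _.
  rewrite map_homography -map_mx_comp; congr (homography _ _).
  exact: eq_map_mx.
have ww2' : w2 ^+ 2 = m1 (u g) by rewrite ww2; apply: m2u.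
have [d [dn0' ugE]] := square_outside ww1 nf sp1 fun1_two w2out ww2'.
apply/same_orbitP; exists M, u, d^-1; split.
- exact: uM.
- exact: su.
- exact: invr_neq0.
- rewrite ugE; apply: esym; exact: (rmorph_cancel_sqr idfun f dn0').
Qed.

(** As eta is outside k(z), its quadratic equation is minimal, and P has degree at most 2 in each
    variable. *)
Lemma general_case : (forall h, eta <> m1 h) -> (forall h, z <> m2 h) ->
  same_orbit f g.
Proof.
move=> out1 out2.
have [p [sp p0]] := quadratic_relation ww1 sp1 eta.
have [q [sq q0]] := quadratic_relation ww2 sp2 z.
have pn0 : p != 0 by rewrite -size_poly_gt0 sp.
have qn0 : q != 0 by rewrite -size_poly_gt0 sq.
have [|P [Pn0 sP sY P0]] := degree_bound mc1 mc2 pn0 p0 _ qn0 q0.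
  by move=> r; rewrite sp; apply: linear_independent.
rewrite sp in sP; rewrite sq in sY.
have s3 : (size P <= 3)%N by rewrite sP.
rewrite (eval2_biquadratic c z eta s3 sY) in P0.
set a : nat -> nat -> k := fun i j => P`_i`_j in P0.
(* The same relation, read as an equation for z over k(eta). *)
pose b i j := a j i.
have nz : exists i j, [/\ (i < 3)%N, (j < 3)%N & a i j != 0].
  have l0 : lead_coef (lead_coef P) != 0 by rewrite !lead_coef_eq0.
  exists 2%N, (size (P`_2)%R).-1.
  move: l0; rewrite ![lead_coef _]lead_coefE sP /= => l0; split=> //.
  have : (size (P`_2)%R <= 3)%N by apply: leq_trans (max_size_coefXY _ _) sY.
  by case: (size _).
have nz' : exists i j, [/\ (i < 3)%N, (j < 3)%N & b i j != 0].
  by have [i [j [hi hj h]]] := nz; exists j, i.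
have P0' : poly2eval c b eta 2%N * z ^+ 2 + poly2eval c b eta 1%N * z
    + poly2eval c b eta 0%N = 0.
  by rewrite -P0 /poly2eval /b; ring.
have [s [sn0 Ds]] := biquadratic_orbit mc1 trz ww1 nf sp1 out1 P0 nz.
have [t [tn0 Dt]] := biquadratic_orbit mc2 tre ww2 ng sp2 out2 P0' nz'.
have [II JJ] := disc_swap_IJ a.
have n1 : nonsquare (disc (@const1 k) a (y1 k)).
  exact: (eq_ind_r (@nonsquare k) (nonsquare_sqrM sn0 nf) Ds).
have n2 : nonsquare (disc (@const1 k) b (y1 k)).
  exact: (eq_ind_r (@nonsquare k) (nonsquare_sqrM tn0 ng) Dt).
have o := quartic_same_orbit n1 n2 II JJ.
have of1 : same_orbit f (disc (@const1 k) a (y1 k)).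
  exact: (eq_ind_r (same_orbit f) (same_orbit_square f sn0) Ds).
have og : same_orbit g (disc (@const1 k) b (y1 k)).
  exact: (eq_ind_r (same_orbit g) (same_orbit_square g tn0) Dt).
exact: same_orbit_trans of1 (same_orbit_trans o (same_orbit_sym og)).
Qed.

End TwoQuadraticOrbits.

Lemma field_iso_same_orbit (k : numClosedFieldType) (f g : fun1 k)
    (nf : nonsquare f) (ng : nonsquare g) :
  field_iso_over (sqrt_const nf) (sqrt_const ng) -> same_orbit f g.
Proof.
move=> [u [[v uv vu] uc]].
pose c : {rmorphism k -> sqrt_ext ng} := sqrt_incl ng \o @const1 k.
pose m1 : {rmorphism fun1 k -> sqrt_ext ng} := u \o sqrt_incl nf.
pose m2 := sqrt_incl ng.
have mc1 : m1 \o @const1 k =1 c by move=> a; exact: uc.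
have mc2 : m2 \o @const1 k =1 c by [].
have ww1 : (u (sqrt_gen nf)) ^+ 2 = m1 f.
  exact: etrans (esym (rmorphXn u 2 (sqrt_gen nf))) (congr1 u (sqrt_genE nf)).
have ww2 : (sqrt_gen ng) ^+ 2 = m2 g by exact: sqrt_genE.
have sp2 : spanned m2 (sqrt_gen ng) by exact: sqrt_ext_spanned.
have sp1 : spanned m1 (u (sqrt_gen nf)).
  move=> t; have [a [b E]] := @sqrt_ext_spanned k f nf (v t).
  exists a, b; apply: etrans (esym (vu t)) _; apply: etrans (congr1 u E) _.
  apply: etrans (rmorphD u _ _) _; congr (_ + _).
  exact: (rmorphM u).
have [[h E]|no1] := pselect (exists h, m2 (y1 k) = m1 h).
  apply: same_orbit_sym.
  exact: (rational_case mc1 mc2 ww1 ww2 nf sp1 sp2 E).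
have [[h E]|no2] := pselect (exists h, m1 (y1 k) = m2 h).
  exact: (rational_case mc2 mc1 ww2 ww1 ng sp2 sp1 E).
apply: (general_case mc1 mc2 ww1 ww2 nf ng sp1 sp2) => h E.
  by apply: no1; exists h.
by apply: no2; exists h.
Qed.

(** * Points of curves *)

Section CurvePoints.
Variables (k K : fieldType) (c : {rmorphism k -> K}) (P : curve c).
Local Notation O := (sval P).
Local Notation m := (max_ideal P).

Lemma point_valuation : exists v : K -> int,
  [/\ exists2 t, t != 0 & v t = 1,
      forall s t, s != 0 -> t != 0 -> v (s * t) = v s + v t,
      forall s t, s != 0 -> t != 0 -> s + t != 0 -> Order.min (v s) (v t) <= v (s + t),
      (forall s, s != 0 -> v s^-1 = - v s) /\
      forall s, O s <-> s = 0 \/ 0 <= v s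
    & forall s, m s <-> s = 0 \/ 0 < v s].
Proof.
have [v [vt vM vD vc OE]] := svalP P; exists v.
have Oin s : O s <-> s = 0 \/ 0 <= v s by rewrite OE.
have v1 : v 1 = 0 by rewrite -(rmorph1 c) vc // oner_eq0.
have vV s : s != 0 -> v s^-1 = - v s.
  move=> sn0; have := vM _ _ sn0 (invr_neq0 sn0); rewrite divff // v1 => /eqP.
  by rewrite eq_sym addrC addr_eq0 => /eqP.
split=> // s; split=> [[/Oin os nos]|ms].
  case: os nos => [->|vs]; first by left.
  case=> [->|nos]; first by left.
  have [->|sn0] := eqVneq s 0; [by left | right].
  rewrite lt_neqAle vs andbT; apply/eqP => vs0; apply: nos; apply/Oin; right.
  by rewrite vV // -vs0 oppr0.
split; first by apply/Oin; case: ms => [->|/ltW vs]; [left | right].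
have [->|sn0] := eqVneq s 0; [by left | right].
case: ms => [/eqP|vs]; first by rewrite (negPf sn0).
move=> /Oin [/eqP|]; first by rewrite invr_eq0 (negPf sn0).
by rewrite vV // oppr_ge0 leNgt vs.
Qed.

Lemma pointM s t : O s -> O t -> O (s * t).
Proof.
have [v [_ vM _ [_ OE] _]] := point_valuation.
have [-> _ _|sn0] := eqVneq s 0; first by apply/OE; left; rewrite mul0r.
have [-> _ _|tn0] := eqVneq t 0; first by apply/OE; left; rewrite mulr0.
move=> /OE[/eqP|vs]; first by rewrite (negPf sn0).
move=> /OE[/eqP|vt]; first by rewrite (negPf tn0).
by apply/OE; right; rewrite vM // addr_ge0.
Qed.

Lemma pointD s t : O s -> O t -> O (s + t).
Proof.
have [v [_ _ vD [_ OE] _]] := point_valuation.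
have [-> _|sn0] := eqVneq s 0; first by rewrite add0r.
have [-> + _|tn0] := eqVneq t 0; first by rewrite addr0.
have [-> _ _|stn0] := eqVneq (s + t) 0; first by apply/OE; left.
move=> /OE[/eqP|vs]; first by rewrite (negPf sn0).
move=> /OE[/eqP|vt]; first by rewrite (negPf tn0).
apply/OE; right; apply: le_trans (vD _ _ sn0 tn0 stn0).
by rewrite le_min vs.
Qed.

Lemma point_max_sub s : m s -> O s. Proof. by case. Qed.

Lemma point_maxM s t : m s -> O t -> m (s * t).
Proof.
have [v [_ vM _ [_ OE] mE]] := point_valuation.
have [-> _ _|sn0] := eqVneq s 0; first by apply/mE; left; rewrite mul0r.
have [-> _ _|tn0] := eqVneq t 0; first by apply/mE; left; rewrite mulr0.
move=> /mE[/eqP|vs]; first by rewrite (negPf sn0).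
move=> /OE[/eqP|vt]; first by rewrite (negPf tn0).
by apply/mE; right; rewrite vM // ltr_wpDr.
Qed.

Lemma point_maxD s t : m s -> m t -> m (s + t).
Proof.
have [v [_ _ vD _ mE]] := point_valuation.
have [-> _|sn0] := eqVneq s 0; first by rewrite add0r.
have [-> + _|tn0] := eqVneq t 0; first by rewrite addr0.
have [-> _ _|stn0] := eqVneq (s + t) 0; first by apply/mE; left.
move=> /mE[/eqP|vs]; first by rewrite (negPf sn0).
move=> /mE[/eqP|vt]; first by rewrite (negPf tn0).
apply/mE; right; apply: lt_le_trans (vD _ _ sn0 tn0 stn0).
by rewrite lt_min vs.
Qed.

Lemma point_const a : O (c a).
Proof.
have [v [_ _ _ vc ->]] := svalP P; rewrite /=.
by have [->|an0] := eqVneq a 0; [left; rewrite rmorph0 | right; rewrite vc].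
Qed.

Lemma point_max0 : m 0.
Proof. by have [v [_ _ _ _ mE]] := point_valuation; apply/mE; left. Qed.

Lemma point_max_const a : m (c a) -> a = 0.
Proof.
move=> [_ [/eqP|]]; first by rewrite fmorph_eq0 => /eqP.
by rewrite -fmorphV => h; case: h; apply: point_const.
Qed.

Lemma point_max1 : ~ m 1.
Proof.
by rewrite -(rmorph1 c) => /point_max_const/eqP; rewrite oner_eq0.
Qed.

Lemma pointN s : O s -> O (- s).
Proof.
move=> os; rewrite -mulN1r -(rmorph1 c) -rmorphN; apply: pointM os.
exact: point_const.
Qed.

Lemma pointB s t : O s -> O t -> O (s - t).
Proof. by move=> os /pointN; apply: pointD. Qed.

Lemma point_maxN s : m s -> m (- s).
Proof.
move=> ms; rewrite -mulrN1 -(rmorph1 c) -rmorphN; apply: point_maxM ms _.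
exact: point_const.
Qed.

Lemma point_maxB s t : m s -> m t -> m (s - t).
Proof. by move=> ms /point_maxN; apply: point_maxD. Qed.

Lemma point_total s : ~ O s -> m s^-1 /\ s != 0.
Proof.
have [v [_ _ _ [vV OE] mE]] := point_valuation; move=> nos.
have sn0 : s != 0 by apply/eqP => s0; apply: nos; apply/OE; left.
split=> //; apply/mE; right; rewrite vV // oppr_gt0 ltNge.
by apply/negP => vs; apply: nos; apply/OE; right.
Qed.

Lemma point_unit s : O s -> ~ m s -> O s^-1.
Proof. by move=> os nms; apply: contrapT => h; apply: nms; split=> //; right. Qed.

Lemma point_unit_neq0 s : ~ m s -> s != 0.
Proof. by move=> nms; apply/eqP => s0; apply: nms; rewrite s0; apply: point_max0. Qed.

Lemma point_prime s t : O s -> O t -> m (s * t) -> m s \/ m t.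
Proof.
move=> os ot mst; have [|nms] := pselect (m s); [by left | right].
have := point_maxM mst (point_unit os nms).
by rewrite mulrAC divff ?mul1r // point_unit_neq0.
Qed.

Lemma point_residue_uniq s a b : m (s - c a) -> m (s - c b) -> a = b.
Proof.
move=> ma mb; apply/eqP; rewrite -subr_eq0; apply/eqP/point_max_const.
rewrite rmorphB; have := point_maxB mb ma.
by rewrite opprB addrC subrKA.
Qed.

Lemma point_horner (p : {poly k}) s : O s -> O (map_poly c p).[s].
Proof.
move=> os; elim/poly_ind: p => [|p a IH].
  by rewrite rmorph0 horner0; apply/point_max_sub/point_max0.
rewrite rmorphD rmorphM /= map_polyX map_polyC !hornerE.
by apply: pointD (point_const _); apply: pointM.
Qed.

Lemma point_horner_residue (p : {poly k}) s a : m (s - c a) ->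
  m ((map_poly c p).[s] - c p.[a]).
Proof.
move=> ms; have os : O s.
  by rewrite -(subrK (c a) s); apply: pointD (point_const _); apply: point_max_sub.
elim/poly_ind: p => [|p b IH].
  by rewrite rmorph0 !horner0 rmorph0 subr0; apply: point_max0.
rewrite rmorphD rmorphM /= map_polyX map_polyC !hornerE /=.
have -> : (map_poly c p).[s] * s + c b - c (p.[a] * a + b) =
  ((map_poly c p).[s] - c p.[a]) * s + (s - c a) * c p.[a].
  by rewrite rmorphD rmorphM; ring.
apply: point_maxD; first exact: point_maxM.
by apply: point_maxM (ms) _; apply: point_const.
Qed.

End CurvePoints.

Lemma curve_eq (k K : fieldType) (c : k -> K) (P Q : curve c) :
  sval P = sval Q -> P = Q.
Proof.
case: P Q => [P hP] [Q hQ] /= E; case: _ / E hQ => hQ.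
by congr exist; apply: Prop_irrelevance.
Qed.

(** Discrete valuation rings are maximal. If s is in the ring of Q but not of P, and t is a
    uniformizer at Q, then t^-1 s^-n is in the ring of P for n large, hence in that of Q, and
    multiplying by s^n puts t^-1 there. *)
Lemma point_sub_eq (k K : fieldType) (c : {rmorphism k -> K}) (P Q : curve c) :
  (forall s, sval P s -> sval Q s) -> P = Q.
Proof.
move=> PQ; apply: curve_eq; apply/seteqP; split=> // s Qs; apply: contrapT => nPs.
have [v [_ vM _ [vV OP] _]] := point_valuation P.
have [v' [[t tn0 vt] _ _ [v'V OQ] _]] := point_valuation Q.
have [_ sn0] := point_total nPs.
have vs : v s < 0.
  by rewrite ltNge; apply/negP => h; apply: nPs; apply/OP; right.
pose n := absz (v t^-1).
have vX i : v (s ^- i) = - (v s *+ i).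
  elim: i => [|i IH]; first by rewrite expr0 invr1 mulr0n oppr0; have := vV 1 (oner_neq0 _); rewrite invr1; lia.
  by rewrite exprSr invfM vM ?invr_eq0 ?expf_neq0 // IH (vV _ sn0) mulrSr opprD.
have : sval P (t^-1 * s ^- n).
  apply/OP; right; rewrite vM ?invr_eq0 ?expf_neq0 // vX /n.
  move: (v t^-1) (v s) vs => x y; nia.
move=> /PQ h.
have : sval Q t^-1.
  have Qn : sval Q (s ^+ n).
    elim: n {h} => [|i IH]; first by rewrite expr0 -(rmorph1 c); apply: point_const.
    by rewrite exprS; apply: pointM.
  have := pointM h Qn; rewrite -mulrA mulVf ?mulr1 //.
  by rewrite expf_neq0.
move=> /OQ [/eqP|]; first by rewrite invr_eq0 (negPf tn0).
by rewrite v'V // vt.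
Qed.

(** * From field isomorphisms to curve isomorphisms *)

Section FieldIsoCurve.
Variables (k K L : fieldType) (c : k -> K) (d : k -> L).
Variables (u : {rmorphism K -> L}) (v : {rmorphism L -> K}).
Hypotheses (uv : cancel u v) (vu : cancel v u).
Hypotheses (uc : forall a, u (c a) = d a).

Lemma transport_dvr (P : curve c) : is_dvr d [set s | sval P (v s)].
Proof.
have [w [[t tn0 wt] wM wD wc E]] := svalP P; exists (w \o v); split=> /=.
- by exists (u t); rewrite ?fmorph_eq0 ?uv.
- by move=> s s' sn0 s'n0; rewrite rmorphM wM ?fmorph_eq0.
- by move=> s s' sn0 s'n0 ss; rewrite rmorphD wD -?rmorphD ?fmorph_eq0.
- by move=> a an0; rewrite -uc uv wc.
- rewrite E; apply/seteqP; split=> s /= [s0|]; try by right.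
    by left; apply/eqP; rewrite -(fmorph_eq0 v) s0.
  by left; rewrite s0 rmorph0.
Qed.

Definition transport_curve (P : curve c) : curve d := exist _ _ (transport_dvr P).

Lemma transport_max P s : max_ideal (transport_curve P) s <-> max_ideal P (v s).
Proof.
rewrite /max_ideal /= fmorphV; split=> -[os [s0|h]]; split=> //; try by right.
  by left; rewrite s0 rmorph0.
by left; apply/eqP; rewrite -(fmorph_eq0 v) s0.
Qed.

End FieldIsoCurve.

Lemma transport_curveK (k K L : fieldType) (c : k -> K) (d : k -> L)
    (u : {rmorphism K -> L}) (v : {rmorphism L -> K})
    (uv : cancel u v) (vu : cancel v u)
    (uc : forall a, u (c a) = d a) (vd : forall a, v (d a) = c a) :
  cancel (transport_curve uv uc) (transport_curve vu vd).
Proof.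
move=> P; apply: curve_eq => /=; apply/seteqP; split=> s /=; by rewrite uv.
Qed.

Lemma transport_morphism (k K L : fieldType) (c : k -> K) (d : k -> L)
    (u : {rmorphism K -> L}) (v : {rmorphism L -> K})
    (uv : cancel u v) (vu : cancel v u)
    (uc : forall a, u (c a) = d a) (vd : forall a, v (d a) = c a) :
  curve_morphism (transport_curve uv uc).
Proof.
split=> [V [->|fV]|V h oV [s sh]].
- by left; rewrite preimage_set0.
- right; rewrite preimage_setC; apply: finite_preimage fV => P Q _ _.
  exact: (can_inj (transport_curveK uv vu uc vd)).
- exists (v s) => P /= VP; have /transport_max := sh _ VP.
  by rewrite rmorphB vd.
Qed.

Lemma field_iso_curve_iso (k K L : fieldType) (c : k -> K) (d : k -> L) :
  field_iso_over c d -> curve_iso c d.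
Proof.
move=> iso; have [v' [[_ _ _] _]] := field_iso_over_sym iso.
move: iso => [u [[v0 uv0 vu0] uc]].
have vB : zmod_morphism v0.
  by move=> x y; apply: (fmorph_inj u); rewrite rmorphB !vu0.
have vM : monoid_morphism v0.
  by split=> [|x y]; apply: (fmorph_inj u); rewrite ?rmorph1 ?rmorphM !vu0.
pose v : {rmorphism L -> K} := HB.pack v0
  (GRing.isZmodMorphism.Build _ _ _ vB) (GRing.isMonoidMorphism.Build _ _ _ vM).
have uv : cancel u v by [].
have vu : cancel v u by [].
have vd a : v (d a) = c a by rewrite -uc uv.
exists (transport_curve uv uc), (transport_curve vu vd); split.
- exact: transport_curveK.
- exact: transport_curveK.
- exact: transport_morphism.
- exact: transport_morphism.
Qed.

(** * From curve isomorphisms to field isomorphisms *)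

Definition curve_finiteness (k K : fieldType) (c : k -> K) :=
  [/\ forall s, finite_set [set P : curve c | ~ sval P s],
      forall (P : curve c) s, sval P s -> exists a, max_ideal P (s - c a)
    & ~ finite_set [set: curve c]].

Lemma cofinite_ex (T : Type) (A : set T) :
  ~ finite_set [set: T] -> finite_set (~` A) -> exists x, A x.
Proof.
move=> inf fin; apply: contrapT => no; apply: inf.
by apply: sub_finite_set fin => x _ Ax; apply: no; exists x.
Qed.

Lemma cofiniteI (T : Type) (A B : set T) :
  finite_set (~` A) -> finite_set (~` B) -> finite_set (~` (A `&` B)).
Proof. by move=> fA fB; rewrite setCI finite_setU. Qed.

(** The zeros of a nonzero s are poles of s^-1, hence finite in number. *)
Lemma cofinite_max_eq0 (k K : fieldType) (c : {rmorphism k -> K})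
    (A : set (curve c)) s : curve_finiteness c -> finite_set (~` A) ->
  (forall P, A P -> max_ideal P s) -> s = 0.
Proof.
move=> [fp _ inf] fA As; apply/eqP/negPn/negP => sn0.
have [P [AP Ps]] := cofinite_ex inf (cofiniteI fA (fp s^-1)).
by have [_ [/eqP|]] := As P AP; first by rewrite (negPf sn0).
Qed.

Section CurveIsoRelation.
Variables (k K L : fieldType) (c : {rmorphism k -> K}) (d : {rmorphism k -> L}).
Hypothesis finK : curve_finiteness c.
Hypothesis finL : curve_finiteness d.
Variables (F : curve c -> curve d) (G : curve d -> curve c).
Hypotheses (FG : cancel F G) (GF : cancel G F).

(** The graph of the field isomorphism sought, with s equal to t o F at almost all points; finitely
    many exceptions leave room for poles. *)
Definition same_values (s : K) (t : L) := exists A : set (curve c),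
  finite_set (~` A) /\ forall P, A P ->
    exists a, max_ideal P (s - c a) /\ max_ideal (F P) (t - d a).

Lemma same_valuesD s t s' t' : same_values s t -> same_values s' t' ->
  same_values (s + s') (t + t').
Proof.
move=> [A [fA hA]] [B [fB hB]]; exists (A `&` B); split; first exact: cofiniteI.
move=> P [/hA[a [sa ta]] /hB[b [sb tb]]]; exists (a + b).
rewrite !rmorphD !opprD [s + s' + _]addrACA [t + t' + _]addrACA.
by split; apply: point_maxD.
Qed.

Lemma same_valuesN s t : same_values s t -> same_values (- s) (- t).
Proof.
move=> [A [fA hA]]; exists A; split=> // P /hA[a [sa ta]]; exists (- a).
by rewrite !rmorphN -!opprD; split; apply: point_maxN.
Qed.

Lemma same_valuesM s t s' t' : same_values s t -> same_values s' t' ->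
  same_values (s * s') (t * t').
Proof.
have key (k' K' : fieldType) (e : {rmorphism k' -> K'}) (P : curve e) x x' a b :
    max_ideal P (x - e a) -> max_ideal P (x' - e b) -> max_ideal P (x * x' - e (a * b)).
  move=> xa xb.
  have ox' : sval P x'.
    by rewrite -(subrK (e b) x'); apply: pointD (point_const _ _); apply: point_max_sub.
  have -> : x * x' - e (a * b) = (x - e a) * x' + (x' - e b) * e a.
    by rewrite rmorphM; ring.
  by apply: point_maxD; [apply: point_maxM | apply: point_maxM xb (point_const _ _)].
move=> [A [fA hA]] [B [fB hB]]; exists (A `&` B); split; first exact: cofiniteI.
by move=> P [/hA[a [sa ta]] /hB[b [sb tb]]]; exists (a * b); split; apply: key.
Qed.

Lemma same_values_const a : same_values (c a) (d a).
Proof.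
exists setT; rewrite setCT; split; first exact: finite_set0.
by move=> P _; exists a; rewrite !subrr; split; apply: point_max0.
Qed.

Lemma same_values0l t : same_values 0 t -> t = 0.
Proof.
move=> [A [fA hA]]; apply: (cofinite_max_eq0 (A := G @^-1` A) finL).
  rewrite preimage_setC; apply: finite_preimage fA => P Q _ _.
  exact: (can_inj GF).
move=> Q /hA[a]; rewrite GF sub0r -rmorphN => -[/point_max_const/eqP + h].
by rewrite oppr_eq0 => /eqP a0; move: h; rewrite a0 rmorph0 subr0.
Qed.

(** The function t is regular away from its poles, an open set, and a morphism of curves pulls
    regular functions back to regular functions. *)
Lemma same_values_pullback : curve_morphism F -> forall t, exists s, same_values s t.
Proof.
move=> [Fo Fr] t; have [fp res inf] := finL; have [_ _ infK] := finK.
pose V := [set Q : curve d | sval Q t].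
have oV : curve_open V by right; exact: fp.
have [h hE] : exists h : curve d -> k, forall Q, V Q -> max_ideal Q (t - d (h Q)).
  have /boolp.choice [h hE] : forall Q, exists a, V Q -> max_ideal Q (t - d a).
    move=> Q; have [VQ|nVQ] := pselect (V Q); last by exists 0.
    by have [a ha] := res Q t VQ; exists a.
  by exists h.
have [s sE] : regular (F @^-1` V) (h \o F) by apply: Fr => //; exists t.
exists s, (F @^-1` V); split.
  rewrite preimage_setC; apply: finite_preimage (fp t) => P Q _ _.
  exact: (can_inj FG).
by move=> P VP; exists (h (F P)); split; [exact: sE | exact: hE].
Qed.

End CurveIsoRelation.

Lemma same_values_sym (k K L : fieldType) (c : {rmorphism k -> K})
    (d : {rmorphism k -> L}) (F : curve c -> curve d) (G : curve d -> curve c) s t :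
  cancel F G -> cancel G F -> same_values G t s -> same_values F s t.
Proof.
move=> FG GF [A [fA hA]]; exists (F @^-1` A); split.
  rewrite preimage_setC; apply: finite_preimage fA => P Q _ _.
  exact: (can_inj FG).
by move=> P /hA[a [ta sa]]; exists a; rewrite FG in sa.
Qed.

Lemma curve_iso_field_iso (k K L : fieldType) (c : {rmorphism k -> K})
    (d : {rmorphism k -> L}) :
  curve_finiteness c -> curve_finiteness d -> curve_iso c d -> field_iso_over c d.
Proof.
move=> finK finL [F [G [FG GF mF mG]]].
have /boolp.choice [u uE] : forall s, exists t, same_values F s t.
  move=> s; have [t h] := same_values_pullback finL finK GF mG s.
  by exists t; apply: same_values_sym h.
have uniq s t t' : same_values F s t -> same_values F s t' -> t = t'.
  move=> h h'; apply/eqP; rewrite -subr_eq0; apply/eqP.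
  apply: (same_values0l finL GF); rewrite -(subrr s).
  by apply: same_valuesD h _; apply: same_valuesN.
have uB : zmod_morphism u.
  move=> s s'; apply: (uniq (s - s')); first exact: uE.
  by apply: same_valuesD (uE _) _; apply: same_valuesN.
have uM : monoid_morphism u.
  split=> [|s s']; last first.
    by apply: (uniq (s * s')); [exact: uE | apply: same_valuesM].
  apply: (uniq 1); first exact: uE.
  by have := @same_values_const k K L c d F 1; rewrite !rmorph1.
pose v : {rmorphism K -> L} := HB.pack u
  (GRing.isZmodMorphism.Build _ _ _ uB) (GRing.isMonoidMorphism.Build _ _ _ uM).
apply: (@field_iso_of_surj _ _ _ _ _ v) => [t|a].
  have [s h] := same_values_pullback finK finL FG mF t.
  by exists s; apply: uniq h; apply: uE.
by apply: (uniq (c a)); [exact: uE | exact: same_values_const].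
Qed.

Lemma three_finite (T : Type) (A : set T) :
  (forall x y z, A x -> A y -> A z -> [\/ x = y, x = z | y = z]) -> finite_set A.
Proof.
move=> A3; have [[x Ax]|no] := pselect (exists x, A x); last first.
  by apply: (sub_finite_set (B := set0)) => // x Ax; apply: no; exists x.
have [[y [Ay xy]]|no] := pselect (exists y, A y /\ x <> y); last first.
  apply: (sub_finite_set (B := [set x])) => // y Ay /=.
  by apply: contrapT => h; apply: no; exists y; split=> // e; apply: h.
apply: (sub_finite_set (B := [set x] `|` [set y])); last by rewrite finite_setU.
by move=> z Az; have [//|->|->] := A3 x y z Ax Ay Az; [left | right].
Qed.

Lemma rmorph_sqr_sub (K L : fieldType) (j : {rmorphism K -> L}) a b f :
  j (b ^+ 2 * f - a ^+ 2) = j b ^+ 2 * j f - j a ^+ 2.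
Proof. by rewrite rmorphB !rmorphM. Qed.

(** * Finiteness on the curve of a quadratic extension *)

Section PointSeparation.
Variables (k : numFieldType) (K : fieldType) (c : {rmorphism k -> K}).
Implicit Types P Q R : curve c.

Lemma point_proper P : exists s, ~ sval P s.
Proof.
have [v [[t tn0 vt] _ _ [vV OE] _]] := point_valuation P.
exists t^-1 => /OE [/eqP|]; first by rewrite invr_eq0 (negPf tn0).
by rewrite vV // vt.
Qed.

(** Take s regular at P with a pole at Q. Then 1 / (s + a) vanishes at Q, and a suitable constant a
    makes it regular at R and a unit at P. *)
Lemma separate_points P Q R : P <> Q ->
  exists e, [/\ sval P e, ~ max_ideal P e, max_ideal Q e & sval R e].
Proof.
move=> PQ; have [s [Ps nQs]] : exists s, sval P s /\ ~ sval Q s.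
  apply: contrapT => no; apply: PQ; apply: point_sub_eq => s Ps.
  by apply: contrapT => nQs; apply: no; exists s.
have uniq (S : curve c) a b : max_ideal S (s + c a) -> max_ideal S (s + c b) -> a = b.
  have E x : s + c x = s - c (- x) by rewrite rmorphN opprK.
  rewrite (E a) (E b) => h1 h2.
  by apply: oppr_inj; apply: point_residue_uniq h1 h2.
(* Each of P and R forbids at most one constant, so one of 0, 1, 2 is allowed. *)
have [a [nP nR]] : exists a, ~ max_ideal P (s + c a) /\ ~ max_ideal R (s + c a).
  apply: contrapT => no.
  have bad a : max_ideal P (s + c a) \/ max_ideal R (s + c a).
    apply: contrapT => /not_orP[h1 h2]; apply: no; by exists a.
  have n01 : 0 <> 1 :> k by apply/eqP; rewrite eq_sym oner_neq0.
  have n02 : 0 <> 2%:R :> k by apply/eqP; rewrite eq_sym pnatr_eq0.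
  have n12 : 1 <> 2%:R :> k by apply/eqP; rewrite (eqr_nat k 1 2).
  have [h0|h0] := bad 0; have [h1|h1] := bad 1; have [h2|h2] := bad 2%:R;
  first [exact: n01 (uniq _ _ _ h0 h1) | exact: n02 (uniq _ _ _ h0 h2)
     | exact: n12 (uniq _ _ _ h1 h2)].
have Pa : sval P (s + c a) by apply: pointD Ps (point_const _ _).
have an0 := point_unit_neq0 nP.
exists (s + c a)^-1; split.
- exact: point_unit.
- move=> h; apply: (@point_max1 _ _ _ P); rewrite -(mulVf an0).
  exact: point_maxM h Pa.
- have [] // := @point_total _ _ _ Q (s + c a).
  by move=> h; apply: nQs; rewrite -(addrK (c a) s); apply: pointB h (point_const _ _).
- have [oR|nR'] := pselect (sval R (s + c a)); first exact: point_unit.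
  by have [/point_max_sub] := point_total nR'.
Qed.

Lemma separate_three P Q R : P <> Q -> P <> R ->
  exists e, [/\ sval P e, ~ max_ideal P e, max_ideal Q e & max_ideal R e].
Proof.
move=> /(@separate_points _ _ R) [e [e1 e2 e3 e4]].
move=> /(@separate_points _ _ Q) [e' [e1' e2' e3' e4']].
exists (e * e'); split.
- exact: pointM.
- by move=> /(point_prime e1 e1') [].
- exact: point_maxM.
- by rewrite mulrC; apply: point_maxM.
Qed.

(** Valuation rings are integrally closed; this is the quadratic case. *)
Lemma point_integral P s A N : sval P A -> sval P N -> s ^+ 2 = A * s + N -> sval P s.
Proof.
move=> oA oN E; apply: contrapT => /point_total[ms sn0].
apply: (@point_max1 _ _ _ P).
have -> : 1 = s^-1 * A + s^-1 * (s^-1 * N).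
  apply: (mulfI (expf_neq0 2 sn0)); rewrite mulr1 {1}E; field.
  by rewrite sn0.
apply: point_maxD; first exact: point_maxM.
by apply: point_maxM (ms) _; apply: pointM => //; apply: point_max_sub.
Qed.

End PointSeparation.

Lemma linear_dependence (K L : fieldType) (j : {rmorphism K -> L}) w :
  spanned j w -> forall e1 e2 e3, exists a1 a2 a3,
  (a1 != 0) || (a2 != 0) || (a3 != 0) /\ j a1 * e1 + j a2 * e2 + j a3 * e3 = 0.
Proof.
move=> sp e1 e2 e3; have [a1 [b1 ->]] := sp e1; have [a2 [b2 ->]] := sp e2.
have [a3 [b3 ->]] := sp e3.
have [m0|mn0] := eqVneq (a1 * b2 - a2 * b1) 0; last first.
  (* The 2 x 2 minors of the coordinate matrix. *)
  exists (a2 * b3 - a3 * b2), (a3 * b1 - a1 * b3), (a1 * b2 - a2 * b1).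
  by split; [rewrite mn0 orbT | rewrite !rmorphB !rmorphM; ring].
have jm0 : j a1 * j b2 - j a2 * j b1 = 0 by rewrite -!rmorphM -rmorphB m0 rmorph0.
have [b10|b1n0] := eqVneq b1 0; last first.
  exists b2, (- b1), 0; split; first by rewrite oppr_eq0 b1n0 orbT.
  by rewrite rmorphN rmorph0; apply: (eq_of_diff 1 jm0); ring.
have [a10|a1n0] := eqVneq a1 0.
  exists 1, 0, 0; split; first by rewrite oner_neq0.
  by rewrite a10 b10 !rmorph0; ring.
exists a2, (- a1), 0; split; first by rewrite oppr_eq0 a1n0 orbT.
by rewrite rmorphN rmorph0; apply: (eq_of_diff (- w) jm0); ring.
Qed.

Section QuadraticCurve.
Variables (k : numClosedFieldType) (L : fieldType) (c : {rmorphism k -> L}).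

Lemma point_poly_root (P : curve c) (q : {poly k}) s : q != 0 -> sval P s ->
  max_ideal P (map_poly c q).[s] -> exists2 r, root q r & max_ideal P (s - c r).
Proof.
move=> qn0 os; have [rs qE] := closed_field_poly_normal q.
have rt r : r \in rs -> root q r.
  by move=> rrs; rewrite qE rootZ ?lead_coef_eq0 // root_prod_XsubC.
move=> mq; have {mq} : max_ideal P (map_poly c (lead_coef q *: \prod_(z <- rs) ('X - z%:P))).[s].
  by rewrite -qE.
rewrite map_polyZ hornerZ => h.
have {h} : max_ideal P (map_poly c (\prod_(z <- rs) ('X - z%:P))).[s].
  case/point_prime: h => //; [exact: point_const | exact: point_horner |].
  by move=> /point_max_const/eqP; rewrite lead_coef_eq0 (negPf qn0).
elim: rs rt {qE} => [|r rs IH] rt.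
  by rewrite big_nil rmorph1 hornerC => /point_max1.
rewrite big_cons rmorphM hornerM rmorphB /= map_polyX map_polyC hornerD hornerN hornerX hornerC.
case/point_prime.
- exact: pointB os (point_const _ _).
- exact: point_horner.
- by move=> h; exists r => //; apply: rt; rewrite mem_head.
- by apply: IH => r' h; apply: rt; rewrite inE h orbT.
Qed.

Section AbovePoint.
Variables (j : {rmorphism fun1 k -> L}) (w : L) (f : fun1 k).
Hypothesis jc : j \o @const1 k =1 c.
Hypothesis ww : w ^+ 2 = j f.
Hypothesis sp : spanned j w.
Local Notation y := (j (y1 k)).

(** If y were regular without a constant residue, all nonzero polynomials in y would be units; the
    ring of P would contain k(y), hence its integral extension L. *)
Lemma point_center (P : curve c) :
  max_ideal P y^-1 \/ exists a, max_ideal P (y - c a).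
Proof.
have [oy|/point_total[]] := pselect (sval P y); last by left.
right; apply: contrapT => no.
have up (p : {poly k}) : p != 0 -> ~ max_ideal P (map_poly c p).[y].
  by move=> pn0 /(point_poly_root pn0 oy) [r _ h]; apply: no; exists r.
have oj q : sval P (j q).
  have [n [d [dn0 ->]]] := fracP q.
  have -> : j (FracField.tofrac n / FracField.tofrac d) =
      (map_poly c n).[y] / (map_poly c d).[y].
    apply: etrans (fmorph_div j _ _) _; congr (_ / _).
      exact: (morph_tofracE n jc (erefl _)).
    exact: (morph_tofracE d jc (erefl _)).
  apply: pointM; first exact: point_horner.
  by apply: point_unit (up _ dn0); apply: point_horner.
have [s nos] := point_proper P; apply: nos.
have [a [b ->]] := sp s.
(* The trace 2a and the opposite of the norm a^2 - b^2 f of s = a + b w. *)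
apply: (@point_integral _ _ _ P _ (j (a + a)) (j (b ^+ 2 * f - a ^+ 2))) => //.
have -> : j (b ^+ 2 * f - a ^+ 2) = j b ^+ 2 * w ^+ 2 - j a ^+ 2.
  by rewrite ww; apply: rmorph_sqr_sub.
have -> : j (a + a) = j a + j a by exact: rmorphD.
by ring.
Qed.

End AbovePoint.
End QuadraticCurve.

Lemma scaled_relation (F : fieldType) (e d s0 s1 s2 a0 a1 a2 x0 x1 x2 : F) :
  e != 0 -> e * s0 = d * a0 -> e * s1 = d * a1 -> e * s2 = d * a2 ->
  a0 * x0 + a1 * x1 + a2 * x2 = 0 -> s0 * x0 + s1 * x1 + s2 * x2 = 0.
Proof.
move=> en0 h0 h1 h2 E; apply: (mulfI en0).
rewrite mulr0 !mulrDr !mulrA h0 h1 h2.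
by apply: (eq_of_diff d E); ring.
Qed.

Section AboveUniformizer.
Variables (k : numClosedFieldType) (L : fieldType) (c : {rmorphism k -> L}).
Variables (j : {rmorphism fun1 k -> L}) (w : L) (f : fun1 k).
Hypothesis jc : j \o @const1 k =1 c.
Hypothesis ww : w ^+ 2 = j f.
Hypothesis sp : spanned j w.
Local Notation y := (j (y1 k)).

Lemma point_sum_max (P : curve c) n (s t : 'I_n -> L) :
  (forall i, max_ideal P (s i - t i)) ->
  max_ideal P (\sum_(i < n) t i) -> max_ideal P (\sum_(i < n) s i).
Proof.
move=> st ht; rewrite -[X in max_ideal P X](subrK (\sum_(i < n) t i)).
apply: point_maxD ht; rewrite -sumrB.
apply: (big_ind (fun x => max_ideal P x)) => //.
- exact: point_max0.
- exact: point_maxD.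
Qed.

Lemma quadratic_primitive s : exists S : {poly {poly k}},
  [/\ S != 0, poly2_primitive S, size S = 3%N & eval2 c y s S = 0].
Proof.
have [p [sz p0]] := quadratic_relation ww sp s.
have pn0 : p != 0 by rewrite -size_poly_gt0 sz.
by have [S [Sn0 prim sS S0]] := relation_primitive jc pn0 p0; exists S; rewrite sS.
Qed.

(** Reduce a primitive quadratic equation of s at y = 0: it stays nonzero and has the residue of s
    as a root, which is therefore in [k]. *)
Lemma residue_above0 (P : curve c) s : max_ideal P y -> sval P s ->
  exists a, max_ideal P (s - c a).
Proof.
move=> my os; have [S [Sn0 prim sS S0]] := quadratic_primitive s.
have qn0 := prim 0; set q := map_poly _ S in qn0.
suff mq : max_ideal P (map_poly c q).[s].
  by have [r _ h] := point_poly_root qn0 os mq; exists r.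
have sq : (size q <= 3)%N by rewrite -sS; apply: size_poly.
rewrite (horner_map_coef c s sq).
have S3 : (size S <= 3)%N by rewrite sS.
have my0 : max_ideal P (y - c 0) by rewrite rmorph0 subr0.
apply: (point_sum_max (t := fun i : 'I_3 => (map_poly c S`_i).[y] * s ^+ i)); last first.
  by rewrite -(eval2_coef c y s S3) S0; apply: point_max0.
move=> i; rewrite -mulrBl; apply: point_maxM; last first.
  elim: (i : nat) => [|n IH]; first by rewrite expr0 -(rmorph1 c); apply: point_const.
  by rewrite exprS; apply: pointM.
rewrite -opprB; apply: point_maxN; rewrite coef_map; exact: point_horner_residue.
Qed.

(** Given three points, take functions e_i that are units at the i-th point and vanish at the other
    two. In a linear relation among them with coefficients in k[y] not all zero at y = 0, evaluation
    at each point makes one coefficient vanish at 0. *)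
Lemma finite_above0 : finite_set [set P : curve c | max_ideal P y].
Proof.
apply: three_finite => P1 P2 P3 m1 m2 m3.
apply: contrapT => no.
have n12 : P1 <> P2 by move=> h; apply: no; constructor 1.
have n13 : P1 <> P3 by move=> h; apply: no; constructor 2.
have n23 : P2 <> P3 by move=> h; apply: no; constructor 3.
have [e1 [o11 u11 m12 m13]] := separate_three n12 n13.
have [e2 [o22 u22 m21 m23]] := separate_three (not_eq_sym n12) n23.
have [e3 [o33 u33 m31 m32]] := separate_three (not_eq_sym n13) (not_eq_sym n23).
have [a1 [a2 [a3 [an0 E]]]] := linear_dependence sp e1 e2 e3.
(* The three coefficients are stored in one polynomial, so that its primitive part provides
   coefficients not all zero at y = 0. *)
pose p := \poly_(i < 3) nth 0 [:: a1; a2; a3] i.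
have pn0 : p != 0.
  apply/eqP => p0; move: an0.
  have := congr1 (fun q : {poly fun1 k} => q`_0) p0.
  have := congr1 (fun q : {poly fun1 k} => q`_1) p0.
  have := congr1 (fun q : {poly fun1 k} => q`_2) p0.
  by rewrite !coef_poly !coef0 /= => -> -> ->; rewrite eqxx.
have [d [q [dn0 qE]]] := clear_denominators p.
have qn0 : q != 0.
  apply/eqP => q0; move: qE; rewrite q0 rmorph0 => /eqP.
  by rewrite scaler_eq0 tofrac_eq0 (negPf dn0) (negPf pn0).
have [e [S [en0 prim SE]]] := primitive_part qn0.
have coefE i : FracField.tofrac d * p`_i = FracField.tofrac e * FracField.tofrac S`_i :> fun1 k.
  have := congr1 (fun r : {poly fun1 k} => r`_i) qE.
  by rewrite coefZ coef_map SE coefCM /= rmorphM.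
have jE i : j (FracField.tofrac S`_i) = (map_poly c S`_i).[y].
  exact: (morph_tofracE S`_i jc (erefl _)).
have je : j (FracField.tofrac e) != 0 by apply: fmorph_neq0; rewrite tofrac_eq0.
have rel : (map_poly c S`_0).[y] * e1 + (map_poly c S`_1).[y] * e2 + (map_poly c S`_2).[y] * e3 = 0.
  have jS i : j (FracField.tofrac e) * (map_poly c S`_i).[y] =
      j (FracField.tofrac d) * j p`_i.
    rewrite -jE; apply: etrans (esym (rmorphM j _ _)) _.
    by apply: etrans (congr1 j (esym (coefE i))) _; apply: rmorphM.
  have p0 : p`_0 = a1 by rewrite coef_poly.
  have p1 : p`_1 = a2 by rewrite coef_poly.
  have p2 : p`_2 = a3 by rewrite coef_poly.
  have := jS 0%N; have := jS 1%N; have := jS 2%N; rewrite p0 p1 p2 => h2 h1 h0.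
  exact: scaled_relation je h0 h1 h2 E.
have resid (P : curve c) i e' r : max_ideal P y -> sval P e' -> ~ max_ideal P e' ->
    max_ideal P r -> (map_poly c S`_i).[y] * e' + r = 0 -> (S`_i).[0] = 0.
  move=> my oe ne mr rel'; apply: (@point_max_const _ _ _ P).
  have my0 : max_ideal P (y - c 0) by rewrite rmorph0 subr0.
  have oy : sval P y by apply: point_max_sub.
  have mS : max_ideal P (map_poly c S`_i).[y].
    have h : max_ideal P ((map_poly c S`_i).[y] * e').
      have -> : (map_poly c S`_i).[y] * e' = - r by apply/eqP; rewrite -addr_eq0 rel'.
      exact: point_maxN.
    by case: (point_prime (point_horner _ oy) oe h).
  have := point_maxB mS (point_horner_residue S`_i my0).
  by rewrite opprB addrC subrK.
have oh (P : curve c) i : max_ideal P y -> sval P (map_poly c S`_i).[y].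
  by move=> my; apply: point_horner; apply: point_max_sub.
have mh (P : curve c) i e' : max_ideal P y -> max_ideal P e' ->
    max_ideal P ((map_poly c S`_i).[y] * e').
  by move=> my me; rewrite mulrC; apply: point_maxM me (oh _ _ my).
have /negP := prim 0; apply; apply/eqP/polyP => i; rewrite coef0.
have S3 : (size S <= 3)%N.
  have -> : size S = size q by rewrite SE size_Cmul.
  rewrite -(size_map_tofrac q) -qE; apply: leq_trans (size_scale_leq _ _) _.
  exact: size_poly.
have [i3|i3] := ltnP i 3; last first.
  by rewrite nth_default //; apply: leq_trans (size_poly _ _) (leq_trans S3 i3).
rewrite coef_map /= /horner_eval.
case: i i3 => [|[|[|//]]] _.
- apply: (resid P1 0%N e1 _ m1 o11 u11 _ (etrans (addrA _ _ _) rel)).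
  by apply: point_maxD; apply: mh.
- apply: (resid P2 1%N e2 ((map_poly c S`_0).[y] * e1 + (map_poly c S`_2).[y] * e3)) => //.
    by apply: point_maxD; apply: mh.
  by rewrite -rel; ring.
- apply: (resid P3 2%N e3 ((map_poly c S`_0).[y] * e1 + (map_poly c S`_1).[y] * e2)) => //.
    by apply: point_maxD; apply: mh.
  by rewrite -rel; ring.
Qed.

End AboveUniformizer.

Section QuadraticCurveFiniteness.
Variables (k : numClosedFieldType) (L : fieldType) (c : {rmorphism k -> L}).
Variables (j : {rmorphism fun1 k -> L}) (w : L) (f : fun1 k).
Hypothesis jc : j \o @const1 k =1 c.
Hypothesis ww : w ^+ 2 = j f.
Hypothesis sp : spanned j w.
Local Notation y := (j (y1 k)).

(** Replacing y by a homography of y moves any point of the projective line to 0, so the results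
    above 0 apply everywhere. *)
Lemma reparametrize (M : 'M[k]_2) : M \in unitmx ->
  exists (j' : {rmorphism fun1 k -> L}) f',
    [/\ j' \o @const1 k =1 c, w ^+ 2 = j' f', spanned j' w
      & j' (y1 k) = homography (map_mx c M) y].
Proof.
move=> uM; have uV : invmx M \in unitmx by rewrite unitmx_inv.
have [u su] := substitution_ex uM; have [v sv] := substitution_ex uV.
have [_ vu] := substitution_cancel uM su sv; have [uc uy] := su.
exists (j \o u), (v f); split.
- by move=> a; apply: etrans (congr1 j (uc a)) (jc a).
- exact: etrans ww (congr1 j (esym (vu f))).
- move=> z; have [a [b ->]] := sp z; exists (v a), (v b).
  by congr (j _ + j _ * w); apply: esym; apply: vu.
- apply: etrans (congr1 j uy) _; rewrite map_homography -map_mx_comp.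
  by congr (homography _ _); apply: eq_map_mx.
Qed.

Lemma unitmx_shift (a : k) : mx2 1 (- a) 0 1 \in unitmx.
Proof. by rewrite unitmx2 !mxE /= mulr1 mulr0 subr0 oner_neq0. Qed.

Lemma unitmx_inversion : mx2 0 1 1 0 \in @unitmx k 2.
Proof. by rewrite unitmx2 !mxE /= mulr0 mulr1 sub0r oppr_eq0 oner_neq0. Qed.

Lemma homography_shift a s : homography (map_mx c (mx2 1 (- a) 0 1)) s = s - c a.
Proof.
by rewrite homography_map_mx2 rmorph1 rmorph0 rmorphN mul1r mul0r add0r divr1.
Qed.

Lemma homography_inversion s : homography (map_mx c (mx2 0 1 1 0)) s = s^-1.
Proof.
by rewrite homography_map_mx2 rmorph1 rmorph0 mul0r add0r addr0 !mul1r.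
Qed.

Lemma finite_above a : finite_set [set P : curve c | max_ideal P (y - c a)].
Proof.
have [j' [f' [jc' ww' sp' yE]]] := reparametrize (unitmx_shift a).
by have := finite_above0 jc' sp'; rewrite yE homography_shift.
Qed.

Lemma finite_above_infinity : finite_set [set P : curve c | max_ideal P y^-1].
Proof.
have [j' [f' [jc' ww' sp' yE]]] := reparametrize unitmx_inversion.
by have := finite_above0 jc' sp'; rewrite yE homography_inversion.
Qed.

Lemma residue_field (P : curve c) s : sval P s -> exists a, max_ideal P (s - c a).
Proof.
move=> os; have [mV|[a ma]] := point_center jc ww sp P.
  have [j' [f' [jc' ww' sp' yE]]] := reparametrize unitmx_inversion.
  by apply: (residue_above0 jc' ww' sp' _ os); rewrite yE homography_inversion.
have [j' [f' [jc' ww' sp' yE]]] := reparametrize (unitmx_shift a).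
by apply: (residue_above0 jc' ww' sp' _ os); rewrite yE homography_shift.
Qed.

(** Dividing a quadratic equation of s by s^2 shows that its leading coefficient vanishes at each
    pole where y is finite. So poles lie above infinity or above its roots. *)
Lemma finite_poles s : finite_set [set P : curve c | ~ sval P s].
Proof.
have [S [Sn0 prim sS S0]] := quadratic_primitive jc ww sp s.
have l0 : S`_2 != 0.
  by have := lead_coef_eq0 S; rewrite lead_coefE sS (negPf Sn0) => /negbT.
have [rs rE] := closed_field_poly_normal S`_2.
apply: (sub_finite_set (B := [set P : curve c | max_ideal P y^-1] `|`
   \bigcup_(a in [set` rs]) [set P : curve c | max_ideal P (y - c a)])); last first.
  rewrite finite_setU; split; first exact: finite_above_infinity.
  by apply: bigcup_finite => [|a _]; [exact: finite_seq | exact: finite_above].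
move=> P /= /point_total[ms sn0].
have [mV|[a ma]] := point_center jc ww sp P; [by left | right].
exists a => //=; have oy : sval P y.
  by rewrite -(subrK (c a) y); apply: pointD (point_const _ _); apply: point_max_sub.
suff : (S`_2).[a] = 0.
  by move/rootP; rewrite rE rootZ ?lead_coef_eq0 // root_prod_XsubC.
apply: (@point_max_const _ _ _ P).
have m2 : max_ideal P (map_poly c S`_2).[y].
  have S3 : (size S <= 3)%N by rewrite sS.
  have E := eval2_coef c y s S3; rewrite S0 !big_ord_recl big_ord0 /= in E.
  have -> : (map_poly c S`_2).[y] =
      s^-1 * (- (map_poly c S`_1).[y] - s^-1 * (map_poly c S`_0).[y]).
    apply: (mulfI (expf_neq0 2 sn0)).
    apply: (eq_of_diff (-1) E); rewrite /bump /=.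
    by move: (map_poly c S`_2).[y] (map_poly c S`_1).[y] (map_poly c S`_0).[y] => p2 p1 p0; field.
  apply: point_maxM (ms) _; apply: pointB; first by apply: pointN; apply: point_horner.
  by apply: pointM; [apply: point_max_sub | apply: point_horner].
have := point_maxB m2 (point_horner_residue S`_2 ma).
by rewrite opprB addrC subrK.
Qed.

End QuadraticCurveFiniteness.

(** A place only records that its ring is stable under sums; dividing by the term of smaller
    valuation recovers the inequality required of a point. *)
Lemma place_val_min (E F : fieldType) (P : place E F) s t :
  s != 0 -> t != 0 -> s + t != 0 ->
  Order.min (place_val P s) (place_val P t) <= place_val P (s + t).
Proof.
wlog le : s t / place_val P s <= place_val P t => [hw sn0 tn0 stn0|sn0 tn0 stn0].
  have [le|/ltW le] := lerP (place_val P s) (place_val P t).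
    by have := hw _ _ le sn0 tn0 stn0; rewrite min_l.
  by rewrite addrC in stn0 *; have := hw _ _ le tn0 sn0 stn0; rewrite min_l.
rewrite min_l //.
have o : place_ring P (t / s) by right; rewrite place_val_div // subr_ge0.
have := place_ringD (place_ring1 P) o.
have E1 : 1 + t / s = (s + t) / s by rewrite mulrDl divff.
rewrite E1 => -[/eqP|].
  by rewrite mulf_eq0 invr_eq0 (negPf sn0) (negPf stn0).
by rewrite place_val_div // subr_ge0.
Qed.

Lemma place_point (k L F : fieldType) (c : {rmorphism k -> L}) (P : place L F) t :
  t != 0 -> place_val P t = 1 -> (forall a, a != 0 -> place_val P (c a) = 0) ->
  exists Q : curve c, max_ideal Q t.
Proof.
move=> tn0 vt vc; pose O := [set s : L | s = 0 \/ 0 <= place_val P s].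
have dO : is_dvr c O.
  exists (place_val P); split=> //; first by exists t.
    exact: place_valM.
  exact: place_val_min.
exists (exist _ O dO); split=> /=; first by right; rewrite vt.
right=> -[/eqP|]; first by rewrite invr_eq0 (negPf tn0).
by rewrite place_valV // vt.
Qed.

Lemma common_root_factor (k : fieldType) (a : k) (r s : {poly k}) :
  (r != 0) || (s != 0) -> exists n r' s', [/\ r = ('X - a%:P) ^+ n * r',
    s = ('X - a%:P) ^+ n * s' & (r'.[a] != 0) || (s'.[a] != 0)].
Proof.
have [n] := ubnP (size r + size s); elim: n r s => // n IH r s sz nz.
have [ok|] := boolP ((r.[a] != 0) || (s.[a] != 0)).
  by exists 0%N, r, s; rewrite expr0 !mul1r.
rewrite negb_or !negbK => /andP[].
rewrite -!rootE -!dvdp_XsubCl !Pdiv.Field.dvdp_eq.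
set r1 := r %/ _; set s1 := s %/ _ => /eqP rE /eqP sE.
have size1 (p p1 : {poly k}) : p = p1 * ('X - a%:P) -> size p = (size p1 + (p1 != 0%R))%N.
  move=> ->; have [->|p1n0] := eqVneq p1 0; first by rewrite mul0r size_poly0.
  by rewrite size_mul ?polyXsubC_eq0 // size_XsubC addn2 addn1.
have nz1 : (r1 != 0) || (s1 != 0).
  apply: contraLR nz; rewrite !negb_or !negbK rE sE => /andP[/eqP -> /eqP ->].
  by rewrite !mul0r !eqxx.
have [|m [r' [s' [r1E s1E ok]]]] := IH r1 s1 _ nz1.
  move: sz; rewrite (size1 _ _ rE) (size1 _ _ sE); move: nz1.
  by case: (r1 != 0); case: (s1 != 0) => //= _; move: (size r1) (size s1) => x y; lia.
exists m.+1, r', s'; split=> //.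
  by rewrite rE r1E exprSr mulrAC.
by rewrite sE s1E exprSr mulrAC.
Qed.

Lemma rmorph_norm (A B : comNzRingType) (u : {rmorphism A -> B}) r s t :
  u (r ^+ 2 - s ^+ 2 * t) = u r ^+ 2 - u s ^+ 2 * u t.
Proof. by rewrite rmorphB !rmorphM. Qed.

(** * Infinitely many points *)

Section PointsAboveRegularValues.
Variables (k : numClosedFieldType) (L : fieldType) (c : {rmorphism k -> L}).
Variables (j : {rmorphism fun1 k -> L}) (w : L) (F : {poly k}).
Hypothesis jc : j \o @const1 k =1 c.
Hypothesis ww : w ^+ 2 = j (FracField.tofrac F).
Hypothesis nF : nonsquare (FracField.tofrac F).
Hypothesis sp : spanned j w.
Local Notation y := (j (y1 k)).

Let jE (p : {poly k}) : j (FracField.tofrac p) = (map_poly c p).[y].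
Proof. exact: (morph_tofracE p jc (erefl _)). Qed.

Let ww' : w ^+ 2 = (map_poly c F).[y]. Proof. by rewrite ww jE. Qed.

Let poly_free (r s : {poly k}) :
  (map_poly c r).[y] + (map_poly c s).[y] * w = 0 -> r = 0 /\ s = 0.
Proof.
rewrite -!jE => /(quadratic_free ww nF) [/eqP + /eqP].
by rewrite !tofrac_eq0 => /eqP -> /eqP ->.
Qed.

Lemma quadratic_normal_form (s : {poly {poly k}}) : exists q r0 r1,
  s = q * ('X^2 - F%:P) + (r0%:P + r1%:P * 'X).
Proof.
elim/poly_ind: s => [|s d [q [r0 [r1 ->]]]].
  by exists 0, 0, 0; rewrite !mul0r !add0r.
exists (q * 'X + r1%:P), (r1 * F + d), r0.
by rewrite polyCD polyCM; ring.
Qed.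

Section OnePoint.
Variables a b : k.
Hypothesis bn0 : b != 0.
Hypothesis Fa : F.[a] = b ^+ 2.

Let i : {rmorphism {poly {poly k}} -> L} :=
  horner_eval y \o (horner_eval w%:P \o map_poly (map_poly c)).
Let e : {rmorphism {poly {poly k}} -> k} := horner_eval a \o horner_eval b%:P.

Let iC p : i p%:P = (map_poly c p).[y].
Proof. by rewrite /i /= /horner_eval map_polyC hornerC. Qed.

Let eC p : e p%:P = p.[a]. Proof. by rewrite /e /= /horner_eval hornerC. Qed.

Let iX : i 'X = w. Proof. by rewrite /i /= /horner_eval map_polyX hornerX hornerC. Qed.

Let eX : e 'X = b. Proof. by rewrite /e /= /horner_eval hornerX hornerC. Qed.

Let i_nf q r0 r1 : i (q * ('X^2 - F%:P) + (r0%:P + r1%:P * 'X)) =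
  (map_poly c r0).[y] + (map_poly c r1).[y] * w.
Proof.
rewrite rmorphD rmorphM rmorphB rmorphXn iX iC ww' subrr mulr0 add0r.
by rewrite rmorphD rmorphM iX !iC.
Qed.

Let e_nf q r0 r1 : e (q * ('X^2 - F%:P) + (r0%:P + r1%:P * 'X)) =
  r0.[a] + r1.[a] * b.
Proof.
rewrite rmorphD rmorphM rmorphB rmorphXn eX eC Fa subrr mulr0 add0r.
by rewrite rmorphD rmorphM eX !eC.
Qed.

(** At the point (a, b) of w^2 = F(y) with b nonzero, y - a is a uniformizer; [principal_place] is
    applied to k[y][X], mapped to L by X |-> w and to k by evaluation at (a, b). *)
Lemma point_above_regular_value : exists P : curve c, max_ideal P (y - c a).
Proof.
pose p : {poly {poly k}} := ('X - a%:P)%:P.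
have ipE : i p = y - c a.
  by rewrite iC rmorphB /= map_polyX map_polyC hornerD hornerN hornerX hornerC.
have ip0 : i p != 0.
  by rewrite iC -jE; apply: fmorph_neq0; rewrite tofrac_eq0 polyXsubC_eq0.
have [| | |s|z|P [P1 P2 _]] := @principal_place {poly {poly k}} L k i e p.
- move=> s; have [q [r0 [r1 ->]]] := quadratic_normal_form s.
  by rewrite i_nf e_nf => /poly_free[-> ->]; rewrite !horner0 mul0r addr0.
- by rewrite eC hornerXsubC subrr.
- exact: ip0.
- have [q [r0 [r1 ->]]] := quadratic_normal_form s; rewrite i_nf => nz.
  have nz' : (r0 != 0) || (r1 != 0).
    apply: contraR nz; rewrite negb_or !negbK => /andP[/eqP -> /eqP ->].
    by rewrite rmorph0 horner0 mul0r addr0.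
  have [n [s0 [s1 [r0E r1E ok]]]] := common_root_factor a nz'.
  have iE : (map_poly c r0).[y] + (map_poly c r1).[y] * w =
      i p ^+ n * ((map_poly c s0).[y] + (map_poly c s1).[y] * w).
    rewrite ipE r0E r1E !rmorphM rmorphXn rmorphB /= map_polyX map_polyC.
    by rewrite !hornerM horner_exp hornerD hornerN hornerX hornerC; ring.
  pose t := 0 * ('X^2 - F%:P) + (s0%:P + s1%:P * 'X).
  have it : i t = (map_poly c s0).[y] + (map_poly c s1).[y] * w by apply: i_nf.
  have et : e t = s0.[a] + s1.[a] * b by apply: e_nf.
  have [t0|tn0] := eqVneq (e t) 0; last first.
    by exists n, t, 1; rewrite tn0 !rmorph1 oner_neq0 mul1r iE it.
  (* The conjugate of t. It does not vanish at (a, b): otherwise s0 and s1 would both vanish at a,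
     as 2 and b are nonzero. *)
  pose t' := 0 * ('X^2 - F%:P) + (s0%:P + (- s1)%:P * 'X).
  have it' : i t' = (map_poly c s0).[y] - (map_poly c s1).[y] * w.
    by rewrite i_nf rmorphN hornerN mulNr.
  have et' : e t' = s0.[a] - s1.[a] * b by rewrite e_nf hornerN mulNr.
  have t'n0 : e t' != 0.
    apply: contraL ok => /eqP t'0; rewrite negb_or !negbK.
    have two : 2%:R != 0 :> k by rewrite pnatr_eq0.
    have s0a : s0.[a] = 0.
      apply: (mulfI two); rewrite mulr0 -[RHS](addr0 0) -{1}t0 -t'0 et et'; ring.
    rewrite s0a eqxx /=; move: t0; rewrite et s0a add0r => /eqP.
    by rewrite mulf_eq0 (negPf bn0) orbF.
  (* The norm t t' lies in k[y], where powers of y - a can be split off. *)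
  pose N := s0 ^+ 2 - s1 ^+ 2 * F.
  have Nn0 : N != 0.
    apply: contraTneq ok => N0; rewrite negb_or !negbK.
    have NE : (map_poly c s0).[y] ^+ 2 - (map_poly c s1).[y] ^+ 2 * w ^+ 2 = 0.
      rewrite ww' -!horner_exp -hornerM -!rmorphXn -!rmorphM -hornerN -hornerD.
      by rewrite -rmorphB -/N N0 rmorph0 horner0.
    have : ((map_poly c s0).[y] + (map_poly c s1).[y] * w) *
           ((map_poly c s0).[y] + (map_poly c (- s1)).[y] * w) = 0.
      by rewrite rmorphN hornerN -[RHS]NE; ring.
    move=> /eqP; rewrite mulf_eq0 => /orP[] /eqP/poly_free[-> h].
      by rewrite h !horner0 eqxx.
    by move/eqP: h; rewrite oppr_eq0 => /eqP ->; rewrite !horner0 eqxx.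
  have [m [N0 + NE]] := multiplicity_XsubC N a; rewrite Nn0 /= => N0a.
  have eN : e N0%:P != 0 by rewrite eC.
  have E : (map_poly c N).[y] = (map_poly c N0).[y] * i p ^+ m.
    rewrite NE ipE rmorphM rmorphXn rmorphB /= map_polyX map_polyC.
    by rewrite hornerM horner_exp hornerD hornerN hornerX hornerC.
  have E' : (map_poly c N).[y] = (map_poly c s0).[y] ^+ 2 - (map_poly c s1).[y] ^+ 2 * w ^+ 2.
    by rewrite ww'; apply: (rmorph_norm (horner_eval y \o map_poly c)).
  have key : i t' * ((map_poly c r0).[y] + (map_poly c r1).[y] * w) =
      i p ^+ (n + m) * i N0%:P.
    rewrite iE it' (iC N0) exprD.
    move: (etrans (esym E') E).
    move: (i p) (map_poly c N0).[y] (map_poly c s0).[y] (map_poly c s1).[y].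
    move=> x n0 x0 x1 EE; apply: (eq_of_diff (x ^+ n) EE); ring.
  by exists (n + m)%N, N0%:P, t'; exact: And3 eN t'n0 key.
- have [u [v ->]] := sp z.
  have [r0 [d [dn0 ->]]] := fracP u; have [s0 [d' [d'n0 ->]]] := fracP v.
  exists ((r0 * d')%:P + (s0 * d)%:P * 'X), (d * d')%:P.
  have ne q : q != 0 -> (map_poly c q).[y] != 0.
    by move=> qn0; rewrite -jE; apply: fmorph_neq0; rewrite tofrac_eq0.
  have := i_nf 0 (r0 * d') (s0 * d); rewrite mul0r add0r => ->.
  rewrite (iC (d * d')); split; first by apply: ne; rewrite mulf_neq0.
  have jf q q' : j (FracField.tofrac q / FracField.tofrac q') =
      (map_poly c q).[y] / (map_poly c q').[y].
    by apply: etrans (fmorph_div j _ _) _; congr (_ / _); apply: jE.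
  rewrite !jf !rmorphM !hornerM.
  have := ne _ dn0; have := ne _ d'n0.
  by move: (map_poly c d).[y] (map_poly c d').[y] => x x' xn0 x'n0; field; rewrite ?xn0 ?x'n0.
have ec (u : k) : u != 0 -> place_val P (c u) = 0.
  move=> un0; have e1 : e 1 != 0 by rewrite rmorph1 oner_neq0.
  have [o r] := P2 u%:P%:P 1 e1; rewrite !rmorph1 !divr1 iC map_polyC hornerC in o r.
  have rn0 : place_res P (c u) != 0 by rewrite r eC hornerC.
  by have [] := place_res_unit o rn0.
by rewrite -ipE; apply: place_point ec.
Qed.

End OnePoint.

Lemma infinite_field : ~ finite_set [set: k].
Proof.
move=> fin; apply: infinite_nat.
have := @finite_preimage _ _ [set: k] (fun n : nat => n%:R : k).
rewrite preimage_setT; apply=> // x x' _ _ /eqP; rewrite eqr_nat.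
by move/eqP.
Qed.

(** Every a that is not a root of F is the value of y at some point, and a point has at most one
    such value. *)
Lemma infinite_points : ~ finite_set [set: curve c].
Proof.
move=> fin; apply: infinite_field.
have /boolp.choice [g gE] : forall P : curve c, exists a, forall b,
    max_ideal P (y - c b) -> b = a.
  move=> P; have [[a ma]|no] := pselect (exists a, max_ideal P (y - c a)).
    by exists a => b mb; apply: point_residue_uniq mb ma.
  by exists 0 => b mb; case: no; exists b.
have Fn0 : F != 0.
  by have := nF 0; rewrite expr0n tofrac_eq0.
have [rs rE] := closed_field_poly_normal F.
apply: (sub_finite_set (B := [set` rs] `|` g @` [set: curve c])); last first.
  by rewrite finite_setU; split; [exact: finite_seq | exact: finite_image].
move=> a _; have [ra|nra] := boolP (root F a).
  by left => /=; move: ra; rewrite rE rootZ ?lead_coef_eq0 // root_prod_XsubC.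
right; have [b Fb] := closed_sqrt F.[a].
have bn0 : b != 0.
  by apply: contraNneq nra => b0; rewrite rootE Fb b0 expr0n.
have [P mP] := point_above_regular_value bn0 Fb.
by exists P => //; apply/esym; apply: gE.
Qed.

End PointsAboveRegularValues.

Lemma mulr_frac_sqr (F : fieldType) (n t : F) : t != 0 -> n * t = t ^+ 2 * (n / t).
Proof. by move=> tn0; field. Qed.

Lemma scaled_sqrt (K L : fieldType) (j : {rmorphism K -> L}) w f t :
  w ^+ 2 = j f -> (j t * w) ^+ 2 = j (t ^+ 2 * f).
Proof. by move=> ww; rewrite exprMn ww rmorph_sqrM. Qed.

Lemma scaled_spanned (K L : fieldType) (j : {rmorphism K -> L}) w t :
  t != 0 -> spanned j w -> spanned j (j t * w).
Proof.
move=> tn0 sp z; have [a [b ->]] := sp z; exists a, (b / t).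
have jt : j t != 0 by rewrite fmorph_eq0.
by rewrite fmorph_div mulrA divfK.
Qed.

Lemma sqrt_curve_finiteness (k : numClosedFieldType) (f : fun1 k) (nf : nonsquare f) :
  curve_finiteness (sqrt_const nf).
Proof.
pose c : {rmorphism k -> sqrt_ext nf} := sqrt_incl nf \o @const1 k.
have jc : sqrt_incl nf \o @const1 k =1 c by [].
have ww := sqrt_genE nf; have sp := @sqrt_ext_spanned k f nf.
split.
- exact: (finite_poles jc ww sp).
- exact: (residue_field jc ww sp).
have [n [d [nn0 dn0 fE]]] := frac_neq0 (nonsquare_neq0 nf).
pose t : fun1 k := FracField.tofrac d.
have tn0 : t != 0 by rewrite tofrac_eq0.
(* Scaling w by d replaces f = n / d by the polynomial n d, in the same field. *)
have FE : FracField.tofrac (n * d) = t ^+ 2 * f.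
  rewrite fE; apply: etrans (rmorphM _ _ _) _.
  by apply: mulr_frac_sqr.
have nF : nonsquare (FracField.tofrac (n * d)).
  exact: (eq_ind_r (@nonsquare k) (nonsquare_sqrM tn0 nf) FE).
have ww' : (sqrt_incl nf t * sqrt_gen nf) ^+ 2 = sqrt_incl nf (FracField.tofrac (n * d)).
  by rewrite FE; apply: scaled_sqrt.
have sp' : spanned (sqrt_incl nf) (sqrt_incl nf t * sqrt_gen nf).
  exact: scaled_spanned.
exact: (infinite_points jc ww' nF sp').
Qed.

(** * The eight equivalent conditions *)

Lemma scaling_PGL2_Jonq (k : fieldType) phi : scaling_PGL2 k phi -> Jonq k phi.
Proof.
move=> [l [M [ln0 uM ->]]]; exists (mx2 l 0 0 1), M; split.
- exact: unitmx_scaling.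
- exact: uM.
- congr (_, _); exact: esym (homography_scaling _ _ _).
Qed.

Theorem proposition7p15 (R : realType) (f g : fun1 R[i])
    (hf : nonsquare f) (hg : nonsquare g) :
  [<-> conjugate_in (Bir R[i]) (torus f) (torus g);
       conjugate_in (Jonq R[i]) (torus f) (torus g);
       conjugate_in (scaling_PGL2 R[i]) (torus f) (torus g);
       same_orbit f g;
       conjugate_elts_in (Bir R[i]) (iota_inv f) (iota_inv g);
       field_iso_over (sqrt_const hf) (sqrt_const hg);
       exists2 M : 'M[R[i]]_2, M \in unitmx
         & Sodd g = mobius M @` Sodd f;
       curve_iso (sqrt_const hf) (sqrt_const hg)].
Proof.
have two : 2%:R != 0 :> fun1 R[i] by apply: fun1_two.
have h15 := torus_conjugate_iota two hf hg.
have h56 := @conjugate_iota_field_iso R[i] f g hf hg.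
have h64 := @field_iso_same_orbit R[i] f g hf hg.
have h43 := @orbit_conjugate R[i] f g hf.
have h32 : conjugate_in (scaling_PGL2 R[i]) (torus f) (torus g) ->
    conjugate_in (Jonq R[i]) (torus f) (torus g).
  move=> [phi [psi [sphi inv E]]]; exists phi, psi.
  by split; [exact: scaling_PGL2_Jonq | exact: inv | exact: E].
have h21 : conjugate_in (Jonq R[i]) (torus f) (torus g) ->
    conjugate_in (Bir R[i]) (torus f) (torus g).
  move=> [phi [psi [_ inv E]]]; exists phi, psi.
  by split; [exists psi | exact: inv | exact: E].
have h47 := @same_orbit_Sodd R[i] f g (nonsquare_neq0 hf).
have h74 := @Sodd_same_orbit R[i] f g (nonsquare_neq0 hf) (nonsquare_neq0 hg).
have h68 := @field_iso_curve_iso R[i] _ _ (sqrt_const hf) (sqrt_const hg).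
have h86 : curve_iso (sqrt_const hf) (sqrt_const hg) ->
    field_iso_over (sqrt_const hf) (sqrt_const hg).
  exact: (@curve_iso_field_iso R[i] _ _ (sqrt_incl hf \o @const1 R[i])
    (sqrt_incl hg \o @const1 R[i]) (sqrt_curve_finiteness hf)
    (sqrt_curve_finiteness hg)).
(* The goals are the cyclic implications in the order of the list, each routed through the
   implications already proved. *)
tfae.
- by move=> /h15 /h56 /h64 /h43 /h32.
- by move=> /h21 /h15 /h56 /h64 /h43.
- by move=> /h32 /h21 /h15 /h56 /h64.
- by move=> /h43 /h32 /h21 /h15.
- exact: h56.
- by move=> /h64 /h47.
- by move=> /h74 /h43 /h32 /h21 /h15 /h56 /h68.
- by move=> /h86 /h64 /h43 /h32 /h21.
Qed.
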